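(* Let $(R,\mathcal{D}_l,\mathcal{D}_r)$ be a $0$-cell in $\mathcal{IB}_{\sigma}$ and write $Q=Q_{\mathcal{D}_l,\mathcal{D}_r}(R)$. Then the sequence of groups $$0\to\mathcal{U}(\mathcal{Z}(R))\to\mathcal{U}(\mathcal{Z}(Q))\xrightarrow{\varphi_1}\mathrm{Pic}(R\mid Q)\xrightarrow{\varphi_2}\mathrm{Pic}(R,\mathcal{D}_l,\mathcal{D}_r)\xrightarrow{\varphi_3}\mathrm{Pic}(Q,\mathcal{D}'_l,\mathcal{D}'_r)$$ is exact, where the first map is the inclusion, $\varphi_1(x)=xR$, $\varphi_2(M)=[M]$ and $\varphi_3([M])=[Q_{\mathcal{D}_l,\mathcal{D}_r}(M)]$.
   Context: All rings are associative and unital and all modules are unitary. $\mathcal{U}(\mathcal{Z}(A))$ is the group of central invertible elements of a ring $A$. A Gabriel filter of right ideals of a ring $A$ is a nonempty set $\mathcal{D}$ of right ideals such that: right ideals containing members are members; finite intersections of members are members; if $I\in\mathcal{D}$ and $a\in A$ then $\{x\in A: ax\in I\}\in\mathcal{D}$; and if $J\in\mathcal{D}$ and $I$ is a right ideal with $\{x\in A: ax\in I\}\in\mathcal{D}$ for all $a\in J$, then $I\in\mathcal{D}$. Symmetrically for left ideals. A module is $\mathcal{D}$-torsion if each of its elements is annihilated by some member of $\mathcal{D}$, and $\mathcal{D}$-torsion-free if $0$ is the only element annihilated by a member of $\mathcal{D}$; $\mathcal{T}_{\mathcal{D}}$ and $\mathcal{F}_{\mathcal{D}}$ denote these classes. A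 $0$-cell of $\mathcal{IB}_\sigma$ is a triple $(R,\mathcal{D}_l,\mathcal{D}_r)$ with $R$ a unital ring and $\mathcal{D}_l,\mathcal{D}_r$ Gabriel filters of left, resp. right, ideals of $R$ such that $R_R$ is $\mathcal{D}_r$-torsion-free and ${}_RR$ is $\mathcal{D}_l$-torsion-free. An $R$-$R$-bimodule $M$ is invertible if there is an $R$-$R$-bimodule $N$ with $M\otimes_RN\cong R\cong N\otimes_RM$ as bimodules. Put $T_M=-\otimes_RM$ on $\mathrm{Mod}\text{-}R$ and $U_M=M\otimes_R-$ on $R\text{-}\mathrm{Mod}$. $T_M^\sharp(\mathcal{D}_r)=\mathcal{D}_r$ means $T_M(\mathcal{T}_{\mathcal{D}_r})=\mathcal{T}_{\mathcal{D}_r}$ and $T_M(\mathcal{F}_{\mathcal{D}_r})=\mathcal{F}_{\mathcal{D}_r}$ up to isomorphism of modules; $U_M^\sharp(\mathcal{D}_l)=\mathcal{D}_l$ is the analogous condition for left modules. $\mathrm{Pic}(R,\mathcal{D}_l,\mathcal{D}_r)$ is the group, under $\otimes_R$, of isomorphism classes $[M]$ of invertible $R$-$R$-bimodules $M$ with $T_M^\sharp(\mathcal{D}_r)=\mathcal{D}_r$ and $U_M^\sharp(\mathcal{D}_l)=\mathcal{D}_l$. Such an $M$ is $\mathcal{D}_r$-torsion-free on the right and $\mathcal{D}_l$-torsion-free on the left. Two-sided localization: for such $M$, $Q_{\mathcal{D}_l,\mathcal{D}_r}(M)$ is the set of classes of compatible pairs $(f,g)$, where $f:D\to{}_RM$ is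 a left $R$-homomorphism (written on the right) with $D\in\mathcal{D}_l$, $g:H\to M_R$ is a right $R$-homomorphism with $H\in\mathcal{D}_r$, and $x\,g(y)=(x)f\,y$ for all $x\in D$, $y\in H$; two pairs are equivalent if both components agree on smaller members of the filters. For $M=R$, $Q=Q_{\mathcal{D}_l,\mathcal{D}_r}(R)$ is a ring: $[(f_1,g_1)][(f_2,g_2)]$ is the class of $(x\mapsto((x)f_1)f_2,\ y\mapsto g_1(g_2(y)))$ on the natural domains, and $R$ is a subring of $Q$ via $r\mapsto[(x\mapsto xr,\ y\mapsto ry)]$. $Q_{\mathcal{D}_l,\mathcal{D}_r}(M)$ is a $Q$-$Q$-bimodule: for $m=[(f,g)]$, $f:D\to M$, $g:H\to M$, and $q=[(f_1,g_1)]\in Q$, $f_1:I\to R$, $g_1:J\to R$, $q\cdot m$ is the class of $(x\mapsto((x)f_1)f,\ y\mapsto\sum_ig_1(z_i)m_i)$ on $\{x\in I:(x)f_1\in D\}$ and $g^{-1}(JM)$, where $g(y)=\sum_iz_im_i$ with $z_i\in J,m_i\in M$; the right action is symmetric. One has $Q_{\mathcal{D}_l,\mathcal{D}_r}(M)\cong M\otimes_RQ\cong Q\otimes_RM$. Induced filters: $\mathcal{D}'_r$ is the set of right ideals of $Q$ containing $D\cdot Q$ for some $D\in\mathcal{D}_r$; $\mathcal{D}'_l$ is the set of left ideals of $Q$ containing $Q\cdot D$ for some $D\in\mathcal{D}_l$. $(Q,\mathcal{D}'_l,\mathcal{D}'_r)$ is again a $0$-cell and $\mathrm{Pic}(Q,\mathcal{D}'_l,\mathcal{D}'_r)$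 is the group, under $\otimes_Q$, of isomorphism classes $[P]$ of invertible $Q$-$Q$-bimodules $P$ (that is, $P\otimes_QP'\cong Q\cong P'\otimes_QP$ as bimodules for some $Q$-$Q$-bimodule $P'$) such that the functor $T_P=-\otimes_QP$ on $\mathrm{Mod}\text{-}Q$ satisfies $T_P(\mathcal{T}_{\mathcal{D}'_r})=\mathcal{T}_{\mathcal{D}'_r}$ and $T_P(\mathcal{F}_{\mathcal{D}'_r})=\mathcal{F}_{\mathcal{D}'_r}$, and the functor $U_P=P\otimes_Q-$ on $Q\text{-}\mathrm{Mod}$ satisfies $U_P(\mathcal{T}_{\mathcal{D}'_l})=\mathcal{T}_{\mathcal{D}'_l}$ and $U_P(\mathcal{F}_{\mathcal{D}'_l})=\mathcal{F}_{\mathcal{D}'_l}$, up to isomorphism of modules. For an $R$-$R$-subbimodule $M$ of $Q$, $M^{-1}=\{n\in Q: nM\subseteq R,\ Mn\subseteq R\}$. $\mathrm{Pic}(R\mid Q)$ is the group of $R$-$R$-subbimodules $M$ of $Q$ with $MM^{-1}=M^{-1}M=R$, $T_M^\sharp(\mathcal{D}_r)=\mathcal{D}_r$ and $U_M^\sharp(\mathcal{D}_l)=\mathcal{D}_l$; the operation is the product $M_1M_2$ (finite sums of products) and the unit is $R$. *)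

(* Defs.v *)
From HB Require Import structures.
From mathcomp Require Import all_boot all_order all_algebra.
From mathcomp Require Import generic_quotient.
From mathcomp Require Import boolp classical_sets.

Set Implicit Arguments.
Unset Strict Implicit.
Unset Printing Implicit Defensive.

Import GRing.Theory.
Local Open Scope classical_set_scope.
Local Open Scope ring_scope.
Local Open Scope quotient_scope.

(* Conventions.  Rings are [pzRingType] (associative, unital, possibly zero).
   A right A-module is a left module over the converse ring A^c, that is an
   [lmodType A^c]; a right ideal of A is a left ideal of A^c, and so on, so
   that every one-sided notion is defined once, on the left.

   Dictionary.  For a 0-cell C = (R, Dl, Dr) and an R-R-bimodule M:
     tensR X M, tensL M Y     T_M(X), as a right module; U_M(Y), as a left one
     T_sharp, U_sharp         T_M^#(Dr) = Dr, U_M^#(Dl) = Dl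
     Qloc M                   the abelian group Q_{Dl,Dr}(M)
     Qring C, R_to_Q          the ring Q = Q_{Dl,Dr}(R), the embedding R -> Q
     QMbimod hM               Q_{Dl,Dr}(M) as a Q-Q-bimodule, for M in Pic
     ind_l C, ind_r C         the induced filters D'_l, D'_r of Q
     UZ, PicRQ, PicR, PicQ    U(Z(-)), Pic(R|Q), Pic(R,Dl,Dr), Pic(Q,D'_l,D'_r)
     phi1, phi2, phi3         x |-> xR, N |-> [N], [M] |-> [Q_{Dl,Dr}(M)]

   An isomorphism class of bimodules is represented by the predicate of its
   members; equality of classes is then equality of predicates. *)


Section GabrielFilters.
Variable A : pzRingType.
Implicit Types (I J : set A) (D : set (set A)).

Definition left_ideal I :=
  [/\ I 0, forall x y, I x -> I y -> I (x + y) & forall a x, I x -> I (a * x)].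

Record gabriel_filter D : Prop := GabrielFilter {
  gf_ideal : forall I, D I -> left_ideal I;
  gf_nonempty : exists I, D I;
  gf_up : forall I J, D I -> left_ideal J -> I `<=` J -> D J;
  gf_cap : forall I J, D I -> D J -> D (I `&` J);
  gf_colon : forall I a, D I -> D [set x | I (x * a)];
  gf_glue : forall I J, D J -> left_ideal I ->
    (forall a, J a -> D [set x | I (x * a)]) -> D I }.

Definition killed_by D (V : lmodType A) (v : V) :=
  exists2 I, D I & forall a, I a -> a *: v = 0.

Definition torsion D (V : lmodType A) := forall v : V, killed_by D v.

Definition torsion_free D (V : lmodType A) :=
  forall v : V, killed_by D v -> v = 0.

Definition lmod_iso (V W : lmodType A) :=
  exists f : {linear V -> W}, bijective f.

End GabrielFilters.


Record bimod (R S : pzRingType) := Bimod {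
  bm_car :> zmodType;
  lact : R -> bm_car -> bm_car;
  ract : bm_car -> S -> bm_car;
  lactA : forall a b m, lact a (lact b m) = lact (a * b) m;
  lact1 : forall m, lact 1 m = m;
  lactDr : forall a m n, lact a (m + n) = lact a m + lact a n;
  lactDl : forall a b m, lact (a + b) m = lact a m + lact b m;
  ractA : forall m a b, ract (ract m a) b = ract m (a * b);
  ract1 : forall m, ract m 1 = m;
  ractDl : forall m n a, ract (m + n) a = ract m a + ract n a;
  ractDr : forall m a b, ract m (a + b) = ract m a + ract m b;
  lractA : forall a m b, ract (lact a m) b = lact a (ract m b) }.
Arguments lact {R S b} : rename.
Arguments ract {R S b} : rename.
Local Notation "a *> m" := (lact a m) (at level 40, m at level 40).
Local Notation "m <* a" := (ract m a) (at level 40, left associativity).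

Definition bimod_iso R S (M N : bimod R S) :=
  exists f : M -> N, [/\ bijective f, {morph f : x y / x + y},
    forall a x, f (a *> x) = a *> f x & forall x a, f (x <* a) = f x <* a].

Definition regular (R : pzRingType) : bimod R R :=
  @Bimod R R R *%R *%R (@mulrA R) (@mul1r R) (@mulrDr R)
    (fun a b m => mulrDl a b m) (fun m a b => esym (mulrA m a b)) (@mulr1 R)
    (fun m n a => mulrDl m n a) (fun m a b => mulrDr m a b)
    (fun a m b => esym (mulrA a m b)).

Section OneSided.
Variables (R S : pzRingType) (M : bimod R S).

Definition left_of : Type := M.
Definition right_of : Type := M.

HB.instance Definition _ := GRing.Zmodule.on left_of.
HB.instance Definition _ := GRing.Zmodule.on right_of.

Fact left_of_scaleDl (m : left_of) :
  {morph (fun a : R => lact a (m : M) : left_of) : a b / a + b}.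
Proof. by move=> a b; exact: lactDl. Qed.

HB.instance Definition _ := GRing.Zmodule_isLmodule.Build R left_of
  (@lactA _ _ M) (@lact1 _ _ M) (@lactDr _ _ M) left_of_scaleDl.

Definition right_scale (a : S^c) (m : right_of) : right_of :=
  ract (m : M) (a : S).

Fact right_scaleA a b m :
  right_scale a (right_scale b m) = right_scale (a * b) m.
Proof. exact: ractA. Qed.
Fact right_scale1 : left_id 1 right_scale.
Proof. exact: ract1. Qed.
Fact right_scaleDr : right_distributive right_scale +%R.
Proof. by move=> a m n; exact: ractDl. Qed.
Fact right_scaleDl m : {morph right_scale^~ m : a b / a + b}.
Proof. by move=> a b; exact: ractDr. Qed.

HB.instance Definition _ := GRing.Zmodule_isLmodule.Build S^c right_of
  right_scaleA right_scale1 right_scaleDr right_scaleDl.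

End OneSided.


(* X (x)_A Y is the quotient of the free commutative monoid on X * Y (finite
   lists of simple tensors, up to order) by biadditivity and balancedness.
   It is an abelian group because (- x) (x) y is opposite to x (x) y. *)

Section Tensor.
Variables (A : pzRingType) (X : lmodType A^c) (Y : lmodType A).

Inductive tens_rel : seq (X * Y) -> seq (X * Y) -> Prop :=
| tens_refl s : tens_rel s s
| tens_sym s t : tens_rel s t -> tens_rel t s
| tens_trans s t u : tens_rel s t -> tens_rel t u -> tens_rel s u
| tens_cat s s' t t' :
    tens_rel s s' -> tens_rel t t' -> tens_rel (s ++ t) (s' ++ t')
| tens_catC s t : tens_rel (s ++ t) (t ++ s)
| tens_zero y : tens_rel [:: (0, y)] [::]
| tens_addl x x' y : tens_rel [:: (x + x', y)] [:: (x, y); (x', y)]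
| tens_addr x y y' : tens_rel [:: (x, y + y')] [:: (x, y); (x, y')]
| tens_bal x (a : A) y : tens_rel [:: ((a : A^c) *: x, y)] [:: (x, a *: y)].

Definition tens_relb s t := `[< tens_rel s t >].

Fact tens_relb_equiv : equiv_class_of tens_relb.
Proof.
split=> [s|s t|t s u].
- by apply/asboolP; exact: tens_refl.
- by apply/asboolP/asboolP; exact: tens_sym.
- by move=> /asboolP h /asboolP k; apply/asboolP; exact: tens_trans h k.
Qed.
Canonical tens_equiv := EquivRelPack tens_relb_equiv.

Definition tensor := {eq_quot tens_equiv}.
HB.instance Definition _ := Choice.on tensor.
HB.instance Definition _ := EqQuotient.on tensor.

Definition tpi (s : seq (X * Y)) : tensor := \pi s.
Definition tens (x : X) (y : Y) : tensor := tpi [:: (x, y)].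

Lemma tpiP s t : tpi s = tpi t <-> tens_rel s t.
Proof.
split=> [/eqquotP/asboolP //|h]; apply/eqquotP; exact/asboolP.
Qed.

Lemma tpi_repr (u : tensor) : tpi (repr u) = u.
Proof. exact: reprK. Qed.

Lemma tpi_ind (P : tensor -> Prop) : (forall s, P (tpi s)) -> forall u, P u.
Proof. by move=> h u; rewrite -(tpi_repr u). Qed.

Definition tadd (u v : tensor) := tpi (repr u ++ repr v).
Definition topp (u : tensor) := tpi [seq (- p.1, p.2) | p <- repr u].

Lemma tadd_pi s t : tadd (tpi s) (tpi t) = tpi (s ++ t).
Proof.
by apply/tpiP; apply: tens_cat; apply/tpiP; rewrite tpi_repr.
Qed.

Fact taddA : associative tadd.
Proof.
by elim/tpi_ind=> s; elim/tpi_ind=> t; elim/tpi_ind=> u; rewrite !tadd_pi catA.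
Qed.
Fact taddC : commutative tadd.
Proof.
elim/tpi_ind=> s; elim/tpi_ind=> t; rewrite !tadd_pi; apply/tpiP.
exact: tens_catC.
Qed.
Fact tadd0 : left_id (tpi [::]) tadd.
Proof. by elim/tpi_ind=> s; rewrite tadd_pi. Qed.
Fact taddN : left_inverse (tpi [::]) topp tadd.
Proof.
elim/tpi_ind=> s; rewrite /topp.
move: (tpi_repr (tpi s)); move: (repr _) => {}t <-; elim: t => [|[x y] t ih].
  by rewrite tadd0.
rewrite -[(x, y) :: t]/([:: (x, y)] ++ t) map_cat -!tadd_pi.
rewrite [tadd (tpi [:: (x, y)]) _]taddC taddA -(taddA _ (tpi _) (tpi t)) ih.
rewrite [tadd _ (tpi [::])]taddC tadd0 tadd_pi /=; apply/tpiP.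
apply: tens_trans (tens_sym (tens_addl _ _ _)) _; rewrite addNr.
exact: tens_zero.
Qed.

HB.instance Definition _ :=
  GRing.isZmodule.Build tensor taddA taddC tadd0 taddN.

Lemma tpi_cat s t : tpi (s ++ t) = tpi s + tpi t.
Proof. by rewrite -tadd_pi. Qed.

Lemma tpiE s : tpi s = \sum_(p <- s) tens p.1 p.2.
Proof.
elim: s => [|[x y] s ih]; first by rewrite big_nil.
by rewrite big_cons -ih -tpi_cat.
Qed.

Lemma tens_ind (P : tensor -> Prop) : P 0 -> (forall u v, P u -> P v -> P (u + v)) ->
  (forall x y, P (tens x y)) -> forall u, P u.
Proof.
move=> P0 PD Pt; elim/tpi_ind => s; rewrite tpiE.
by elim/big_ind: _ => // -[].
Qed.

Lemma tensDl x x' y : tens (x + x') y = tens x y + tens x' y.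
Proof. by rewrite -tpi_cat; apply/tpiP; exact: tens_addl. Qed.
Lemma tensDr x y y' : tens x (y + y') = tens x y + tens x y'.
Proof. by rewrite -tpi_cat; apply/tpiP; exact: tens_addr. Qed.
Lemma tensZ x (a : A) y : tens ((a : A^c) *: x) y = tens x (a *: y).
Proof. by apply/tpiP; exact: tens_bal. Qed.

Record balanced (G : zmodType) (f : X -> Y -> G) : Prop := Balanced {
  balDl : forall x x' y, f (x + x') y = f x y + f x' y;
  balDr : forall x y y', f x (y + y') = f x y + f x y';
  balZ : forall x (a : A) y, f ((a : A^c) *: x) y = f x (a *: y) }.

Definition tlift (G : zmodType) (f : X -> Y -> G) (u : tensor) : G :=
  \sum_(p <- repr u) f p.1 p.2.

Lemma tlift_pi (G : zmodType) (f : X -> Y -> G) (fb : balanced f) s :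
  tlift f (tpi s) = \sum_(p <- s) f p.1 p.2.
Proof.
have f0 y : f 0 y = 0.
  by apply: (addIr (f 0 y)); rewrite -(balDl fb) !add0r.
rewrite /tlift; have : tens_rel (repr (tpi s)) s by apply/tpiP; rewrite tpi_repr.
move: (repr _) => r; elim=> {r s} // [s t u _ -> _ -> //|s s' t t' _ e _ e'|s t|y|x x' y|x y y'|x a y].
- by rewrite !big_cat /= e e'.
- by rewrite !big_cat /= addrC.
- by rewrite big_nil big_seq1 f0.
- by rewrite !big_cons !big_nil !addr0 (balDl fb).
- by rewrite !big_cons !big_nil !addr0 (balDr fb).
- by rewrite !big_seq1 (balZ fb).
Qed.

Lemma tliftD (G : zmodType) (f : X -> Y -> G) (fb : balanced f) :
  {morph tlift f : u v / u + v}.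
Proof.
elim/tpi_ind=> s; elim/tpi_ind=> t.
by rewrite -tpi_cat !tlift_pi // big_cat.
Qed.

Lemma tliftE (G : zmodType) (f : X -> Y -> G) (fb : balanced f) x y :
  tlift f (tens x y) = f x y.
Proof. by rewrite tlift_pi // big_seq1. Qed.

Lemma tens_ext (G : zmodType) (f g : tensor -> G) :
  {morph f : u v / u + v} -> {morph g : u v / u + v} ->
  (forall x y, f (tens x y) = g (tens x y)) -> f =1 g.
Proof.
move=> fD gD fg; elim/tens_ind=> [|u v|]; [|by rewrite fD gD => -> ->|by []].
have h0 (h : tensor -> G) : {morph h : u v / u + v} -> h 0 = 0.
  by move=> hD; apply: (addIr (h 0)); rewrite -hD !add0r.
by rewrite !h0.
Qed.

End Tensor.

Section TensorRight.
Variables (A S : pzRingType) (X : lmodType A^c) (M : bimod A S).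

Definition tensR : Type := tensor X (left_of M).
HB.instance Definition _ := GRing.Zmodule.on tensR.

Definition tens_ract (u : tensR) (a : S) : tensR :=
  tlift (fun (x : X) (m : left_of M) => tens x ((m : M) <* a : left_of M)) u.

Fact tens_ract_bal a :
  balanced (fun (x : X) (m : left_of M) => tens x ((m : M) <* a : left_of M)).
Proof.
split=> [x x' y|x y y'|x b y]; first exact: tensDl.
- by rewrite -tensDr; congr tens; exact: ractDl.
- by rewrite tensZ; congr tens; symmetry; exact: lractA.
Qed.

Lemma tens_ractD a : {morph tens_ract^~ a : u v / u + v}.
Proof. exact/tliftD/tens_ract_bal. Qed.

Lemma tens_ractE x (m : M) a :
  tens_ract (tens x (m : left_of M)) a = tens x (m <* a : left_of M).
Proof. exact: (tliftE (tens_ract_bal a)). Qed.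

Definition tensR_scale (a : S^c) (u : tensR) : tensR := tens_ract u a.

Fact tensR_scaleA a b u :
  tensR_scale a (tensR_scale b u) = tensR_scale (a * b) u.
Proof.
apply: (tens_ext (f := fun u => tensR_scale a (tensR_scale b u))) u => [u v|u v|x y].
- by rewrite /tensR_scale !tens_ractD.
- exact: tens_ractD.
- by rewrite /tensR_scale !tens_ractE ractA.
Qed.
Fact tensR_scale1 : left_id 1 tensR_scale.
Proof.
move=> u; apply: (tens_ext (g := idfun)) u => // [u v|x y].
  exact: tens_ractD.
by rewrite /tensR_scale tens_ractE ract1.
Qed.
Fact tensR_scaleDr : right_distributive tensR_scale +%R.
Proof. by move=> a u v; exact: tens_ractD. Qed.
Fact tensR_scaleDl u : {morph tensR_scale^~ u : a b / a + b}.
Proof.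
move=> a b.
apply: (tens_ext (g := fun u => tensR_scale a u + tensR_scale b u)) u => [u v|u v|x y].
- exact: tens_ractD.
- by rewrite /tensR_scale !tens_ractD addrACA.
- by rewrite /tensR_scale !tens_ractE ractDr; exact: tensDr.
Qed.

HB.instance Definition _ := GRing.Zmodule_isLmodule.Build S^c tensR
  tensR_scaleA tensR_scale1 tensR_scaleDr tensR_scaleDl.

End TensorRight.

Section TensorLeft.
Variables (A S : pzRingType) (M : bimod S A) (Y : lmodType A).

Definition tensL : Type := tensor (right_of M) Y.
HB.instance Definition _ := GRing.Zmodule.on tensL.

Definition tens_lact (a : S) (u : tensL) : tensL :=
  tlift (fun (m : right_of M) (y : Y) => tens (a *> (m : M) : right_of M) y) u.

Fact tens_lact_bal a :
  balanced (fun (m : right_of M) (y : Y) => tens (a *> (m : M) : right_of M) y).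
Proof.
split=> [x x' y|x y y'|x b y]; last 1 first.
- by rewrite -tensZ; congr tens; symmetry; exact: lractA.
- by rewrite -tensDl; congr tens; exact: lactDr.
- exact: tensDr.
Qed.

Lemma tens_lactD a : {morph tens_lact a : u v / u + v}.
Proof. exact/tliftD/tens_lact_bal. Qed.

Lemma tens_lactE (m : M) y a :
  tens_lact a (tens (m : right_of M) y) = tens (a *> m : right_of M) y.
Proof. exact: (tliftE (tens_lact_bal a)). Qed.

Fact tens_lactA a b u : tens_lact a (tens_lact b u) = tens_lact (a * b) u.
Proof.
apply: (tens_ext (f := fun u => tens_lact a (tens_lact b u))) u => [u v|u v|x y].
- by rewrite !tens_lactD.
- exact: tens_lactD.
- by rewrite !tens_lactE lactA.
Qed.
Fact tens_lact1 : left_id 1 tens_lact.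
Proof.
move=> u; apply: (tens_ext (g := idfun)) u => // [u v|x y].
  exact: tens_lactD.
by rewrite tens_lactE lact1.
Qed.
Fact tens_lactDr : right_distributive tens_lact +%R.
Proof. exact: tens_lactD. Qed.
Fact tens_lactDl u : {morph tens_lact^~ u : a b / a + b}.
Proof.
move=> a b.
apply: (tens_ext (g := fun u => tens_lact a u + tens_lact b u)) u => [u v|u v|x y].
- exact: tens_lactD.
- by rewrite !tens_lactD addrACA.
- by rewrite !tens_lactE lactDl; exact: tensDl.
Qed.

HB.instance Definition _ := GRing.Zmodule_isLmodule.Build S tensL
  tens_lactA tens_lact1 tens_lactDr tens_lactDl.

End TensorLeft.

Section TensorBimodule.
Variables (S A T : pzRingType) (M : bimod S A) (N : bimod A T).

Fact tens_lractA (a : S) (u : tensor (right_of M) (left_of N)) (b : T) :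
  tens_ract (tens_lact a u) b = tens_lact a (tens_ract u b).
Proof.
apply: (tens_ext (f := fun u => tens_ract (tens_lact a u) b)
  (g := fun u => tens_lact a (tens_ract u b))) u => [u v|u v|x y].
- by rewrite tens_lactD; exact: tens_ractD.
- by rewrite -tens_lactD; congr tens_lact; exact: tens_ractD.
- by rewrite tens_lactE !tens_ractE tens_lactE.
Qed.

Definition tensB : bimod S T :=
  @Bimod S T (tensor (right_of M) (left_of N))
    (@tens_lact _ _ M (left_of N)) (@tens_ract _ _ (right_of M) N)
    (@tens_lactA _ _ M (left_of N)) (@tens_lact1 _ _ M (left_of N))
    (@tens_lactDr _ _ M (left_of N))
    (fun a b u => @tens_lactDl _ _ M (left_of N) u a b)
    (fun u a b => @tensR_scaleA _ _ (right_of M) N b a u)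
    (@tensR_scale1 _ _ (right_of M) N)
    (fun u v a => @tensR_scaleDr _ _ (right_of M) N a u v)
    (@tensR_scaleDl _ _ (right_of M) N) tens_lractA.

End TensorBimodule.


(* The isomorphism classes of bimodules live one universe above bimodules,
   hence a plain structure rather than [groupType]: a subset [gmem] of an
   ambient type, with an operation and a unit. *)
Record pregroup := Pregroup {
  gtype : Type;
  gmem : gtype -> Prop;
  gmul : gtype -> gtype -> gtype;
  gone : gtype }.

Record is_group (G : pregroup) : Prop := IsGroup {
  is_gmul : forall x y, gmem x -> gmem y -> @gmem G (gmul x y);
  is_gone : gmem (gone G);
  is_gmulA : forall x y z : gtype G, gmem x -> gmem y -> gmem z ->
    gmul x (gmul y z) = gmul (gmul x y) z;
  is_gmul1 : forall x : gtype G, gmem x ->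
    gmul (gone G) x = x /\ gmul x (gone G) = x;
  is_ginv : forall x : gtype G, gmem x ->
    exists2 y, gmem y & gmul x y = gone G /\ gmul y x = gone G }.

Definition is_hom (G H : pregroup) (f : gtype G -> gtype H) : Prop :=
  (forall x, gmem x -> gmem (f x)) /\
  (forall x y, gmem x -> gmem y -> f (gmul x y) = gmul (f x) (f y)).

Definition trivial_kernel (G H : pregroup) (f : gtype G -> gtype H) : Prop :=
  forall x, gmem x -> f x = gone H -> x = gone G.

Definition exact_at (G H K : pregroup) (f : gtype G -> gtype H)
    (g : gtype H -> gtype K) : Prop :=
  forall y, gmem y -> ((exists2 x, gmem x & f x = y) <-> g y = gone K).

Arguments is_hom : clear implicits.
Arguments trivial_kernel : clear implicits.
Arguments exact_at : clear implicits.


Definition central_unit (A : pzRingType) (x : A) : Prop :=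
  (forall y, x * y = y * x) /\ (exists y, x * y = 1 /\ y * x = 1).

Definition UZ (A : pzRingType) : pregroup :=
  Pregroup (@central_unit A) *%R 1.

Section Pic.
Variables (R : pzRingType) (Dl : set (set R)) (Dr : set (set R^c)).

Definition invertible (M : bimod R R) : Prop :=
  exists N : bimod R R,
    bimod_iso (tensB M N) (regular R) /\ bimod_iso (tensB N M) (regular R).

(* T_M(T_Dr) = T_Dr up to isomorphism: the modules isomorphic to some T_M(N),
   with N torsion, are exactly the torsion modules; likewise for F_Dr. *)
Definition T_sharp (M : bimod R R) : Prop :=
  (forall X : lmodType R^c, torsion Dr X <->
     exists2 N : lmodType R^c, torsion Dr N & lmod_iso (tensR N M) X) /\
  (forall X : lmodType R^c, torsion_free Dr X <->
     exists2 N : lmodType R^c, torsion_free Dr N & lmod_iso (tensR N M) X).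

Definition U_sharp (M : bimod R R) : Prop :=
  (forall X : lmodType R, torsion Dl X <->
     exists2 N : lmodType R, torsion Dl N & lmod_iso (tensL M N) X) /\
  (forall X : lmodType R, torsion_free Dl X <->
     exists2 N : lmodType R, torsion_free Dl N & lmod_iso (tensL M N) X).

Definition in_Pic (M : bimod R R) : Prop :=
  [/\ invertible M, T_sharp M & U_sharp M].

Definition iso_class (M : bimod R R) : bimod R R -> Prop :=
  fun N => bimod_iso M N.

Definition Pic_mem (c : bimod R R -> Prop) : Prop :=
  exists2 M, in_Pic M & c = iso_class M.

(* [M] [N] = [M (x) N], written so as to make sense for arbitrary c and d *)
Definition Pic_mul (c d : bimod R R -> Prop) : bimod R R -> Prop :=
  fun P => exists M N, [/\ c M, d N & bimod_iso (tensB M N) P].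

Definition Pic : pregroup :=
  Pregroup Pic_mem Pic_mul (iso_class (regular R)).

End Pic.


Section QuotientModule.
Variables (A : pzRingType) (V : lmodType A) (P : set V).
Hypothesis P0 : P 0.
Hypothesis PD : forall x y, P x -> P y -> P (x + y).
Hypothesis PZ : forall a x, P x -> P (a *: x).

Definition qm_relb (x y : V) := `[< P (x - y) >].

Fact qm_relb_equiv : equiv_class_of qm_relb.
Proof.
split=> [x|x y|y x z].
- by apply/asboolP; rewrite subrr.
- apply/asboolP/asboolP => /(PZ (-1)); by rewrite scaleN1r opprB.
- move=> /asboolP h /asboolP k; apply/asboolP.
  by rewrite -(subrK y x) -addrA; exact: PD.
Qed.
Definition qm_equiv := EquivRelPack qm_relb_equiv.

Definition quotmod := {eq_quot qm_equiv}.
HB.instance Definition _ := Choice.on quotmod.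

Definition qmpi (x : V) : quotmod := (\pi_{eq_quot qm_equiv} x)%qT.
Definition qmrepr (u : quotmod) : V := repr (u : {eq_quot qm_equiv}).

Lemma qmpiP x y : qmpi x = qmpi y <-> P (x - y).
Proof.
split=> [/eqquotP/asboolP //|h]; apply/eqquotP; exact/asboolP.
Qed.

Lemma qmreprK (u : quotmod) : qmpi (qmrepr u) = u.
Proof. exact: reprK. Qed.

Lemma qm_ind (F : quotmod -> Prop) : (forall x, F (qmpi x)) -> forall u, F u.
Proof. by move=> h u; rewrite -(qmreprK u). Qed.

Lemma qmrepr_pi x : P (qmrepr (qmpi x) - x).
Proof. by apply/qmpiP; rewrite qmreprK. Qed.

Definition qmadd (u v : quotmod) := qmpi (qmrepr u + qmrepr v).
Definition qmopp (u : quotmod) := qmpi (- qmrepr u).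
Definition qmscale a (u : quotmod) := qmpi (a *: qmrepr u).

Lemma qmadd_pi x y : qmadd (qmpi x) (qmpi y) = qmpi (x + y).
Proof. by apply/qmpiP; rewrite opprD addrACA; apply: PD; exact: qmrepr_pi. Qed.
Lemma qmopp_pi x : qmopp (qmpi x) = qmpi (- x).
Proof.
by apply/qmpiP; rewrite -opprD; have /(PZ (-1)) := qmrepr_pi x; rewrite scaleN1r.
Qed.
Lemma qmscale_pi a x : qmscale a (qmpi x) = qmpi (a *: x).
Proof. by apply/qmpiP; rewrite -scalerBr; apply: PZ; exact: qmrepr_pi. Qed.

Fact qmaddA : associative qmadd.
Proof.
by elim/qm_ind=> x; elim/qm_ind=> y; elim/qm_ind=> z; rewrite !qmadd_pi addrA.
Qed.
Fact qmaddC : commutative qmadd.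
Proof. by elim/qm_ind=> x; elim/qm_ind=> y; rewrite !qmadd_pi addrC. Qed.
Fact qmadd0 : left_id (qmpi 0) qmadd.
Proof. by elim/qm_ind=> x; rewrite qmadd_pi add0r. Qed.
Fact qmaddN : left_inverse (qmpi 0) qmopp qmadd.
Proof. by elim/qm_ind=> x; rewrite qmopp_pi qmadd_pi addNr. Qed.

HB.instance Definition _ :=
  GRing.isZmodule.Build quotmod qmaddA qmaddC qmadd0 qmaddN.

Fact qmscaleA a b u : qmscale a (qmscale b u) = qmscale (a * b) u.
Proof. by elim/qm_ind: u => x; rewrite !qmscale_pi scalerA. Qed.
Fact qmscale1 : left_id 1 qmscale.
Proof. by elim/qm_ind=> x; rewrite qmscale_pi scale1r. Qed.
Fact qmscaleDr : right_distributive qmscale +%R.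
Proof.
move=> a; elim/qm_ind=> x; elim/qm_ind=> y.
by rewrite [_ + _]qmadd_pi !qmscale_pi [RHS]qmadd_pi scalerDr.
Qed.
Fact qmscaleDl u : {morph qmscale^~ u : a b / a + b}.
Proof.
move=> a b; elim/qm_ind: u => x.
by rewrite !qmscale_pi [RHS]qmadd_pi scalerDl.
Qed.

HB.instance Definition _ := GRing.Zmodule_isLmodule.Build A quotmod
  qmscaleA qmscale1 qmscaleDr qmscaleDl.

Lemma qmpiD x y : qmpi (x + y) = qmpi x + qmpi y.
Proof. by rewrite [RHS]qmadd_pi. Qed.
Lemma qmpiZ a x : qmpi (a *: x) = a *: qmpi x.
Proof. by rewrite [RHS]qmscale_pi. Qed.

End QuotientModule.


(* A 0-cell of IB_sigma; zc_ltf and zc_rtf say that R is torsion-free as a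
   left, resp. right, module over itself. *)
Record zero_cell := ZeroCell {
  zc_ring :> pzRingType;
  zc_l : set (set zc_ring);
  zc_r : set (set zc_ring^c);
  zc_lP : gabriel_filter zc_l;
  zc_rP : gabriel_filter zc_r;
  zc_ltf : torsion_free zc_l (zc_ring^o);
  zc_rtf : torsion_free zc_r ((zc_ring^c)^o) }.
Arguments zc_l : clear implicits.
Arguments zc_r : clear implicits.

Section Filters.
Variable C : zero_cell.
Local Notation R := (zc_ring C).

Lemma zc_lT : zc_l C setT.
Proof.
have [I DI] := gf_nonempty (zc_lP C).
by apply: (gf_up (zc_lP C) DI).
Qed.
Lemma zc_rT : zc_r C setT.
Proof.
have [I DI] := gf_nonempty (zc_rP C).
by apply: (gf_up (zc_rP C) DI).
Qed.
Lemma zc_lI I J : zc_l C I -> zc_l C J -> zc_l C (I `&` J).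
Proof. exact: (gf_cap (zc_lP C)). Qed.
Lemma zc_rI I J : zc_r C I -> zc_r C J -> zc_r C (I `&` J).
Proof. exact: (gf_cap (zc_rP C)). Qed.
Lemma zc_lid I : zc_l C I -> [/\ I 0, forall x y, I x -> I y -> I (x + y) &
  forall a x : R, I x -> I (a * x)].
Proof. exact: (gf_ideal (zc_lP C)). Qed.
Lemma zc_rid (I : set R) : zc_r C I ->
  [/\ I 0, forall x y : R, I x -> I y -> I (x + y) &
      forall x a : R, I x -> I (x * a)].
Proof. by move/(gf_ideal (zc_rP C)) => -[h k l]; split=> // x a; exact: l. Qed.
Lemma zc_lcolon I (a : R) : zc_l C I -> zc_l C [set x | I (x * a)].
Proof. exact: (gf_colon (zc_lP C)). Qed.
Lemma zc_rcolon (I : set R) (a : R) : zc_r C I -> zc_r C [set x : R | I (a * x)].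
Proof. exact: (gf_colon (zc_rP C)). Qed.
End Filters.

(* A compatible pair (f, g).  The maps f and g are total functions, but only
   their restrictions to the domains matter: the equivalence below ignores
   the other values. *)
Record cpair (C : zero_cell) (M : bimod C C) := CPair {
  ldom : set C;
  lmap : C -> M;
  rdom : set C;
  rmap : C -> M;
  ldomP : zc_l C ldom;
  rdomP : zc_r C rdom;
  lmapD : forall x y, ldom x -> ldom y -> lmap (x + y) = lmap x + lmap y;
  lmapZ : forall a x, ldom x -> lmap (a * x) = a *> lmap x;
  rmapD : forall x y, rdom x -> rdom y -> rmap (x + y) = rmap x + rmap y;
  rmapZ : forall x a, rdom x -> rmap (x * a) = rmap x <* a;
  cpairP : forall x y, ldom x -> rdom y -> x *> rmap y = lmap x <* y }.

Section Localization.
Variables (C : zero_cell) (M : bimod C C).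
Local Notation R := (zc_ring C).
Implicit Types p q r : cpair M.

Definition lagree p q := exists2 D, zc_l C D &
  [/\ D `<=` ldom p, D `<=` ldom q & forall x, D x -> lmap p x = lmap q x].
Definition ragree p q := exists2 H, zc_r C H &
  [/\ H `<=` rdom p, H `<=` rdom q & forall y, H y -> rmap p y = rmap q y].
Definition cequiv p q := lagree p q /\ ragree p q.

Definition cequivb p q := `[< cequiv p q >].

Fact cequivb_equiv : equiv_class_of cequivb.
Proof.
split=> [p|p q|q p r].
- apply/asboolP; split.
    by exists (ldom p); [exact: ldomP|split].
  by exists (rdom p); [exact: rdomP|split].
- apply/asboolP/asboolP => -[[D DD [h k l]] [H HH [h' k' l']]].
    by split; [exists D|exists H] => //; split=> // x ?; rewrite ?l ?l'.
  by split; [exists D|exists H] => //; split=> // x ?; rewrite ?l ?l'.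
- move=> /asboolP[[D DD [h k l]] [H HH [h' k' l']]].
  move=> /asboolP[[E EE [a b c]] [G GG [a' b' c']]]; apply/asboolP; split.
  + exists (D `&` E); first exact: zc_lI.
    by split=> x [Dx Ex]; [exact: h|exact: b|rewrite l // c].
  + exists (H `&` G); first exact: zc_rI.
    by split=> x [Dx Ex]; [exact: h'|exact: b'|rewrite l' // c'].
Qed.

HB.instance Definition _ := gen_eqMixin (cpair M).
HB.instance Definition _ := gen_choiceMixin (cpair M).
Definition cequiv_rel := EquivRelPack cequivb_equiv.

Definition Qloc := {eq_quot cequiv_rel}.
HB.instance Definition _ := Choice.on Qloc.

Definition cls p : Qloc := (\pi_{eq_quot cequiv_rel} p)%qT.
Definition rep (u : Qloc) : cpair M := repr (u : {eq_quot cequiv_rel}).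

Lemma clsP p q : cls p = cls q <-> cequiv p q.
Proof. by split=> [/eqquotP/asboolP //|h]; apply/eqquotP; exact/asboolP. Qed.

Lemma repK u : cls (rep u) = u.
Proof. exact: reprK. Qed.

Lemma Qloc_ind (P : Qloc -> Prop) : (forall p, P (cls p)) -> forall u, P u.
Proof. by move=> h u; rewrite -(repK u). Qed.

Lemma rep_cls p : cequiv (rep (cls p)) p.
Proof. by apply/clsP; rewrite repK. Qed.

Lemma cls_eq p q : ldom p = ldom q -> rdom p = rdom q ->
  (forall x, ldom p x -> lmap p x = lmap q x) ->
  (forall y, rdom p y -> rmap p y = rmap q y) -> cls p = cls q.
Proof.
move=> e e' h h'; apply/clsP; split.
  by exists (ldom p); [exact: ldomP|rewrite -e; split].
by exists (rdom p); [exact: rdomP|rewrite -e'; split].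
Qed.

Section Ops.
Variables p q : cpair M.
Let D := ldom p `&` ldom q.
Let H := rdom p `&` rdom q.

Fact cadd_lD x y : D x -> D y ->
  lmap p (x + y) + lmap q (x + y) = lmap p x + lmap q x + (lmap p y + lmap q y).
Proof. by move=> [a b] [c d]; rewrite !lmapD // addrACA. Qed.
Fact cadd_lZ a x : D x -> lmap p (a * x) + lmap q (a * x) = a *> (lmap p x + lmap q x).
Proof. by move=> [b c]; rewrite !lmapZ // lactDr. Qed.
Fact cadd_rD x y : H x -> H y ->
  rmap p (x + y) + rmap q (x + y) = rmap p x + rmap q x + (rmap p y + rmap q y).
Proof. by move=> [a b] [c d]; rewrite !rmapD // addrACA. Qed.
Fact cadd_rZ x a : H x -> rmap p (x * a) + rmap q (x * a) = (rmap p x + rmap q x) <* a.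
Proof. by move=> [b c]; rewrite !rmapZ // ractDl. Qed.
Fact cadd_c x y : D x -> H y ->
  x *> (rmap p y + rmap q y) = (lmap p x + lmap q x) <* y.
Proof. by move=> [a b] [c d]; rewrite lactDr ractDl !cpairP. Qed.

Definition cadd : cpair M := CPair (zc_lI (ldomP p) (ldomP q))
  (zc_rI (rdomP p) (rdomP q)) cadd_lD cadd_lZ cadd_rD cadd_rZ cadd_c.

Fact lact0 a : a *> (0 : M) = 0.
Proof. by apply: (addIr (a *> 0)); rewrite -lactDr !add0r. Qed.
Fact ract0 a : (0 : M) <* a = 0.
Proof. by apply: (addIr (0 <* a)); rewrite -ractDl !add0r. Qed.
Fact lactN a (m : M) : a *> (- m) = - (a *> m).
Proof. by apply: (addrI (a *> m)); rewrite -lactDr !subrr lact0. Qed.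
Fact ractN (m : M) a : (- m) <* a = - (m <* a).
Proof. by apply: (addrI (m <* a)); rewrite -ractDl !subrr ract0. Qed.

Fact copp_lD x y : ldom p x -> ldom p y -> - lmap p (x + y) = - lmap p x + - lmap p y.
Proof. by move=> a b; rewrite lmapD // opprD. Qed.
Fact copp_lZ a x : ldom p x -> - lmap p (a * x) = a *> - lmap p x.
Proof. by move=> b; rewrite lmapZ // lactN. Qed.
Fact copp_rD x y : rdom p x -> rdom p y -> - rmap p (x + y) = - rmap p x + - rmap p y.
Proof. by move=> a b; rewrite rmapD // opprD. Qed.
Fact copp_rZ x a : rdom p x -> - rmap p (x * a) = (- rmap p x) <* a.
Proof. by move=> b; rewrite rmapZ // ractN. Qed.
Fact copp_c x y : ldom p x -> rdom p y -> x *> - rmap p y = (- lmap p x) <* y.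
Proof. by move=> a b; rewrite lactN ractN cpairP. Qed.

Definition copp : cpair M := CPair (ldomP p) (rdomP p)
  copp_lD copp_lZ copp_rD copp_rZ copp_c.

End Ops.

Section Embedding.
Variable m : M.

Definition cemb : cpair M :=
  @CPair C M setT (fun x => x *> m) setT (fun y => m <* y) (zc_lT C) (zc_rT C)
    (fun x y _ _ => lactDl x y m) (fun a x _ => esym (lactA a x m))
    (fun x y _ _ => ractDr m x y) (fun x a _ => esym (ractA m x a))
    (fun x y _ _ => esym (lractA x m y)).

Definition emb : Qloc := cls cemb.
End Embedding.

Definition Qadd (u v : Qloc) := cls (cadd (rep u) (rep v)).
Definition Qopp (u : Qloc) := cls (copp (rep u)).

Lemma Qadd_cls p q : Qadd (cls p) (cls q) = cls (cadd p q).
Proof.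
apply/clsP; have [[D DD [a b c]] [H HH [a' b' c']]] := rep_cls p.
have [[E EE [d e f]] [G GG [d' e' f']]] := rep_cls q; split.
- exists (D `&` E); first exact: zc_lI.
  by split=> x [Dx Ex] /=; [split; [exact: a|exact: d]|
    split; [exact: b|exact: e]|rewrite c // f].
- exists (H `&` G); first exact: zc_rI.
  by split=> x [Dx Ex] /=; [split; [exact: a'|exact: d']|
    split; [exact: b'|exact: e']|rewrite c' // f'].
Qed.

Lemma Qopp_cls p : Qopp (cls p) = cls (copp p).
Proof.
apply/clsP; have [[D DD [a b c]] [H HH [a' b' c']]] := rep_cls p; split.
- by exists D => //; split=> //= x Dx; rewrite c.
- by exists H => //; split=> //= x Dx; rewrite c'.
Qed.

Fact QaddA : associative Qadd.
Proof.
elim/Qloc_ind=> p; elim/Qloc_ind=> q; elim/Qloc_ind=> r; rewrite !Qadd_cls.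
by apply: cls_eq => [||x _|x _] /=; rewrite ?setIA ?addrA.
Qed.
Fact QaddC : commutative Qadd.
Proof.
elim/Qloc_ind=> p; elim/Qloc_ind=> q; rewrite !Qadd_cls.
by apply: cls_eq => [||x _|x _] /=; rewrite 1?setIC 1?addrC.
Qed.
Fact Qadd0 : left_id (emb 0) Qadd.
Proof.
elim/Qloc_ind=> p; rewrite Qadd_cls.
by apply: cls_eq => [||x _|x _] /=; rewrite ?setTI ?lact0 ?ract0 ?add0r.
Qed.
Fact QaddN : left_inverse (emb 0) Qopp Qadd.
Proof.
elim/Qloc_ind=> p; rewrite Qopp_cls Qadd_cls; apply/clsP; split.
- exists (ldom p); first exact: ldomP.
  by split=> x //= ?; rewrite addNr lact0.
- exists (rdom p); first exact: rdomP.
  by split=> x //= ?; rewrite addNr ract0.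
Qed.

HB.instance Definition _ :=
  GRing.isZmodule.Build Qloc QaddA QaddC Qadd0 QaddN.

Lemma clsD p q : cls p + cls q = cls (cadd p q).
Proof. exact: Qadd_cls. Qed.

Lemma cls_eql p q : torsion_free (zc_l C) (left_of M) -> lagree p q -> cls p = cls q.
Proof.
move=> tf h; apply/clsP; split=> //; have [D DD [a b c]] := h.
exists (rdom p `&` rdom q); first by apply: zc_rI; exact: rdomP.
split=> [x []|x []|y [py qy]] //.
apply/eqP; rewrite -subr_eq0; apply/eqP; apply: (tf (_ : left_of M)).
exists D => // x Dx; apply: etrans (lactDr _ _ _) _.
by rewrite lactN !cpairP ?c ?subrr //; [exact: b|exact: a].
Qed.
Lemma cls_eqr p q : torsion_free (zc_r C) (right_of M) -> ragree p q -> cls p = cls q.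
Proof.
move=> tf h; apply/clsP; split=> //; have [H HH [a b c]] := h.
exists (ldom p `&` ldom q); first by apply: zc_lI; exact: ldomP.
split=> [x []|x []|x [px qx]] //.
apply/eqP; rewrite -subr_eq0; apply/eqP; apply: (tf (_ : right_of M)).
exists H => // y Hy; apply: etrans (ractDl _ _ _) _.
by rewrite ractN -!cpairP ?c ?subrr //; [exact: b|exact: a].
Qed.

End Localization.


Section RingQ.
Variable C : zero_cell.
Local Notation R := (zc_ring C).
Local Notation RR := (regular R).

Fact comp_ldom (p : cpair RR) (E : set R) : zc_l C E ->
  zc_l C [set x | ldom p x /\ E (lmap p x)].
Proof.
move=> EE; have [p0 pD pM] := zc_lid (ldomP p); have [E0 ED EM] := zc_lid EE.
set D := [set x | _].
have D0 : D 0 by split=> //; rewrite -[X in lmap p X](mul0r 0) lmapZ //= mul0r.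
have DD x y : D x -> D y -> D (x + y).
  by move=> [px qx] [py qy]; split; [exact: pD|rewrite lmapD //; exact: ED].
have DM a x : D x -> D (a * x).
  by move=> [px qx]; split; [exact: pM|rewrite lmapZ //; exact: EM].
apply: (gf_glue (zc_lP C) (ldomP p)) => [|a pa]; first by split.
apply: (gf_up (zc_lP C) (zc_lcolon (lmap p a : R) EE)) => [|x px].
  split=> [|x y|b x] /=; first by rewrite mul0r.
    by move=> *; rewrite mulrDl; exact: DD.
  by move=> *; rewrite -mulrA; exact: DM.
by split; [exact: pM|rewrite lmapZ].
Qed.

Fact comp_rdom (q : cpair RR) (K : set R) : zc_r C K ->
  zc_r C [set y : R | rdom q y /\ K (rmap q y)].
Proof.
move=> KK; have [q0 qD qM] := zc_rid (rdomP q); have [K0 KD KM] := zc_rid KK.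
set H : set R := [set x : R | _].
have H0 : H 0 by split=> //; rewrite -[X in rmap q X](mulr0 0) rmapZ //= mulr0.
have HD x y : H x -> H y -> H (x + y).
  by move=> [px qx] [py qy]; split; [exact: qD|rewrite rmapD //; exact: KD].
have HM x a : H x -> H (x * a).
  by move=> [px qx]; split; [exact: qM|rewrite rmapZ //; exact: KM].
apply: (gf_glue (zc_rP C) (rdomP q)) => [|a qa].
  by split=> // a x; exact: HM.
apply: (gf_up (zc_rP C) (zc_rcolon (rmap q a : R) KK)) => [|x px].
  split=> [|x y|b x] /=.
  - by rewrite [_ * _](mulr0 (a : R)).
  - by move=> *; rewrite [_ * _](mulrDr (a : R)); exact: HD.
  - by move=> *; rewrite [_ * _](mulrA (a : R)); exact: HM.
by split; [exact: qM|rewrite rmapZ].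
Qed.

Section Mul.
Variables p q : cpair RR.
Let pl (x : R) : R := lmap p x.
Let pr (x : R) : R := rmap p x.
Let ql (x : R) : R := lmap q x.
Let qr (x : R) : R := rmap q x.
Let D : set R := [set x | ldom p x /\ ldom q (pl x)].
Let H : set R := [set y | rdom q y /\ rdom p (qr y)].

Fact cmul_ld : zc_l C D.
Proof. exact/comp_ldom/ldomP. Qed.
Fact cmul_rd : zc_r C H.
Proof. exact/comp_rdom/rdomP. Qed.
Fact cmul_lD x y : D x -> D y -> ql (pl (x + y)) = ql (pl x) + ql (pl y).
Proof. by move=> [a b] [c d]; rewrite /pl /ql !lmapD. Qed.
Fact cmul_lZ a x : D x -> ql (pl (a * x)) = a * ql (pl x).
Proof. by move=> [b c]; rewrite /pl /ql !lmapZ. Qed.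
Fact cmul_rD x y : H x -> H y -> pr (qr (x + y)) = pr (qr x) + pr (qr y).
Proof. by move=> [a b] [c d]; rewrite /pr /qr !rmapD. Qed.
Fact cmul_rZ x a : H x -> pr (qr (x * a)) = pr (qr x) * a.
Proof. by move=> [b c]; rewrite /pr /qr !rmapZ. Qed.
Fact cmul_c x y : D x -> H y -> x * pr (qr y) = ql (pl x) * y.
Proof.
move=> [a b] [c d].
have /= -> := cpairP a d.
by have /= := cpairP b c.
Qed.

Definition cmul : cpair RR := @CPair C RR D (fun x => ql (pl x)) H
  (fun y => pr (qr y)) cmul_ld cmul_rd cmul_lD cmul_lZ cmul_rD cmul_rZ cmul_c.
End Mul.

Definition Qring : Type := Qloc RR.
HB.instance Definition _ := GRing.Zmodule.on Qring.

Definition Qmul (u v : Qring) : Qring := cls (cmul (rep u) (rep v)).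

Lemma Qmul_cls p q : Qmul (cls p) (cls q) = cls (cmul p q).
Proof.
apply/clsP; have [[D DD [a b c]] [H HH [a' b' c']]] := rep_cls p.
have [[E EE [d e f]] [G GG [d' e' f']]] := rep_cls q.
pose p0 : cpair RR := CPair DD (rdomP p)
  (fun x y Dx Dy => lmapD (b _ Dx) (b _ Dy)) (fun a x Dx => lmapZ a (b _ Dx))
  (@rmapD _ _ p) (@rmapZ _ _ p) (fun x y Dx => cpairP (b _ Dx)).
pose q0 : cpair RR := CPair EE (rdomP q)
  (fun x y Dx Dy => lmapD (e _ Dx) (e _ Dy)) (fun a x Dx => lmapZ a (e _ Dx))
  (@rmapD _ _ q) (@rmapZ _ _ q) (fun x y Dx => cpairP (e _ Dx)).
pose p1 : cpair RR := CPair (ldomP p) HH (@lmapD _ _ p) (@lmapZ _ _ p)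
  (fun x y Dx Dy => rmapD (b' _ Dx) (b' _ Dy)) (fun x a Dx => rmapZ a (b' _ Dx))
  (fun x y px Hy => cpairP px (b' _ Hy)).
pose q1 : cpair RR := CPair (ldomP q) GG (@lmapD _ _ q) (@lmapZ _ _ q)
  (fun x y Dx Dy => rmapD (e' _ Dx) (e' _ Dy)) (fun x a Dx => rmapZ a (e' _ Dx))
  (fun x y px Hy => cpairP px (e' _ Hy)).
split.
- exists (ldom (cmul p0 q0)); first exact: ldomP.
  split=> x [/= Dx Ex].
  + by split=> /=; [exact: a|rewrite c //; exact: d].
  + by split=> /=; [apply/b|apply/e].
  + by rewrite c // f.
- exists (rdom (cmul p1 q1)); first exact: rdomP.
  split=> x [/= Gx Hx].
  + by split=> /=; [exact: d'|rewrite f' //; exact: a'].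
  + by split=> /=; [apply/e'|apply/b'].
  + by rewrite f' // c'.
Qed.

Definition R_to_Q (r : R) : Qring := emb (r : RR).

Lemma cmul_eq (p q : cpair RR) : (forall x, ldom p x = ldom q x) ->
  (forall x, rdom p x = rdom q x) ->
  (forall x, ldom p x -> lmap p x = lmap q x) ->
  (forall y, rdom p y -> rmap p y = rmap q y) -> cls p = cls q.
Proof. by move=> /funext h /funext h'; exact: cls_eq. Qed.

Fact QmulA : associative Qmul.
Proof.
elim/Qloc_ind=> p; elim/Qloc_ind=> q; elim/Qloc_ind=> r; rewrite !Qmul_cls.
by apply: cmul_eq => [x|x|x _|x _] //=; apply/propext; tauto.
Qed.
Fact Qmul1 : left_id (R_to_Q 1) Qmul.
Proof.
elim/Qloc_ind=> p; rewrite Qmul_cls.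
apply: cmul_eq => [x|x|x _|x _] //=; rewrite ?mulr1 ?mul1r //; apply/propext; tauto.
Qed.
Fact Qmulr1 : right_id (R_to_Q 1) Qmul.
Proof.
elim/Qloc_ind=> p; rewrite Qmul_cls.
apply: cmul_eq => [x|x|x _|x _] //=; rewrite ?mulr1 ?mul1r //; apply/propext; tauto.
Qed.
Fact QmulDl : left_distributive Qmul +%R.
Proof.
elim/Qloc_ind=> p; elim/Qloc_ind=> q; elim/Qloc_ind=> r.
rewrite [_ + _]Qadd_cls !Qmul_cls [RHS]Qadd_cls; apply/clsP; split.
- exists (ldom (cadd (cmul p r) (cmul q r))); first exact: ldomP.
  have [_ rD _] := zc_lid (ldomP r).
  by split=> x //= [[a b] [c d]]; [split=> //; exact: rD|rewrite lmapD].
- exists (rdom (cadd (cmul p r) (cmul q r))); first exact: rdomP.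
  by split=> x //= [[a b] [c d]].
Qed.
Fact QmulDr : right_distributive Qmul +%R.
Proof.
elim/Qloc_ind=> p; elim/Qloc_ind=> q; elim/Qloc_ind=> r.
rewrite [_ + _]Qadd_cls !Qmul_cls [RHS]Qadd_cls; apply/clsP; split.
- exists (ldom (cadd (cmul p q) (cmul p r))); first exact: ldomP.
  by split=> x //= [[a b] [c d]].
- exists (rdom (cadd (cmul p q) (cmul p r))); first exact: rdomP.
  have [_ pD _] := zc_rid (rdomP p).
  by split=> x //= [[a b] [c d]]; [split=> //; exact: pD|rewrite rmapD].
Qed.

HB.instance Definition _ := GRing.Zmodule_isPzRing.Build Qring
  QmulA Qmul1 Qmulr1 QmulDl QmulDr.

Fact R_to_Q_is_zmod : {morph R_to_Q : a b / a - b}.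
Proof.
move=> a b.
rewrite (_ : R_to_Q a - R_to_Q b = Qadd (R_to_Q a) (Qopp (R_to_Q b))) // Qopp_cls Qadd_cls.
by apply: cls_eq => [||x _|x _] //=; rewrite ?setIT // ?mulrBr ?mulrBl.
Qed.
Fact R_to_Q_is_monoid : GRing.monoid_morphism R_to_Q.
Proof.
split=> // a b; rewrite [RHS]Qmul_cls.
by apply: cmul_eq => [x|x|x _|x _] //=; rewrite ?mulrA //; apply/propext; tauto.
Qed.

HB.instance Definition _ :=
  GRing.isZmodMorphism.Build R Qring R_to_Q R_to_Q_is_zmod.
HB.instance Definition _ :=
  GRing.isMonoidMorphism.Build R Qring R_to_Q R_to_Q_is_monoid.

End RingQ.


Section SharpFacts.
Variables (C : zero_cell) (M : bimod C C).
Local Notation R := (zc_ring C).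
Hypothesis hM : in_Pic (zc_l C) (zc_r C) M.

Lemma lmod_iso_refl (A : pzRingType) (V : lmodType A) : lmod_iso V V.
Proof. by exists idfun; exists idfun. Qed.

Fact Pic_ltf : torsion_free (zc_l C) (left_of M).
Proof.
case: hM => _ _ [_ tf] m [I DI Im].
have tfT : torsion_free (zc_l C) (tensL M R^o).
  by apply/tf; exists R^o; [exact: zc_ltf|exact: lmod_iso_refl].
have fb : balanced (fun (x : right_of M) (r : R^o) => (x : M) <* (r : R)).
  split=> [x x' y|x y y'|x a y].
  - exact: ractDl.
  - exact: ractDr.
  - exact: ractA.
have t0 : tens (m : right_of M) (1 : R^o) = 0.
  apply: (tfT (tens (m : right_of M) (1 : R^o) : tensL M R^o)).
  exists I => // a Ia; apply: etrans (tens_lactE _ _ _) _.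
  rewrite (Im a Ia : a *> (m : M) = 0).
  by apply: (addIr (tens (0 : right_of M) (1 : R^o))); rewrite -tensDl !add0r.
have := tliftE fb m 1; rewrite t0 ract1 => <-.
have /eqP := tliftD fb 0 0.
by rewrite addr0 addrC -subr_eq subrr eq_sym => /eqP.
Qed.

Fact Pic_rtf : torsion_free (zc_r C) (right_of M).
Proof.
case: hM => _ [_ tf] _ m [I DI Im].
have tfT : torsion_free (zc_r C) (tensR (R^c)^o M).
  by apply/tf; exists (R^c)^o; [exact: zc_rtf|exact: lmod_iso_refl].
have fb : balanced (fun (r : (R^c)^o) (x : left_of M) => (r : R) *> (x : M)).
  split=> [x x' y|x y y'|x a y].
  - exact: lactDl.
  - exact: lactDr.
  - by rewrite [RHS]lactA.
have t0 : tens (1 : (R^c)^o) (m : left_of M) = 0.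
  apply: (tfT (tens (1 : (R^c)^o) (m : left_of M) : tensR (R^c)^o M)).
  exists I => // a Ia; apply: etrans (tens_ractE _ _ _) _.
  rewrite (Im a Ia : (m : M) <* a = 0).
  by apply: (addIr (tens (1 : (R^c)^o) (0 : left_of M))); rewrite -tensDr !add0r.
have := tliftE fb 1 m; rewrite t0 lact1 => <-.
have /eqP := tliftD fb 0 0.
by rewrite addr0 addrC -subr_eq subrr eq_sym => /eqP.
Qed.

End SharpFacts.

(* [lspan J g v w]: v = \sum_i z_i m_i and w = \sum_i g(z_i) m_i for some
   z_i in J and m_i in M.  So v ranges over J M; symmetrically for [rspan]. *)
Section Spans.
Variables (R : pzRingType) (M : bimod R R).
Implicit Types (J : set R) (g : R -> R) (v w : M).

Definition lspan J g v w := exists s : seq (R * M),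
  [/\ forall z, z \in s -> J z.1, v = \sum_(z <- s) z.1 *> z.2
    & w = \sum_(z <- s) g z.1 *> z.2].

Definition rspan J g v w := exists s : seq (M * R),
  [/\ forall z, z \in s -> J z.2, v = \sum_(z <- s) z.1 <* z.2
    & w = \sum_(z <- s) z.1 <* g z.2].

Lemma lspan0 J g : lspan J g 0 0.
Proof. by exists [::]; rewrite !big_nil. Qed.
Lemma rspan0 J g : rspan J g 0 0.
Proof. by exists [::]; rewrite !big_nil. Qed.

Lemma lspanD J g v v' w w' :
  lspan J g v w -> lspan J g v' w' -> lspan J g (v + v') (w + w').
Proof.
move=> [s [sJ -> ->]] [t [tJ -> ->]]; exists (s ++ t); rewrite !big_cat.
by split=> // z; rewrite mem_cat => /orP[/sJ|/tJ].
Qed.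
Lemma rspanD J g v v' w w' :
  rspan J g v w -> rspan J g v' w' -> rspan J g (v + v') (w + w').
Proof.
move=> [s [sJ -> ->]] [t [tJ -> ->]]; exists (s ++ t); rewrite !big_cat.
by split=> // z; rewrite mem_cat => /orP[/sJ|/tJ].
Qed.

Lemma lact_sum a (I : eqType) (s : seq I) (F : I -> M) :
  a *> (\sum_(i <- s) F i) = \sum_(i <- s) a *> F i.
Proof.
elim: s => [|i s ih]; last by rewrite !big_cons lactDr ih.
by rewrite !big_nil; apply: (addIr (a *> (0 : M))); rewrite -lactDr !add0r.
Qed.
Lemma ract_sum a (I : eqType) (s : seq I) (F : I -> M) :
  (\sum_(i <- s) F i) <* a = \sum_(i <- s) F i <* a.
Proof.
elim: s => [|i s ih]; last by rewrite !big_cons ractDl ih.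
by rewrite !big_nil; apply: (addIr ((0 : M) <* a)); rewrite -ractDl !add0r.
Qed.

Lemma lspanM J g v w a : lspan J g v w -> lspan J g (v <* a) (w <* a).
Proof.
move=> [s [sJ -> ->]]; exists [seq (z.1, z.2 <* a) | z <- s]; split.
- by move=> _ /mapP[z /sJ Jz ->].
- by rewrite big_map ract_sum; apply: eq_bigr => z _; rewrite lractA.
- by rewrite big_map ract_sum; apply: eq_bigr => z _; rewrite lractA.
Qed.
Lemma rspanM J g v w a : rspan J g v w -> rspan J g (a *> v) (a *> w).
Proof.
move=> [s [sJ -> ->]]; exists [seq (a *> z.1, z.2) | z <- s]; split.
- by move=> _ /mapP[z /sJ Jz ->].
- by rewrite big_map lact_sum; apply: eq_bigr => z _; rewrite lractA.
- by rewrite big_map lact_sum; apply: eq_bigr => z _; rewrite lractA.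
Qed.

Lemma eq_lspan J J' g g' v w : J `<=` J' -> (forall z, J z -> g z = g' z) ->
  lspan J g v w -> lspan J' g' v w.
Proof.
move=> JJ gg [s [sJ vE wE]]; exists s; split=> //; first by move=> z /sJ /JJ.
by rewrite wE; apply: eq_big_seq => z /sJ Jz; rewrite gg.
Qed.
Lemma eq_rspan J J' g g' v w : J `<=` J' -> (forall z, J z -> g z = g' z) ->
  rspan J g v w -> rspan J' g' v w.
Proof.
move=> JJ gg [s [sJ vE wE]]; exists s; split=> //; first by move=> z /sJ /JJ.
by rewrite wE; apply: eq_big_seq => z /sJ Jz; rewrite gg.
Qed.

Lemma lspanX J g v : (exists w, lspan J g v w) -> lspan J g v (xget 0 (lspan J g v)).
Proof. by move=> [w h]; exact: (xgetPex 0 (ex_intro _ w h)). Qed.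
Lemma rspanX J g v : (exists w, rspan J g v w) -> rspan J g v (xget 0 (rspan J g v)).
Proof. by move=> [w h]; exact: (xgetPex 0 (ex_intro _ w h)). Qed.

End Spans.

Section SpanDomains.
Variables (C : zero_cell) (M : bimod C C).
Local Notation R := (zc_ring C).
Local Notation RR := (regular R).
Hypothesis hM : in_Pic (zc_l C) (zc_r C) M.

(* g^{-1}(J M) is in Dr: apply T_M to the torsion module R / J. *)
Fact rspan_dom (q : cpair RR) (m : cpair M) : zc_r C
  [set y : R | rdom m y /\ exists w, lspan (rdom q) (rmap q) (rmap m y) w].
Proof.
have [q0 qD qM] := zc_rid (rdomP q); have [m0 mD mM] := zc_rid (rdomP m).
have dM (y a : R) : rdom m y -> (exists w, lspan (rdom q) (rmap q) (rmap m y) w) ->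
    exists w, lspan (rdom q) (rmap q) (rmap m (y * a)) w.
  by move=> my [w h]; exists (w <* a); rewrite rmapZ //; exact: lspanM.
have dD (x y : R) : rdom m x -> rdom m y ->
    (exists w, lspan (rdom q) (rmap q) (rmap m x) w) ->
    (exists w, lspan (rdom q) (rmap q) (rmap m y) w) ->
    exists w, lspan (rdom q) (rmap q) (rmap m (x + y)) w.
  by move=> mx my [w h] [w' h']; exists (w + w'); rewrite rmapD //; exact: lspanD.
have d0 : exists w, lspan (rdom q) (rmap q) (rmap m 0) w.
  exists 0; rewrite -[X in rmap m X](mulr0 0) rmapZ //.
  by rewrite [_ <* _](_ : _ = 0); [exact: lspan0|
    apply: (addIr (rmap m 0 <* 0)); rewrite -ractDr !add0r].
apply: (gf_glue (zc_rP C) (rdomP m)) => [|y my].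
  split=> [|x y [mx hx] [my hy]|a x [mx hx]]; first by split.
    by split; [exact: mD|exact: dD].
  by split; [exact: mM|exact: dM].
pose V : lmodType R^c := (R^c)^o.
pose JP : set V := rdom q.
have JPZ a x : JP x -> JP (a *: x) by exact: qM.
pose W : lmodType R^c := quotmod (V := V) q0 qD JPZ.
pose rho : V -> W := @qmpi _ V JP q0 qD JPZ.
have Wt : torsion (zc_r C) W.
  elim/qm_ind => x; exists [set a : R | rdom q ((x : R) * a)].
    exact: (zc_rcolon x (rdomP q)).
  by move=> a qa; rewrite -qmpiZ; apply/qmpiP; rewrite subr0.
have WMt : torsion (zc_r C) (tensR W M).
  by case: hM => _ [t _] _; apply/t; exists W => //; exact: lmod_iso_refl.
pose JM : set (right_of M) := fun v => exists w, lspan (rdom q) (rmap q) v w.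
have JM0 : JM 0 by exists 0; exact: lspan0.
have JMD x z : JM x -> JM z -> JM (x + z).
  by move=> [w h] [w' h']; exists (w + w'); exact: lspanD.
have JMZ a x : JM x -> JM (a *: x).
  by move=> [w h]; exists ((w : M) <* a); exact: lspanM.
pose U : lmodType R^c := quotmod (V := right_of M) JM0 JMD JMZ.
pose pi : right_of M -> U := @qmpi _ _ _ JM0 JMD JMZ.
have piJ (z : R) (v : M) : rdom q z -> JM (z *> v : M).
  move=> qz; exists ((rmap q z : R) *> v); exists [:: (z, v)].
  by rewrite !big_seq1; split=> // z'; rewrite inE => /eqP ->.
pose f (x : W) (v : left_of M) : U := pi ((qmrepr x : R) *> (v : M) : M).
have fE (x : V) v : f (rho x) v = pi ((x : R) *> (v : M) : M).
  apply/qmpiP; pose b : R := qmrepr (rho x); rewrite -/b.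
  have -> : b *> (v : M) - (x : R) *> (v : M) = (b - x : R) *> (v : M).
    by apply: (canLR (addrK _)); rewrite -lactDl subrK.
  exact/piJ/(@qmrepr_pi _ V JP q0 qD JPZ).
have fb : balanced f.
  split; last 1 first.
  - elim/qm_ind=> x a v; rewrite -qmpiZ !fE; congr pi; symmetry; exact: lactA.
  - elim/qm_ind=> x; elim/qm_ind=> x' v; rewrite -qmpiD !fE -qmpiD; congr pi.
    exact: lactDl.
  - elim/qm_ind=> x v v'; rewrite !fE -qmpiD; congr pi; exact: lactDr.
have [K DK Kk] := WMt (tens (rho 1) (rmap m y : left_of M)).
have [k0 kD kM] := zc_rid DK.
apply: (gf_up (zc_rP C) (zc_rI DK (zc_rcolon y (rdomP m)))).
  split=> [|a b [ma ha] [mb hb]|b a [ma ha]] /=.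
  - rewrite [_ * _](mulr0 (y : R)); by split.
  - rewrite [_ * _](mulrDr (y : R)); by split; [exact: mD|exact: dD].
  - rewrite [_ * _](mulrA (y : R)); by split; [exact: mM|exact: dM].
move=> a [Ka ya]; split=> //; rewrite [_ * _](_ : _ = (y : R) * (a : R)) // rmapZ //.
have t0 : tens (rho 1) (rmap m y <* a : left_of M) = 0.
  by rewrite -[RHS](Kk a Ka); symmetry; exact: tens_ractE.
have := tliftE fb (rho 1) (rmap m y <* a); rewrite t0 fE lact1.
have -> : tlift f 0 = 0.
  have /eqP := tliftD fb 0 0.
  by rewrite addr0 addrC -subr_eq subrr eq_sym => /eqP.
by move=> /esym/qmpiP; rewrite subr0.
Qed.

Fact lspan_dom (m : cpair M) (q : cpair RR) : zc_l C
  [set x : R | ldom m x /\ exists w, rspan (ldom q) (lmap q) (lmap m x) w].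
Proof.
have [q0 qD qM] := zc_lid (ldomP q); have [m0 mD mM] := zc_lid (ldomP m).
have dM (a y : R) : ldom m y -> (exists w, rspan (ldom q) (lmap q) (lmap m y) w) ->
    exists w, rspan (ldom q) (lmap q) (lmap m (a * y)) w.
  by move=> my [w h]; exists (a *> w); rewrite lmapZ //; exact: rspanM.
have dD (x y : R) : ldom m x -> ldom m y ->
    (exists w, rspan (ldom q) (lmap q) (lmap m x) w) ->
    (exists w, rspan (ldom q) (lmap q) (lmap m y) w) ->
    exists w, rspan (ldom q) (lmap q) (lmap m (x + y)) w.
  by move=> mx my [w h] [w' h']; exists (w + w'); rewrite lmapD //; exact: rspanD.
have d0 : exists w, rspan (ldom q) (lmap q) (lmap m 0) w.
  exists 0; rewrite -[X in lmap m X](mul0r 0) lmapZ //.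
  by rewrite [_ *> _](_ : _ = 0); [exact: rspan0|
    apply: (addIr (0 *> lmap m 0)); rewrite -lactDl !add0r].
apply: (gf_glue (zc_lP C) (ldomP m)) => [|y my].
  split=> [|x y [mx hx] [my hy]|a x [mx hx]]; first by split.
    by split; [exact: mD|exact: dD].
  by split; [exact: mM|exact: dM].
pose V : lmodType R := R^o.
pose JP : set V := ldom q.
have JPZ a x : JP x -> JP (a *: x) by exact: qM.
pose W : lmodType R := quotmod (V := V) q0 qD JPZ.
pose rho : V -> W := @qmpi _ V JP q0 qD JPZ.
have Wt : torsion (zc_l C) W.
  elim/qm_ind => x; exists [set a : R | ldom q (a * (x : R))].
    exact: (zc_lcolon x (ldomP q)).
  by move=> a qa; rewrite -qmpiZ; apply/qmpiP; rewrite subr0.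
have WMt : torsion (zc_l C) (tensL M W).
  by case: hM => _ _ [t _]; apply/t; exists W => //; exact: lmod_iso_refl.
pose JM : set (left_of M) := fun v => exists w, rspan (ldom q) (lmap q) v w.
have JM0 : JM 0 by exists 0; exact: rspan0.
have JMD x z : JM x -> JM z -> JM (x + z).
  by move=> [w h] [w' h']; exists (w + w'); exact: rspanD.
have JMZ a x : JM x -> JM (a *: x).
  by move=> [w h]; exists (a *> (w : M)); exact: rspanM.
pose U : lmodType R := quotmod (V := left_of M) JM0 JMD JMZ.
pose pi : left_of M -> U := @qmpi _ _ _ JM0 JMD JMZ.
have piJ (z : R) (v : M) : ldom q z -> JM (v <* z : M).
  move=> qz; exists (v <* (lmap q z : R)); exists [:: (v, z)].
  by rewrite !big_seq1; split=> // z'; rewrite inE => /eqP ->.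
pose f (v : right_of M) (x : W) : U := pi ((v : M) <* (qmrepr x : R) : M).
have fE v (x : V) : f v (rho x) = pi ((v : M) <* (x : R) : M).
  apply/qmpiP; pose b : R := qmrepr (rho x); rewrite -/b.
  have -> : (v : M) <* b - (v : M) <* (x : R) = (v : M) <* (b - x : R).
    by apply: (canLR (addrK _)); rewrite -ractDr subrK.
  exact/piJ/(@qmrepr_pi _ V JP q0 qD JPZ).
have fb : balanced f.
  split; last 1 first.
  - move=> v a; elim/qm_ind=> x; rewrite -qmpiZ !fE; congr pi; exact: ractA.
  - move=> v v'; elim/qm_ind=> x; rewrite !fE -qmpiD; congr pi; exact: ractDl.
  - move=> v; elim/qm_ind=> x; elim/qm_ind=> x'; rewrite -qmpiD !fE -qmpiD; congr pi.
    exact: ractDr.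
have [K DK Kk] := WMt (tens (lmap m y : right_of M) (rho 1)).
have [k0 kD kM] := zc_lid DK.
apply: (gf_up (zc_lP C) (zc_lI DK (zc_lcolon y (ldomP m)))).
  split=> [|a b [ma ha] [mb hb]|b a [ma ha]] /=.
  - rewrite mul0r; by split.
  - rewrite mulrDl; by split; [exact: mD|exact: dD].
  - rewrite -mulrA; by split; [exact: mM|exact: dM].
move=> a [Ka ya]; split=> //; rewrite lmapZ //.
have t0 : tens (a *> lmap m y : right_of M) (rho 1) = 0.
  by rewrite -[RHS](Kk a Ka); symmetry; exact: tens_lactE.
have := tliftE fb (a *> lmap m y) (rho 1); rewrite t0 fE ract1.
have -> : tlift f 0 = 0.
  have /eqP := tliftD fb 0 0.
  by rewrite addr0 addrC -subr_eq subrr eq_sym => /eqP.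
by move=> /esym/qmpiP; rewrite subr0.
Qed.

End SpanDomains.

Section LocalizedBimodule.
Variables (C : zero_cell) (M : bimod C C).
Hypothesis hM : in_Pic (zc_l C) (zc_r C) M.
Local Notation R := (zc_ring C).
Local Notation RR := (regular R).
Local Notation ltf := (@Pic_ltf C M hM).
Local Notation rtf := (@Pic_rtf C M hM).
Implicit Types (p q : cpair RR) (m n : cpair M).

Lemma lspan_lact q (v w : M) x : lspan (rdom q) (rmap q) v w -> ldom q x ->
  x *> w = (lmap q x : R) *> v.
Proof.
move=> [s [sq -> ->]] qx; rewrite !lact_sum; apply: eq_big_seq => z /sq qz.
by rewrite !lactA; congr (_ *> _); exact: (cpairP qx qz).
Qed.
Lemma rspan_ract q (v w : M) y : rspan (ldom q) (lmap q) v w -> rdom q y ->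
  w <* y = v <* (rmap q y : R).
Proof.
move=> [s [sq -> ->]] qy; rewrite !ract_sum; apply: eq_big_seq => z /sq qz.
by rewrite !ractA; congr (_ <* _); symmetry; exact: (cpairP qz qy).
Qed.

Lemma ltf_eq (D : set R) (v w : M) : zc_l C D ->
  (forall x, D x -> x *> v = x *> w) -> v = w.
Proof.
move=> DD h; apply/eqP; rewrite -subr_eq0; apply/eqP.
have tf := @Pic_ltf C M hM; apply: (tf (_ : left_of M)); exists D => // x Dx.
by apply: etrans (lactDr _ _ _) _; rewrite lactN h ?subrr.
Qed.
Lemma rtf_eq (H : set R) (v w : M) : zc_r C H ->
  (forall y, H y -> v <* y = w <* y) -> v = w.
Proof.
move=> HH h; apply/eqP; rewrite -subr_eq0; apply/eqP.
have tf := @Pic_rtf C M hM; apply: (tf (_ : right_of M)); exists H => // x Dx.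
by apply: etrans (ractDl _ _ _) _; rewrite ractN h ?subrr.
Qed.

Lemma lspan_get q (v w : M) : lspan (rdom q) (rmap q) v w ->
  xget 0 (lspan (rdom q) (rmap q) v) = w.
Proof.
move=> h; apply: (ltf_eq (ldomP q)) => x qx.
have h0 := lspanX (ex_intro _ w h).
by rewrite (lspan_lact h0 qx) (lspan_lact h qx).
Qed.
Lemma rspan_get q (v w : M) : rspan (ldom q) (lmap q) v w ->
  xget 0 (rspan (ldom q) (lmap q) v) = w.
Proof.
move=> h; apply: (rtf_eq (rdomP q)) => x qx.
have h0 := rspanX (ex_intro _ w h).
by rewrite (rspan_ract h0 qx) (rspan_ract h qx).
Qed.

Section Actions.
Variables (q : cpair RR) (m : cpair M).

Let D : set R := [set x | ldom q x /\ ldom m (lmap q x)].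
Let H : set R :=
  [set y | rdom m y /\ exists w, lspan (rdom q) (rmap q) (rmap m y) w].
Let f (x : R) : M := lmap m (lmap q x).
Let g (y : R) : M := xget 0 (lspan (rdom q) (rmap q) (rmap m y)).

Fact gE y : H y -> lspan (rdom q) (rmap q) (rmap m y) (g y).
Proof. by move=> [_ h]; exact: lspanX. Qed.
Fact clact_lD x y : D x -> D y -> f (x + y) = f x + f y.
Proof. by move=> [a b] [c d]; rewrite /f !lmapD. Qed.
Fact clact_lZ a x : D x -> f (a * x) = a *> f x.
Proof. by move=> [b c]; rewrite /f !lmapZ. Qed.
Fact clact_rD x y : H x -> H y -> g (x + y) = g x + g y.
Proof.
move=> Hx Hy; apply: lspan_get; rewrite rmapD; [|by case: Hx|by case: Hy].
by apply: lspanD; exact: gE.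
Qed.
Fact clact_rZ x a : H x -> g (x * a) = g x <* a.
Proof.
move=> Hx; apply: lspan_get; rewrite rmapZ; last by case: Hx.
by apply: lspanM; exact: gE.
Qed.
Fact clact_c x y : D x -> H y -> x *> g y = f x <* y.
Proof.
move=> [qx mx] Hy; rewrite (lspan_lact (gE Hy)) //.
by apply: cpairP => //; case: Hy.
Qed.

(* q . m: on the left x |-> ((x)f1)f; on the right, with g(y) = \sum z_i m_i
   and z_i in J, y |-> \sum g1(z_i) m_i on g^{-1}(J M). *)
Definition clact : cpair M := @CPair C M D f H g
  (comp_ldom q (ldomP m)) (rspan_dom hM q m)
  clact_lD clact_lZ clact_rD clact_rZ clact_c.

Let D' : set R :=
  [set x | ldom m x /\ exists w, rspan (ldom q) (lmap q) (lmap m x) w].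
Let H' : set R := [set y | rdom q y /\ rdom m (rmap q y)].
Let f' (x : R) : M := xget 0 (rspan (ldom q) (lmap q) (lmap m x)).
Let g' (y : R) : M := rmap m (rmap q y).

Fact f'E x : D' x -> rspan (ldom q) (lmap q) (lmap m x) (f' x).
Proof. by move=> [_ h]; exact: rspanX. Qed.
Fact cract_lD x y : D' x -> D' y -> f' (x + y) = f' x + f' y.
Proof.
move=> Hx Hy; apply: rspan_get; rewrite lmapD; [|by case: Hx|by case: Hy].
by apply: rspanD; exact: f'E.
Qed.
Fact cract_lZ a x : D' x -> f' (a * x) = a *> f' x.
Proof.
move=> Hx; apply: rspan_get; rewrite lmapZ; last by case: Hx.
by apply: rspanM; exact: f'E.
Qed.
Fact cract_rD x y : H' x -> H' y -> g' (x + y) = g' x + g' y.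
Proof. by move=> [a b] [c d]; rewrite /g' !rmapD. Qed.
Fact cract_rZ x a : H' x -> g' (x * a) = g' x <* a.
Proof. by move=> [b c]; rewrite /g' !rmapZ. Qed.
Fact cract_c x y : D' x -> H' y -> x *> g' y = f' x <* y.
Proof.
move=> Hx [qy my]; rewrite (rspan_ract (f'E Hx)) //.
by apply: cpairP => //; case: Hx.
Qed.

Definition cract : cpair M := @CPair C M D' f' H' g'
  (lspan_dom hM m q) (comp_rdom q (rdomP m))
  cract_lD cract_lZ cract_rD cract_rZ cract_c.
End Actions.

Definition Qlact (u : Qring C) (v : Qloc M) : Qloc M := cls (clact (rep u) (rep v)).
Definition Qract (v : Qloc M) (u : Qring C) : Qloc M := cls (cract (rep u) (rep v)).

Definition crestr (N : bimod C C) (p : cpair N) (D : set R) (H : set R)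
    (DD : zc_l C D) (HH : zc_r C H) (Dp : D `<=` ldom p)
    (Hp : (H : set R) `<=` rdom p) : cpair N :=
  @CPair C N D (lmap p) H (rmap p) DD HH
    (fun x y Dx Dy => lmapD (Dp _ Dx) (Dp _ Dy)) (fun a x Dx => lmapZ a (Dp _ Dx))
    (fun x y Dx Dy => rmapD (Hp _ Dx) (Hp _ Dy)) (fun x a Dx => rmapZ a (Hp _ Dx))
    (fun x y Dx Hy => cpairP (Dp _ Dx) (Hp _ Hy)).

Lemma Qlact_cls q m : Qlact (cls q) (cls m) = cls (clact q m).
Proof.
apply: (cls_eql ltf).
have [[D DD [a b c]] _] := rep_cls q; have [[E EE [d e f]] _] := rep_cls m.
pose q0 := crestr DD (rdomP q) b (fun _ => id).
exists [set x | ldom q0 x /\ E (lmap q0 x)]; first exact: comp_ldom.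
split=> x [/= Dx Ex].
- by split=> /=; [apply/a|rewrite c //; apply/d].
- by split=> /=; [apply/b|apply/e].
- by rewrite c // f.
Qed.
Lemma Qract_cls m q : Qract (cls m) (cls q) = cls (cract q m).
Proof.
apply: (cls_eqr rtf).
have [_ [D DD [a b c]]] := rep_cls q; have [_ [E EE [d e f]]] := rep_cls m.
pose q0 := crestr (ldomP q) DD (fun _ => id) b.
exists [set x : R | rdom q0 x /\ E (rmap q0 x)]; first exact: comp_rdom.
split=> x [/= Dx Ex].
- by split=> /=; [apply/a|rewrite c //; apply/d].
- by split=> /=; [apply/b|apply/e].
- by rewrite c // f.
Qed.

Lemma cls_lext m n (D : set R) : zc_l C D ->
  (forall x, D x -> [/\ ldom m x, ldom n x & lmap m x = lmap n x]) ->
  cls m = cls n.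
Proof.
move=> DD h; apply: (cls_eql ltf); exists D => //.
by split=> x /h[].
Qed.
Lemma cls_rext m n (D : set R) : zc_r C D ->
  (forall x, D x -> [/\ rdom m x, rdom n x & rmap m x = rmap n x]) ->
  cls m = cls n.
Proof.
move=> DD h; apply: (cls_eqr rtf); exists D => //.
by split=> x /h[].
Qed.

Fact QlactA a b u : Qlact a (Qlact b u) = Qlact (a * b) u.
Proof.
elim/Qloc_ind: a => p; elim/Qloc_ind: b => q; elim/Qloc_ind: u => m.
rewrite [_ * _]Qmul_cls !Qlact_cls.
apply: (cls_lext (ldomP (clact p (clact q m)))) => x /= [h [k l]].
by split.
Qed.
Fact Qlact1 u : Qlact 1 u = u.
Proof.
elim/Qloc_ind: u => m; rewrite Qlact_cls.
by apply: (cls_lext (ldomP m)) => x mx /=; rewrite mulr1.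
Qed.
Fact QlactDr a u v : Qlact a (u + v) = Qlact a u + Qlact a v.
Proof.
elim/Qloc_ind: a => p; elim/Qloc_ind: u => m; elim/Qloc_ind: v => n.
rewrite clsD !Qlact_cls clsD.
apply: (cls_lext (ldomP (clact p (cadd m n)))) => x /= [h [k l]].
by split.
Qed.
Fact QlactDl a b u : Qlact (a + b) u = Qlact a u + Qlact b u.
Proof.
elim/Qloc_ind: a => p; elim/Qloc_ind: b => q; elim/Qloc_ind: u => m.
rewrite [_ + _]Qadd_cls !Qlact_cls clsD.
have [_ mD _] := zc_lid (ldomP m).
apply: (cls_lext (ldomP (cadd (clact p m) (clact q m)))) => x /= [[h k] [h' k']].
by split=> //; [split=> //; exact: mD|rewrite lmapD].
Qed.
Fact QractA u a b : Qract (Qract u a) b = Qract u (a * b).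
Proof.
elim/Qloc_ind: a => p; elim/Qloc_ind: b => q; elim/Qloc_ind: u => m.
rewrite [_ * _]Qmul_cls !Qract_cls.
apply: (cls_rext (rdomP (cract q (cract p m)))) => x /= [h [k l]].
by split.
Qed.
Fact Qract1 u : Qract u 1 = u.
Proof.
elim/Qloc_ind: u => m; rewrite Qract_cls.
by apply: (cls_rext (rdomP m)) => x mx /=; rewrite mul1r.
Qed.
Fact QractDl u v a : Qract (u + v) a = Qract u a + Qract v a.
Proof.
elim/Qloc_ind: a => p; elim/Qloc_ind: u => m; elim/Qloc_ind: v => n.
rewrite clsD !Qract_cls clsD.
apply: (cls_rext (rdomP (cract p (cadd m n)))) => x /= [h [k l]].
by split.
Qed.
Fact QractDr u a b : Qract u (a + b) = Qract u a + Qract u b.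
Proof.
elim/Qloc_ind: a => p; elim/Qloc_ind: b => q; elim/Qloc_ind: u => m.
rewrite [_ + _]Qadd_cls !Qract_cls clsD.
have [_ mD _] := zc_rid (rdomP m).
apply: (cls_rext (rdomP (cadd (cract p m) (cract q m)))) => x /= [[h k] [h' k']].
by split=> //; [split=> //; exact: mD|rewrite rmapD].
Qed.
Fact QlractA a u b : Qract (Qlact a u) b = Qlact a (Qract u b).
Proof.
elim/Qloc_ind: a => p; elim/Qloc_ind: b => q; elim/Qloc_ind: u => m.
rewrite (Qract_cls m q) !Qlact_cls Qract_cls.
apply: (cls_lext (ldomP (clact p (cract q m)))) => x /= [h [k [w l]]].
by do ![split=> //]; exists w.
Qed.

Definition QMbimod : bimod (Qring C) (Qring C) :=
  @Bimod (Qring C) (Qring C) (Qloc M) Qlact Qract QlactA Qlact1 QlactDr QlactDl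
    QractA Qract1 QractDl QractDr QlractA.

End LocalizedBimodule.


Section SubBimodules.
Variable C : zero_cell.
Local Notation R := (zc_ring C).
Local Notation Q := (Qring C).
Implicit Types N : set Q.

Definition RinQ : set Q := range (@R_to_Q C).

Record sub_bimod N : Prop := SubBimod {
  sb0 : N 0;
  sbD : forall x y, N x -> N y -> N (x + y);
  sbl : forall (a : R) x, N x -> N (R_to_Q a * x);
  sbr : forall x (a : R), N x -> N (x * R_to_Q a) }.

Section Carrier.
Variables (N : set Q) (hN : sub_bimod N).

Definition sub_of of sub_bimod N : Type := {x : Q | N x}.
Local Notation T := (sub_of hN).

HB.instance Definition _ := gen_eqMixin T.
HB.instance Definition _ := gen_choiceMixin T.

Fact sub_inj (x y : T) : sval x = sval y -> x = y.
Proof. by case: x y => [x Nx] [y Ny] /= e; exact: eq_exist. Qed.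

Fact sbN x : N x -> N (- x).
Proof. by move/(sbl hN (-1)); rewrite rmorphN1 mulN1r. Qed.

Definition sub_zero : T := exist _ 0 (sb0 hN).
Definition sub_add (x y : T) : T := exist _ _ (sbD hN (svalP x) (svalP y)).
Definition sub_opp (x : T) : T := exist _ _ (sbN (svalP x)).
Definition sub_lact (a : R) (x : T) : T := exist _ _ (sbl hN a (svalP x)).
Definition sub_ract (x : T) (a : R) : T := exist _ _ (sbr hN a (svalP x)).

Fact sub_addA : associative sub_add.
Proof. by move=> x y z; apply: sub_inj; rewrite /= addrA. Qed.
Fact sub_addC : commutative sub_add.
Proof. by move=> x y; apply: sub_inj; rewrite /= addrC. Qed.
Fact sub_add0 : left_id sub_zero sub_add.
Proof. by move=> x; apply: sub_inj; rewrite /= add0r. Qed.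
Fact sub_addN : left_inverse sub_zero sub_opp sub_add.
Proof. by move=> x; apply: sub_inj; rewrite /= addNr. Qed.

HB.instance Definition _ :=
  GRing.isZmodule.Build T sub_addA sub_addC sub_add0 sub_addN.

Fact sub_lactA a b x : sub_lact a (sub_lact b x) = sub_lact (a * b) x.
Proof. by apply: sub_inj; rewrite /= rmorphM mulrA. Qed.
Fact sub_lact1 x : sub_lact 1 x = x.
Proof. by apply: sub_inj; rewrite /= rmorph1 mul1r. Qed.
Fact sub_lactDr a x y : sub_lact a (x + y) = sub_lact a x + sub_lact a y.
Proof. by apply: sub_inj; rewrite /= mulrDr. Qed.
Fact sub_lactDl a b x : sub_lact (a + b) x = sub_lact a x + sub_lact b x.
Proof. by apply: sub_inj; rewrite /= rmorphD mulrDl. Qed.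
Fact sub_ractA x a b : sub_ract (sub_ract x a) b = sub_ract x (a * b).
Proof. by apply: sub_inj; rewrite /= rmorphM mulrA. Qed.
Fact sub_ract1 x : sub_ract x 1 = x.
Proof. by apply: sub_inj; rewrite /= rmorph1 mulr1. Qed.
Fact sub_ractDl x y a : sub_ract (x + y) a = sub_ract x a + sub_ract y a.
Proof. by apply: sub_inj; rewrite /= mulrDl. Qed.
Fact sub_ractDr x a b : sub_ract x (a + b) = sub_ract x a + sub_ract x b.
Proof. by apply: sub_inj; rewrite /= rmorphD mulrDr. Qed.
Fact sub_lractA a x b : sub_ract (sub_lact a x) b = sub_lact a (sub_ract x b).
Proof. by apply: sub_inj; rewrite /= mulrA. Qed.

Definition sub_bm : bimod R R :=
  @Bimod R R T sub_lact sub_ract sub_lactA sub_lact1 sub_lactDr sub_lactDl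
    sub_ractA sub_ract1 sub_ractDl sub_ractDr sub_lractA.

End Carrier.

Definition set_prod (A B : set Q) : set Q :=
  [set x | exists s : seq (Q * Q),
     (forall z, z \in s -> A z.1 /\ B z.2) /\ x = \sum_(z <- s) z.1 * z.2].

Definition set_inv N : set Q :=
  [set n | forall m, N m -> RinQ (n * m) /\ RinQ (m * n)].

Definition PicRQ_mem N : Prop := exists hN : sub_bimod N,
  [/\ set_prod N (set_inv N) = RinQ, set_prod (set_inv N) N = RinQ,
      T_sharp (zc_r C) (sub_bm hN) & U_sharp (zc_l C) (sub_bm hN)].

Definition PicRQ : pregroup := Pregroup PicRQ_mem set_prod RinQ.

Definition ind_l : set (set Q) :=
  [set J | left_ideal J /\
     exists2 D : set R, zc_l C D & set_prod setT (@R_to_Q C @` D) `<=` J].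
Definition ind_r : set (set Q^c) :=
  [set J | @left_ideal Q^c J /\
     exists2 D : set R, zc_r C D & set_prod (@R_to_Q C @` D) setT `<=` J].

Definition PicR : pregroup := Pic (zc_l C) (zc_r C).
Definition PicQ : pregroup := Pic ind_l ind_r.

Definition phi1 (x : Q) : set Q := [set x * R_to_Q r | r in [set: R]].

Definition phi2 N : bimod R R -> Prop :=
  fun P => exists hN : sub_bimod N, bimod_iso (sub_bm hN) P.

Definition phi3 (c : bimod R R -> Prop) : bimod Q Q -> Prop :=
  fun P => exists (M : bimod R R) (hM : in_Pic (zc_l C) (zc_r C) M),
    c M /\ bimod_iso (QMbimod hM) P.

End SubBimodules.

(* Main.v *)
(* An invertible bimodule M, with inverse N, has compatible pairings
   (-,-) : M x N -> R and [-,-] : N x M -> R and dual bases, so that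
   m = sum_i a_i [a'_i, m].  For n in N and z in Q(M), a unique element [n, z]
   of Q extends the pairing; then z = sum_i a_i [a'_i, z], so that
   Q(M) = M (x)_R Q, and symmetrically Q(M) = Q (x)_R M.  Hence Q-linear maps
   on Q(M) are determined by their restrictions to M, which gives
   Q(M (x)_R N) = Q(M) (x)_Q Q(N), and X (x)_Q Q(M) = X (x)_R M for a right
   Q-module X, which transports the conditions on the torsion classes.

   For exactness at Pic(R, Dl, Dr): if Q(M) = Q, then also Q(M') = Q for the
   inverse M' of M, and M, M' embed in Q with images N, N' such that
   N N' = u R with u central in Q.  Since N and N' contain members of the
   filters, so does u R, and u r |-> r defines an inverse w of u in Q;
   then w N' is the inverse of N. *)
From HB Require Import structures.
Require Import Defs.
From mathcomp Require Import all_boot all_algebra.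
From mathcomp Require Import boolp classical_sets.

Set Implicit Arguments.
Unset Strict Implicit.
Unset Printing Implicit Defensive.

Import GRing.Theory.
Local Open Scope classical_set_scope.
Local Open Scope ring_scope.

Local Notation "a *> m" := (lact a m) (at level 40, m at level 40).
Local Notation "m <* a" := (ract m a) (at level 40, left associativity).
Local Notation additive f := {morph f : u v / u + v}.

(** The two isomorphisms that make M invertible are chosen independently, so the pairings that they
    induce need not be associative; correcting one of them by an automorphism of M gives a Morita
    context.

    An element of Q(M) is a pair of maps, and torsion-freeness makes either component determine the
    other. Equalities are therefore tested on one side only, by multiplying with the elements of a
    member of one filter, whereas constructing an element such as [n, z] takes both components. The
    second component exists because torsion modules remain torsion after tensoring with N.

    In the last exactness, N (wN') = R settles only one order of the product. The other order gives
    (wN') N = vR with v central, and v is invertible for the same reason as u. Since N (wN') = R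
    makes vR idempotent, v cancels in v^2 R = vR, and vR = R. *)

Section Additive.
Variables (U V : zmodType) (f : U -> V).
Hypothesis fD : additive f.

Lemma addf0 : f 0 = 0.
Proof. by apply: (addIr (f 0)); rewrite -fD !add0r. Qed.

Lemma addfN x : f (- x) = - f x.
Proof. by apply: (addIr (f x)); rewrite -fD !addNr addf0. Qed.

Lemma addfB x y : f (x - y) = f x - f y.
Proof. by rewrite fD addfN. Qed.

Lemma addf_sum I (s : seq I) (F : I -> U) :
  f (\sum_(i <- s) F i) = \sum_(i <- s) f (F i).
Proof. by apply: (big_morph f) => //; exact: addf0. Qed.

End Additive.

Lemma bij_of (T U : Type) (f : T -> U) : injective f -> (forall y, exists x, f x = y) ->
  bijective f.
Proof.
move=> fI fS; have [g gE] := choice fS; exists g => // x.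
by apply: fI; rewrite gE.
Qed.

Lemma bij_id T : bijective (@idfun T). Proof. by exists idfun. Qed.

(** * Linear maps and isomorphisms of modules *)

Section Lin.
Variable A : pzRingType.
Implicit Types U V W : lmodType A.

(** A predicate on bare functions, because one function is read with respect to several module
    structures on one carrier: left, right, or that of a tensor product. *)
Record lin V W (f : V -> W) : Prop := Lin {
  linD : additive f;
  linZ : forall (a : A) x, f (a *: x) = a *: f x }.

Lemma lin_comp U V W (g : V -> W) (f : U -> V) : lin g -> lin f -> lin (g \o f).
Proof.
move=> gl fl; split=> [x y|a x] /=; first by rewrite (linD fl) (linD gl).
by rewrite (linZ fl) (linZ gl).
Qed.

Lemma lin_can V W (f : V -> W) g : lin f -> cancel f g -> cancel g f -> lin g.
Proof.
move=> fl fK gK; split=> [x y|a x]; apply: (can_inj fK).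
  by rewrite (linD fl) !gK.
by rewrite (linZ fl) !gK.
Qed.

Lemma lmod_isoI V W (f : V -> W) : lin f -> bijective f -> lmod_iso V W.
Proof.
move=> [fD fZ] fb; have fl : linear f by move=> a x y; rewrite fD fZ.
pose F : {linear V -> W} := HB.pack f (GRing.isLinear.Build A V W *:%R f fl).
by exists F.
Qed.

Lemma lmod_isoE V W : lmod_iso V W -> exists2 f : V -> W, lin f & bijective f.
Proof.
move=> [f fb]; exists f => //; split=> [x y|a x]; first exact: raddfD.
exact: linearZ.
Qed.

Lemma lmod_iso_sym V W : lmod_iso V W -> lmod_iso W V.
Proof.
move=> /lmod_isoE[f fl [g fK gK]]; apply: (@lmod_isoI _ _ g); last by exists f.
exact: lin_can fl fK gK.
Qed.

Lemma lmod_iso_trans U V W : lmod_iso U V -> lmod_iso V W -> lmod_iso U W.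
Proof.
move=> /lmod_isoE[f fl fb] /lmod_isoE[g gl gb]; apply: (@lmod_isoI _ _ (g \o f)).
  exact: lin_comp.
exact: bij_comp.
Qed.

Variable D : set (set A).

Lemma torsion_iso V W : lmod_iso V W -> torsion D V -> torsion D W.
Proof.
move=> /lmod_isoE[f fl [g fK gK]] t w; have [I DI Ik] := t (g w).
exists I => // a Ia; rewrite -[w]gK -(linZ fl) Ik //.
exact: addf0 (linD fl).
Qed.

Lemma torsion_free_iso V W : lmod_iso V W -> torsion_free D V -> torsion_free D W.
Proof.
move=> /lmod_isoE[f fl [g fK gK]] t w [I DI Ik].
have gl := lin_can fl fK gK.
rewrite -[w]gK (t (g w)) ?(addf0 (linD fl)) //.
by exists I => // a Ia; rewrite -(linZ gl) Ik // (addf0 (linD gl)).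
Qed.

End Lin.

(** * Functors preserving torsion theories *)

(* [T_sharp] and [U_sharp] are the instances F = - (x) M and F = M (x) -. *)
Section Sharp.
Variables (A : pzRingType) (D : set (set A)).
Implicit Types F G : lmodType A -> lmodType A.

Definition sharp F : Prop :=
  (forall X : lmodType A, torsion D X <->
     exists2 N : lmodType A, torsion D N & lmod_iso (F N) X) /\
  (forall X : lmodType A, torsion_free D X <->
     exists2 N : lmodType A, torsion_free D N & lmod_iso (F N) X).

Definition preserves F : Prop := forall X : lmodType A,
  (torsion D X -> torsion D (F X)) /\ (torsion_free D X -> torsion_free D (F X)).

Definition iso_functor F : Prop :=
  forall X Y : lmodType A, lmod_iso X Y -> lmod_iso (F X) (F Y).

Lemma sharp_preserves F : sharp F -> preserves F.
Proof.
move=> [t f] X; split=> tX; [apply/t|apply/f]; exists X => //;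
  exact: lmod_iso_refl.
Qed.

(** Every X in a class is isomorphic to F (G X), and G X is again in the class; so a one-sided
    inverse that preserves the classes turns preservation into equality. *)
Lemma preserves_sharp F G : (forall X, lmod_iso (F (G X)) X) ->
  preserves F -> preserves G -> sharp F.
Proof.
move=> FG pF pG; split=> X; split=> [tX|[N tN NX]].
- by exists (G X) => //; have [h _] := pG X; exact: h.
- by apply: torsion_iso NX _; have [h _] := pF N; exact: h.
- by exists (G X) => //; have [_ h] := pG X; exact: h.
- by apply: torsion_free_iso NX _; have [_ h] := pF N; exact: h.
Qed.

Lemma sharp_eq F G : (forall X, lmod_iso (F X) (G X)) -> sharp F -> sharp G.
Proof.
move=> FG [t f]; split=> X; split.
- by move=> /t[N tN i]; exists N => //; apply: lmod_iso_trans i; exact: lmod_iso_sym.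
- by move=> [N tN i]; apply/t; exists N => //; exact: lmod_iso_trans i.
- by move=> /f[N tN i]; exists N => //; apply: lmod_iso_trans i; exact: lmod_iso_sym.
- by move=> [N tN i]; apply/f; exists N => //; exact: lmod_iso_trans i.
Qed.

Lemma sharp_id : sharp id.
Proof.
split=> X; split=> [tX|[N tN i]]; first by exists X => //; exact: lmod_iso_refl.
- exact: torsion_iso i tN.
- by exists X => //; exact: lmod_iso_refl.
- exact: torsion_free_iso i tN.
Qed.

Lemma sharp_comp F G : iso_functor G -> sharp F -> sharp G -> sharp (G \o F).
Proof.
move=> Gi sF sG; have pF := sharp_preserves sF; have pG := sharp_preserves sG.
case: sF sG => [tF fF] [tG fG]; split=> X; split.
- move=> /tG[N1 /tF[N tN i1] i2]; exists N => //.
  by apply: lmod_iso_trans i2; exact: Gi.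
- move=> [N tN i]; apply: torsion_iso i _; apply pG; exact: (pF N).1.
- move=> /fG[N1 /fF[N tN i1] i2]; exists N => //.
  by apply: lmod_iso_trans i2; exact: Gi.
- move=> [N tN i]; apply: torsion_free_iso i _; apply pG; exact: (pF N).2.
Qed.

(** A torsion N is some F N0 with N0 torsion, so G N = G (F N0) = N0 is torsion; conversely a
    torsion X is G (F X). The same argument serves the torsion-free class. *)
Lemma sharp_inv F G : iso_functor G ->
  (forall X, lmod_iso (G (F X)) X) -> sharp F -> sharp G.
Proof.
move=> Gi GF sF; have pF := sharp_preserves sF; case: sF => tF fF.
split=> X; split=> [tX|[N tN i]].
- by exists (F X) => //; exact: (pF X).1.
- have /tF[N0 t0 i0] := tN; apply: torsion_iso t0.
  apply: lmod_iso_trans i; apply: lmod_iso_trans (Gi _ _ i0).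
  exact: lmod_iso_sym.
- by exists (F X) => //; exact: (pF X).2.
- have /fF[N0 t0 i0] := tN; apply: torsion_free_iso t0.
  apply: lmod_iso_trans i; apply: lmod_iso_trans (Gi _ _ i0).
  exact: lmod_iso_sym.
Qed.

End Sharp.

(** * Tensor products *)

Section TensorMaps.

Section Sums.
Variables (A : pzRingType) (X : lmodType A^c) (Y : lmodType A).

Lemma tens_suml I (s : seq I) (F : I -> X) (y : Y) :
  tens (\sum_(i <- s) F i) y = \sum_(i <- s) tens (F i) y.
Proof. by apply: (@addf_sum _ _ (fun x => tens x y)) => x x'; exact: tensDl. Qed.

Lemma tens_sumr I (s : seq I) (F : I -> Y) (x : X) :
  tens x (\sum_(i <- s) F i) = \sum_(i <- s) tens x (F i).
Proof. by apply: (@addf_sum _ _ (tens x)) => y y'; exact: tensDr. Qed.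

End Sums.

Section Functor.
Variables (A : pzRingType) (X X' : lmodType A^c) (Y Y' : lmodType A).

Definition tmap (f : X -> X') (g : Y -> Y') : tensor X Y -> tensor X' Y' :=
  tlift (fun x y => tens (f x) (g y)).

Lemma tmap_bal (f : X -> X') (g : Y -> Y') : lin f -> lin g ->
  balanced (fun x y => tens (f x) (g y)).
Proof.
move=> fl gl; split=> [x x' y|x y y'|x a y].
- by rewrite (linD fl) tensDl.
- by rewrite (linD gl) tensDr.
- by rewrite (linZ fl) (linZ gl) tensZ.
Qed.

Lemma tmapD (f : X -> X') (g : Y -> Y') : lin f -> lin g -> additive (tmap f g).
Proof. by move=> fl gl; apply: tliftD; exact: tmap_bal. Qed.

Lemma tmapE (f : X -> X') (g : Y -> Y') : lin f -> lin g ->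
  forall x y, tmap f g (tens x y) = tens (f x) (g y).
Proof. by move=> fl gl x y; rewrite /tmap tliftE //; exact: tmap_bal. Qed.

End Functor.

Lemma tmap_bij (A : pzRingType) (X X' : lmodType A^c) (Y Y' : lmodType A)
    (f : X -> X') (g : Y -> Y') : lin f -> lin g -> bijective f -> bijective g ->
  bijective (tmap f g).
Proof.
move=> fl gl [f' fK f'K] [g' gK g'K].
have fl' := lin_can fl fK f'K; have gl' := lin_can gl gK g'K.
exists (tmap f' g'); apply: (tens_ext (g := idfun)) => [u v|//|x y].
- by rewrite !tmapD.
- by rewrite !tmapE // fK gK.
- by rewrite !tmapD.
- by rewrite !tmapE // f'K g'K.
Qed.

Section Assoc.
Variables (A B : pzRingType) (X : lmodType A^c) (M : bimod A B) (Y : lmodType B).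

(** A map out of an iterated tensor product is built in two stages: with the outer variable fixed
    the inner pair is lifted, and the result is then shown to be balanced in the outer pair. *)
Let al1 (y : Y) (x : X) (m : left_of M) : tensor X (tensL M Y) :=
  tens x (tens (m : right_of M) y : tensL M Y).
Let al (u : tensR X M) (y : Y) := tlift (al1 y) u.

Fact al1_bal y : balanced (al1 y).
Proof.
split=> [x x' m|x m m'|x a m]; first exact: tensDl.
  by rewrite -tensDr -tensDl.
by rewrite /al1 tensZ; congr tens; exact: tens_lactE.
Qed.

Fact al_bal : balanced al.
Proof.
split=> [u u' y|u y y'|u a y]; first by rewrite /al (tliftD (al1_bal y)).
- move: u; apply: tens_ext => [u v|u v|x m].
  + exact: (tliftD (al1_bal _)).
  + by rewrite /al !(tliftD (al1_bal _)) addrACA.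
  + by rewrite /al !(tliftE (al1_bal _)) /al1 -!tensDr.
- move: u; apply: (tens_ext (f := fun u => al (tens_ract u a) y)) => [u v|u v|x m].
  + by rewrite (tens_ractD a) /al (tliftD (al1_bal _)).
  + exact: (tliftD (al1_bal _)).
  + rewrite /al tens_ractE !(tliftE (al1_bal _)) /al1; congr tens.
    exact: (tensZ (m : right_of M)).
Qed.

Definition tassoc : tensor (tensR X M) Y -> tensor X (tensL M Y) := tlift al.

Lemma tassocD : additive tassoc. Proof. exact: tliftD al_bal. Qed.
Lemma tassocE x m y :
  tassoc (tens (tens x m : tensR X M) y) = tens x (tens (m : right_of M) y : tensL M Y).
Proof. by rewrite /tassoc (tliftE al_bal) /al (tliftE (al1_bal y)). Qed.

Let be1 (x : X) (m : right_of M) (y : Y) : tensor (tensR X M) Y :=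
  tens (tens x (m : left_of M) : tensR X M) y.
Let be (x : X) (u : tensL M Y) := tlift (be1 x) u.

Fact be1_bal x : balanced (be1 x).
Proof.
split=> [m m' y|m y y'|m a y].
- by rewrite -tensDl -tensDr.
- exact: tensDr.
- by rewrite /be1 -tensZ; congr tens; symmetry; exact: tens_ractE.
Qed.

Fact be_bal : balanced be.
Proof.
split=> [x x' u|x u u'|x a u].
- move: u; apply: tens_ext => [u v|u v|m y].
  + exact: (tliftD (be1_bal _)).
  + by rewrite /be !(tliftD (be1_bal _)) addrACA.
  + by rewrite /be !(tliftE (be1_bal _)) /be1 -!tensDl.
- by rewrite /be (tliftD (be1_bal x)).
- move: u; apply: (tens_ext (g := fun u => be x (tens_lact a u))) => [u v|u v|m y].
  + exact: (tliftD (be1_bal _)).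
  + by rewrite (tens_lactD a) /be (tliftD (be1_bal _)).
  + rewrite /be tens_lactE !(tliftE (be1_bal _)) /be1; congr tens.
    exact: (tensZ x a (m : left_of M)).
Qed.

Lemma tassoc_bij : bijective tassoc.
Proof.
exists (tlift be).
- apply: (tens_ext (g := idfun)) => [u v|//|u y].
    by rewrite tassocD (tliftD be_bal).
  move: u; apply: (tens_ext (g := fun u : tensR X M => tens u y)) => [u v|u v|x m].
  + by rewrite tensDl tassocD (tliftD be_bal).
  + exact: tensDl.
  + by rewrite tassocE (tliftE be_bal) /be (tliftE (be1_bal x)).
- apply: (tens_ext (g := idfun)) => [u v|//|x u].
    by rewrite (tliftD be_bal) tassocD.
  move: u; apply: (tens_ext (g := fun u : tensL M Y => tens x u)) => [u v|u v|m y].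
  + by rewrite tensDr (tliftD be_bal) tassocD.
  + exact: tensDr.
  + by rewrite (tliftE be_bal) /be (tliftE (be1_bal x)) tassocE.
Qed.

End Assoc.

Section Assoc3.
Variables (A B : pzRingType) (X : lmodType A^c) (M : bimod A B) (Y : lmodType B).
Variables (U : lmodType B^c) (V : lmodType A).
Variables (i : tensR X M -> U) (k : tensL M Y -> V).
Hypotheses (il : lin i) (ib : bijective i) (kl : lin k) (kb : bijective k).

(** [U] and [V] may present the carriers of the inner tensor products with another module structure,
    such as [right_of (tensB M N)]; [i] and [k] are the identity in all applications. One statement
    thus yields associativity for modules on either side and for bimodules. *)
Lemma tens_assoc : exists h : tensor U Y -> tensor X V,
  [/\ bijective h, additive h &
      forall x m y, h (tens (i (tens x m)) y) = tens x (k (tens (m : right_of M) y))].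
Proof.
have [j iK jK] := ib; have jl := lin_can il iK jK.
exists (tmap idfun k \o @tassoc _ _ X M Y \o tmap j idfun); split.
- apply: bij_comp; last by apply: tmap_bij => //; [exists i|exact: bij_id].
  by apply: bij_comp; [apply: tmap_bij => //; exact: bij_id|exact: tassoc_bij].
- by move=> u v /=; rewrite tmapD // tassocD tmapD.
- by move=> x m y /=; rewrite tmapE // iK tassocE tmapE.
Qed.

End Assoc3.

End TensorMaps.

(** * Bimodule maps; functoriality, associativity and units of the tensor product *)

Record bilin R S (M N : bimod R S) (f : M -> N) : Prop := Bilin {
  bilinD : additive f;
  bilinL : forall a x, f (a *> x) = a *> f x;
  bilinR : forall x a, f (x <* a) = f x <* a }.

Section Bilin.
Variables R S : pzRingType.
Implicit Types M N P : bimod R S.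

Lemma bimod_isoI M N (f : M -> N) : bilin f -> bijective f -> bimod_iso M N.
Proof. by move=> [fD fL fR] fb; exists f. Qed.

Lemma bimod_isoE M N : bimod_iso M N -> exists2 f : M -> N, bilin f & bijective f.
Proof. by move=> [f [fb fD fL fR]]; exists f. Qed.

Lemma bilin_comp M N P (g : N -> P) (f : M -> N) : bilin g -> bilin f -> bilin (g \o f).
Proof.
move=> [gD gL gR] [fD fL fR].
by split=> [x y|a x|x a] /=; rewrite ?fD ?fL ?fR ?gD ?gL ?gR.
Qed.

Lemma bilin_can M N (f : M -> N) g : bilin f -> cancel f g -> cancel g f -> bilin g.
Proof.
move=> [fD fL fR] fK gK.
by split=> [x y|a x|x a]; apply: (can_inj fK); rewrite ?fD ?fL ?fR !gK.
Qed.

Lemma bimod_iso_refl M : bimod_iso M M.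
Proof. by exists idfun; split=> //; exact: bij_id. Qed.

Lemma bimod_iso_sym M N : bimod_iso M N -> bimod_iso N M.
Proof.
move=> /bimod_isoE[f fl [g fK gK]]; apply: (@bimod_isoI _ _ g); last by exists f.
exact: bilin_can fl fK gK.
Qed.

Lemma bimod_iso_trans M N P : bimod_iso M N -> bimod_iso N P -> bimod_iso M P.
Proof.
move=> /bimod_isoE[f fl fb] /bimod_isoE[g gl gb]; apply: (@bimod_isoI _ _ (g \o f)).
  exact: bilin_comp.
exact: bij_comp.
Qed.

Lemma bilin_lin_l M N (f : M -> N) : bilin f -> @lin _ (left_of M) (left_of N) f.
Proof. by case. Qed.

Lemma bilin_lin_r M N (f : M -> N) : bilin f -> @lin _ (right_of M) (right_of N) f.
Proof. by case=> fD fL fR; split=> // a x; exact: fR. Qed.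

Lemma lact_addD M (a : R) : additive (@lact _ _ M a).
Proof. exact: lactDr. Qed.
Lemma ract_addD M (a : S) : additive (fun m : M => m <* a).
Proof. by move=> m n; exact: ractDl. Qed.
Lemma lactr_addD M (m : M) : additive (fun a : R => a *> m).
Proof. by move=> a b; exact: lactDl. Qed.
Lemma ractr_addD M (m : M) : additive (fun a : S => m <* a).
Proof. by move=> a b; exact: ractDr. Qed.

End Bilin.

Section Generators.
Variables A B : pzRingType.

Lemma tensR_linI (X : lmodType A^c) (M : bimod A B) (V : lmodType B^c)
    (h : tensR X M -> V) : additive h ->
  (forall x (m : M) (a : B),
     h (tens x (m <* a : left_of M)) = (a : B^c) *: h (tens x (m : left_of M))) ->
  lin h.
Proof.
move=> hD hE; split=> // a u; move: u.
apply: (@tens_ext A X (left_of M) V (fun u => h (tens_ract (M := M) u a))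
  (fun u => a *: h u)) => [u v|u v|x m].
- by rewrite tens_ractD hD.
- by rewrite hD scalerDr.
- by rewrite tens_ractE hE.
Qed.

Lemma tensL_linI (M : bimod B A) (Y : lmodType A) (V : lmodType B)
    (h : tensL M Y -> V) : additive h ->
  (forall (m : M) y (a : B),
     h (tens (a *> m : right_of M) y) = a *: h (tens (m : right_of M) y)) ->
  lin h.
Proof.
move=> hD hE; split=> // a u; move: u.
apply: (@tens_ext A (right_of M) Y V (fun u => h (tens_lact (M := M) a u))
  (fun u => a *: h u)) => [u v|u v|x m].
- by rewrite tens_lactD hD.
- by rewrite hD scalerDr.
- by rewrite tens_lactE hE.
Qed.

End Generators.

Section BimodGenerators.
Variables A B D : pzRingType.

Lemma tensB_bilinI (M : bimod B A) (N : bimod A D) (P : bimod B D)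
    (h : tensB M N -> P) : additive h ->
  (forall (m : M) (n : N) a, h (tens (a *> m : right_of M) (n : left_of N)) =
     a *> h (tens (m : right_of M) (n : left_of N))) ->
  (forall (m : M) (n : N) a, h (tens (m : right_of M) (n <* a : left_of N)) =
     h (tens (m : right_of M) (n : left_of N)) <* a) ->
  bilin h.
Proof.
move=> hD hL hR; split=> // [a u|u a].
- exact: (linZ (@tensL_linI _ _ M (left_of N) (left_of P) h hD (fun m y a => hL m y a))).
- exact: (linZ (@tensR_linI _ _ (right_of M) N (right_of P) h hD (fun m y a => hR m y a))).
Qed.

Lemma tensB_ext (M : bimod B A) (N : bimod A D) (G : zmodType)
    (f g : tensB M N -> G) : additive f -> additive g ->
  (forall (m : M) (n : N), f (tens (m : right_of M) (n : left_of N)) =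
     g (tens (m : right_of M) (n : left_of N))) -> f =1 g.
Proof. exact: (@tens_ext A (right_of M) (left_of N) G f g). Qed.

End BimodGenerators.

Section Functors.
Variables A B D : pzRingType.

Lemma tensR_iso (X X' : lmodType A^c) (M : bimod A B) :
  lmod_iso X X' -> lmod_iso (tensR X M) (tensR X' M).
Proof.
move=> /lmod_isoE[f fl fb].
pose h := tmap (Y := left_of M) (Y' := left_of M) f idfun.
apply: (@lmod_isoI _ (tensR X M) (tensR X' M) h).
  apply: tensR_linI => [|x m a]; first exact: tmapD.
  by rewrite /h !tmapE //; symmetry; exact: tens_ractE.
by apply: tmap_bij => //; exact: bij_id.
Qed.

Lemma tensR_biso (X : lmodType A^c) (M N : bimod A B) :
  bimod_iso M N -> lmod_iso (tensR X M) (tensR X N).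
Proof.
move=> /bimod_isoE[f fl fb]; have fll := bilin_lin_l fl.
pose h := tmap (X := X) (X' := X) (Y := left_of M) (Y' := left_of N) idfun f.
apply: (@lmod_isoI _ (tensR X M) (tensR X N) h).
  apply: tensR_linI => [|x m a]; first exact: tmapD.
  by rewrite /h !tmapE // (bilinR fl); symmetry; exact: tens_ractE.
by apply: tmap_bij => //; exact: bij_id.
Qed.

Lemma tensL_iso (M : bimod B A) (Y Y' : lmodType A) :
  lmod_iso Y Y' -> lmod_iso (tensL M Y) (tensL M Y').
Proof.
move=> /lmod_isoE[f fl fb].
pose h := tmap (X := right_of M) (X' := right_of M) idfun f.
apply: (@lmod_isoI _ (tensL M Y) (tensL M Y') h).
  apply: tensL_linI => [|m y a]; first exact: tmapD.
  by rewrite /h !tmapE //; symmetry; exact: tens_lactE.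
by apply: tmap_bij => //; exact: bij_id.
Qed.

Lemma tensL_biso (M N : bimod B A) (Y : lmodType A) :
  bimod_iso M N -> lmod_iso (tensL M Y) (tensL N Y).
Proof.
move=> /bimod_isoE[f fl fb]; have fll := bilin_lin_r fl.
pose h := tmap (X := right_of M) (X' := right_of N) (Y := Y) (Y' := Y) f idfun.
apply: (@lmod_isoI _ (tensL M Y) (tensL N Y) h).
  apply: tensL_linI => [|m y a]; first exact: tmapD.
  by rewrite /h !tmapE // (bilinL fl); symmetry; exact: tens_lactE.
by apply: tmap_bij => //; exact: bij_id.
Qed.

Lemma tensB_iso (M M' : bimod A B) (N N' : bimod B D) :
  bimod_iso M M' -> bimod_iso N N' -> bimod_iso (tensB M N) (tensB M' N').
Proof.
move=> /bimod_isoE[f fl fb] /bimod_isoE[g gl gb].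
have fr := bilin_lin_r fl; have gll := bilin_lin_l gl.
pose h := tmap (X := right_of M) (X' := right_of M') (Y := left_of N) (Y' := left_of N') f g.
apply: (@bimod_isoI _ _ (tensB M N) (tensB M' N') h); last exact: tmap_bij.
apply: tensB_bilinI => [|m n a|m n a]; first exact: tmapD.
- by rewrite /h !tmapE // (bilinL fl); symmetry; exact: tens_lactE.
- by rewrite /h !tmapE // (bilinR gl); symmetry; exact: tens_ractE.
Qed.

End Functors.

Section AssocIso.
Variables A B D E : pzRingType.

Lemma tensR_assoc (X : lmodType A^c) (M : bimod A B) (N : bimod B D) :
  lmod_iso (tensR (tensR X M) N) (tensR X (tensB M N)).
Proof.
have [||||h [hb hD hE]] := @tens_assoc _ _ X M (left_of N) (tensR X M)
  (left_of (tensB M N)) idfun idfun; try by []; try exact: bij_id.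
apply: (@lmod_isoI _ (tensR (tensR X M) N) (tensR X (tensB M N)) h) => //.
apply: tensR_linI => // u n a; move: u.
apply: (tens_ext (G := tensR X (tensB M N))
  (f := fun u => h (tens (u : tensR X M) (n <* a : left_of N)))
  (g := fun u => (a : D^c) *: (h (tens (u : tensR X M) (n : left_of N)) : tensR X (tensB M N))))
  => [u v|u v|x m].
- by rewrite tensDl hD.
- apply: etrans (scalerDr _ _ _); congr (_ *: _); apply: etrans (hD _ _).
  by congr h; exact: tensDl.
- rewrite !hE; symmetry; apply: etrans (tens_ractE _ _ _) _.
  by congr tens; exact: tens_ractE.
Qed.

Lemma tensL_assoc (M : bimod D A) (N : bimod A B) (Y : lmodType B) :
  lmod_iso (tensL (tensB M N) Y) (tensL M (tensL N Y)).
Proof.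
have [||||h [hb hD hE]] := @tens_assoc _ _ (right_of M) N Y (right_of (tensB M N))
  (tensL N Y) idfun idfun; try by []; try exact: bij_id.
apply: (@lmod_isoI _ (tensL (tensB M N) Y) (tensL M (tensL N Y)) h) => //.
apply: tensL_linI => // u y a; move: u.
apply: (tens_ext (G := tensL M (tensL N Y))
  (f := fun u => h (tens (a *> (u : tensB M N) : right_of (tensB M N)) y))
  (g := fun u => a *: (h (tens (u : right_of (tensB M N)) y) : tensL M (tensL N Y))))
  => [u v|u v|m n].
- by rewrite lactDr; apply: etrans (hD _ _); congr h; exact: tensDl.
- apply: etrans (scalerDr _ _ _); congr (_ *: _); apply: etrans (hD _ _).
  by congr h; exact: tensDl.
- transitivity (h (tens (tens (a *> (m : M) : right_of M) n : right_of (tensB M N)) y)).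
    by congr h; congr tens; exact: tens_lactE.
  by rewrite !hE; symmetry; exact: tens_lactE.
Qed.

Lemma tensB_assoc (M : bimod A B) (N : bimod B D) (P : bimod D E) :
  bimod_iso (tensB (tensB M N) P) (tensB M (tensB N P)).
Proof.
have [||||h [hb hD hE]] := @tens_assoc _ _ (right_of M) N (left_of P)
  (right_of (tensB M N)) (left_of (tensB N P)) idfun idfun; try by []; try exact: bij_id.
apply: (@bimod_isoI _ _ (tensB (tensB M N) P) (tensB M (tensB N P)) h) => //.
apply: tensB_bilinI => // u p a; move: u.
- apply: (tensB_ext (G := tensB M (tensB N P))
    (f := fun u => h (tens (a *> (u : tensB M N) : right_of (tensB M N)) (p : left_of P)))
    (g := fun u => a *> (h (tens (u : right_of (tensB M N)) (p : left_of P))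
       : tensB M (tensB N P)))) => [u v|u v|m n].
  + by rewrite lactDr; apply: etrans (hD _ _); congr h; exact: tensDl.
  + apply: etrans (lactDr _ _ _); congr (_ *> _); apply: etrans (hD _ _).
    by congr h; exact: tensDl.
  + transitivity (h (tens (tens (a *> (m : M) : right_of M) (n : left_of N)
      : right_of (tensB M N)) (p : left_of P))).
      by congr h; congr tens; exact: tens_lactE.
    by rewrite !hE; symmetry; exact: tens_lactE.
- apply: (tensB_ext (G := tensB M (tensB N P))
    (f := fun u => h (tens (u : right_of (tensB M N)) (p <* a : left_of P)))
    (g := fun u => (h (tens (u : right_of (tensB M N)) (p : left_of P))
       : tensB M (tensB N P)) <* a)) => [u v|u v|m n].
  + by apply: etrans (hD _ _); congr h; exact: tensDl.
  + apply: etrans (ractDl _ _ _); congr (_ <* _); apply: etrans (hD _ _).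
    by congr h; exact: tensDl.
  + rewrite !hE; symmetry; apply: etrans (tens_ractE _ _ _) _.
    by congr tens; exact: tens_ractE.
Qed.

End AssocIso.

Section UnitIso.
Variables A B : pzRingType.

Lemma tens1_bal (X : lmodType A^c) :
  balanced (fun (x : X) (r : left_of (regular A)) => (r : A^c) *: x).
Proof.
split=> [x x' y|x y y'|x a y]; [exact: scalerDr|exact: scalerDl|exact: scalerA].
Qed.

Lemma tens1l_bal (Y : lmodType A) :
  balanced (fun (r : right_of (regular A)) (y : Y) => (r : A) *: y).
Proof.
split=> [x x' y|x y y'|x a y]; [exact: scalerDl|exact: scalerDr|].
by rewrite scalerA.
Qed.

Lemma tens1_bij (X : lmodType A^c) :
  bijective (tlift (fun (x : X) (r : left_of (regular A)) => (r : A^c) *: x)).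
Proof.
have hb := tens1_bal X.
exists (fun x => tens x (1 : left_of (regular A))) => [|x].
  apply: (tens_ext (g := idfun)) => [u v|//|x r].
    by rewrite (tliftD hb) tensDl.
  by rewrite (tliftE hb) (tensZ x (r : A)); congr tens; exact: mulr1.
by rewrite (tliftE hb) scale1r.
Qed.

Lemma tens1l_bij (Y : lmodType A) :
  bijective (tlift (fun (r : right_of (regular A)) (y : Y) => (r : A) *: y)).
Proof.
have hb := tens1l_bal Y.
exists (fun x => tens (1 : right_of (regular A)) x) => [|x].
  apply: (tens_ext (g := idfun)) => [u v|//|r x].
    by rewrite (tliftD hb) tensDr.
  by rewrite (tliftE hb) -tensZ; congr tens; exact: mul1r.
by rewrite (tliftE hb) scale1r.
Qed.

Lemma tensR_unit (X : lmodType A^c) : lmod_iso (tensR X (regular A)) X.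
Proof.
have hb := tens1_bal X.
apply: (@lmod_isoI _ (tensR X (regular A)) X _ _ (tens1_bij X)).
apply: tensR_linI => [|x m a]; first exact: tliftD hb.
by rewrite !(tliftE hb) scalerA.
Qed.

Lemma tensL_unit (Y : lmodType A) : lmod_iso (tensL (regular A) Y) Y.
Proof.
have hb := tens1l_bal Y.
apply: (@lmod_isoI _ (tensL (regular A) Y) Y _ _ (tens1l_bij Y)).
apply: tensL_linI => [|m y a]; first exact: tliftD hb.
by rewrite !(tliftE hb) scalerA.
Qed.

Lemma tensB_unitl (M : bimod A B) : bimod_iso (tensB (regular A) M) M.
Proof.
have hb := tens1l_bal (left_of M).
apply: (@bimod_isoI _ _ (tensB (regular A) M) M _ _ (tens1l_bij (left_of M))).
apply: tensB_bilinI => [|m n a|m n a]; first exact: tliftD hb.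
- by rewrite !(tliftE hb); symmetry; exact: lactA.
- by rewrite !(tliftE hb); symmetry; exact: lractA.
Qed.

Lemma tensB_unitr (M : bimod B A) : bimod_iso (tensB M (regular A)) M.
Proof.
have hb := tens1_bal (right_of M).
apply: (@bimod_isoI _ _ (tensB M (regular A)) M _ _ (tens1_bij (right_of M))).
apply: tensB_bilinI => [|m n a|m n a]; first exact: tliftD hb.
- by rewrite !(tliftE hb); exact: lractA.
- by rewrite !(tliftE hb); symmetry; exact: ractA.
Qed.

End UnitIso.

(** * The Picard group *)

Section PicGroup.
Variables (R : pzRingType) (Dl : set (set R)) (Dr : set (set R^c)).
Implicit Types M N P : bimod R R.

Lemma iso_class_eq M N : bimod_iso M N -> iso_class M = iso_class N.
Proof.
move=> i; apply/funext => P; apply/propext; split; last exact: bimod_iso_trans.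
by apply: bimod_iso_trans; exact: bimod_iso_sym.
Qed.

Lemma iso_classE M N : iso_class M = iso_class N -> bimod_iso M N.
Proof. by move=> e; have : iso_class N N := bimod_iso_refl N; rewrite -e. Qed.

Lemma Pic_mulE M N : Pic_mul (iso_class M) (iso_class N) = iso_class (tensB M N).
Proof.
apply/funext => P; apply/propext; split=> [[M' [N' [i j k]]]|i].
  exact: bimod_iso_trans (tensB_iso i j) k.
by exists M, N; split=> //; exact: bimod_iso_refl.
Qed.

Lemma tensR_cancel M N (X : lmodType R^c) : bimod_iso (tensB M N) (regular R) ->
  lmod_iso (tensR (tensR X M) N) X.
Proof.
move=> i; apply: lmod_iso_trans (tensR_assoc _ _ _) _.
exact: lmod_iso_trans (tensR_biso _ i) (tensR_unit X).
Qed.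

Lemma tensL_cancel M N (Y : lmodType R) : bimod_iso (tensB M N) (regular R) ->
  lmod_iso (tensL M (tensL N Y)) Y.
Proof.
move=> i; apply: lmod_iso_trans (lmod_iso_sym (tensL_assoc _ _ _)) _.
exact: lmod_iso_trans (tensL_biso _ i) (tensL_unit Y).
Qed.

Lemma T_sharp_iso M N : bimod_iso M N -> T_sharp Dr M -> T_sharp Dr N.
Proof.
move=> i; apply: (@sharp_eq _ Dr (fun X => tensR X M) (fun X => tensR X N)) => X.
exact: tensR_biso.
Qed.

Lemma U_sharp_iso M N : bimod_iso M N -> U_sharp Dl M -> U_sharp Dl N.
Proof.
move=> i; apply: (@sharp_eq _ Dl (fun X => tensL M X) (fun X => tensL N X)) => X.
exact: tensL_biso.
Qed.

Lemma tensR_functor M : iso_functor (fun X => tensR X M).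
Proof. by move=> X Y; exact: tensR_iso. Qed.

Lemma tensL_functor M : iso_functor (fun Y => tensL M Y).
Proof. by move=> X Y; exact: tensL_iso. Qed.

Lemma T_sharp_mul M N : T_sharp Dr M -> T_sharp Dr N -> T_sharp Dr (tensB M N).
Proof.
move=> sM sN; have := sharp_comp (@tensR_functor N) sM sN.
by apply: sharp_eq => X; exact: tensR_assoc.
Qed.

Lemma U_sharp_mul M N : U_sharp Dl M -> U_sharp Dl N -> U_sharp Dl (tensB M N).
Proof.
move=> sM sN; have := sharp_comp (@tensL_functor M) sN sM.
by apply: sharp_eq => X; exact/lmod_iso_sym/tensL_assoc.
Qed.

(** T_N after T_M tensors with M (x) N on the right, while U_N after U_M tensors with N (x) M on the
    left; hence the opposite orders here and in [U_sharp_inv]. *)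
Lemma T_sharp_inv M N : bimod_iso (tensB M N) (regular R) ->
  T_sharp Dr M -> T_sharp Dr N.
Proof.
move=> i; apply: (@sharp_inv _ Dr (fun X => tensR X M) (fun X => tensR X N)) => [|X].
  exact: tensR_functor.
exact: tensR_cancel.
Qed.

Lemma U_sharp_inv M N : bimod_iso (tensB N M) (regular R) ->
  U_sharp Dl M -> U_sharp Dl N.
Proof.
move=> i; apply: (@sharp_inv _ Dl (fun X => tensL M X) (fun X => tensL N X)) => [|X].
  exact: tensL_functor.
exact: tensL_cancel.
Qed.

Lemma T_sharp1 : T_sharp Dr (regular R).
Proof.
apply: (@sharp_eq _ Dr id (fun X => tensR X (regular R)) _ (sharp_id Dr)) => X.
exact/lmod_iso_sym/tensR_unit.
Qed.

Lemma U_sharp1 : U_sharp Dl (regular R).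
Proof.
apply: (@sharp_eq _ Dl id (fun X => tensL (regular R) X) _ (sharp_id Dl)) => X.
exact/lmod_iso_sym/tensL_unit.
Qed.

Lemma invertible_iso M N : bimod_iso M N -> invertible M -> invertible N.
Proof.
move=> i [M' [j k]]; exists M'; split.
  apply: bimod_iso_trans j; apply: tensB_iso; last exact: bimod_iso_refl.
  exact: bimod_iso_sym.
apply: bimod_iso_trans k; apply: tensB_iso; first exact: bimod_iso_refl.
exact: bimod_iso_sym.
Qed.

Lemma in_Pic_iso M N : bimod_iso M N -> in_Pic Dl Dr M -> in_Pic Dl Dr N.
Proof.
move=> i [iM tM uM]; split; [exact: invertible_iso i iM|exact: T_sharp_iso i tM|].
exact: U_sharp_iso i uM.
Qed.

Lemma in_Pic1 : in_Pic Dl Dr (regular R).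
Proof.
split; [|exact: T_sharp1|exact: U_sharp1].
by exists (regular R); split; exact: tensB_unitl.
Qed.

Lemma tensB_cancel M M' N N' : bimod_iso (tensB M M') (regular R) ->
  bimod_iso (tensB N N') (regular R) ->
  bimod_iso (tensB (tensB M N) (tensB N' M')) (regular R).
Proof.
move=> i j; apply: bimod_iso_trans (tensB_assoc _ _ _) _.
apply: bimod_iso_trans i; apply: tensB_iso; first exact: bimod_iso_refl.
apply: bimod_iso_trans (bimod_iso_sym (tensB_assoc _ _ _)) _.
by apply: bimod_iso_trans (tensB_unitl _); apply: tensB_iso => //; exact: bimod_iso_refl.
Qed.

Lemma in_Pic_mul M N : in_Pic Dl Dr M -> in_Pic Dl Dr N -> in_Pic Dl Dr (tensB M N).
Proof.
move=> [[M' [i j]] tM uM] [[N' [k l]] tN uN]; split.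
- by exists (tensB N' M'); split; exact: tensB_cancel.
- exact: T_sharp_mul.
- exact: U_sharp_mul.
Qed.

Lemma in_Pic_inv M N : in_Pic Dl Dr M -> bimod_iso (tensB M N) (regular R) ->
  bimod_iso (tensB N M) (regular R) -> in_Pic Dl Dr N.
Proof.
move=> [_ tM uM] i j; split; first by exists M.
  exact: T_sharp_inv i tM.
exact: U_sharp_inv j uM.
Qed.

Lemma Pic_group : is_group (Pic Dl Dr).
Proof.
split=> /= [x y [M hM ->] [N hN ->]||x y z [M hM ->] [N hN ->] [P hP ->]
  |x [M hM ->]|x [M hM ->]].
- by exists (tensB M N); [exact: in_Pic_mul|exact: Pic_mulE].
- by exists (regular R) => //; exact: in_Pic1.
- by rewrite !Pic_mulE; apply: iso_class_eq; exact/bimod_iso_sym/tensB_assoc.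
- rewrite !Pic_mulE; split; apply: iso_class_eq; first exact: tensB_unitl.
  exact: tensB_unitr.
- have [[N [i j]] _ _] := hM; exists (iso_class N).
    by exists N => //; exact: in_Pic_inv hM i j.
  by rewrite !Pic_mulE; split; exact: iso_class_eq.
Qed.

End PicGroup.

(** * Morita contexts *)

Section Morita.
Variable A : pzRingType.
Implicit Types M N : bimod A A.

Record pairing (M N : bimod A A) (mu : M -> N -> A) : Prop := Pairing {
  pairDl : forall n, additive (mu^~ n);
  pairDr : forall m, additive (mu m);
  pairL : forall a m n, mu (a *> m) n = a * mu m n;
  pairR : forall m n a, mu m (n <* a) = mu m n * a;
  pairM : forall m a n, mu (m <* a) n = mu m (a *> n) }.

(** A Morita context whose two pairings are onto: the last two fields place 1 in their images. *)
Record morita (M N : bimod A A) (mu : M -> N -> A) (nu : N -> M -> A) : Prop :=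
  Morita {
  mor_mu : pairing mu;
  mor_nu : pairing nu;
  mor_munu : forall m n m', mu m n *> m' = m <* nu n m';
  mor_numu : forall n m n', nu n m *> n' = n <* mu m n';
  mor_mu1 : exists s : seq (M * N), \sum_(z <- s) mu z.1 z.2 = 1;
  mor_nu1 : exists s : seq (N * M), \sum_(z <- s) nu z.1 z.2 = 1 }.

(** Write m as 1 m with 1 a sum of values of [mu], and apply associativity to each term. *)
Lemma mor_basis M N (mu : M -> N -> A) nu : morita mu nu ->
  exists s : seq (M * N), forall m, \sum_(z <- s) z.1 <* nu z.2 m = m.
Proof.
move=> h; have [s s1] := mor_mu1 h; exists s => m.
rewrite -[RHS]lact1 -s1 (addf_sum (lactr_addD m)).
by apply: eq_bigr => z _; rewrite (mor_munu h).
Qed.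

Lemma mor_basis_l M N (mu : M -> N -> A) nu : morita mu nu ->
  exists s : seq (N * M), forall m, \sum_(z <- s) mu m z.1 *> z.2 = m.
Proof.
move=> h; have [s s1] := mor_nu1 h; exists s => m.
rewrite -[RHS]ract1 -s1 (addf_sum (ractr_addD m)).
by apply: eq_bigr => z _; rewrite (mor_munu h).
Qed.

Lemma tens_seq (X : lmodType A^c) (Y : lmodType A) (u : tensor X Y) :
  exists s : seq (X * Y), u = \sum_(z <- s) tens z.1 z.2.
Proof. by exists (repr u); rewrite -tpiE tpi_repr. Qed.

Lemma iso_pairing (M N : bimod A A) (f : tensB M N -> regular A) : bilin f ->
  pairing (fun m n => f (tens (m : right_of M) (n : left_of N))).
Proof.
move=> [fD fL fR]; split=> [n m m'|m n n'|a m n|m n a|m a n].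
- by rewrite -fD; congr f; exact: tensDl.
- by rewrite -fD; congr f; exact: tensDr.
- by rewrite -[RHS]fL; congr f; symmetry; exact: tens_lactE.
- by rewrite -[RHS]fR; congr f; symmetry; exact: tens_ractE.
- by congr f; exact: (tensZ (m : right_of M) a (n : left_of N)).
Qed.

Lemma tlift0 (X : lmodType A^c) (Y : lmodType A) (G : zmodType) (F : X -> Y -> G) :
  balanced F -> tlift F 0 = 0.
Proof. by move=> Fb; exact: (addf0 (tliftD Fb)). Qed.

Lemma tlift_sum (X : lmodType A^c) (Y : lmodType A) (G : zmodType) (F : X -> Y -> G)
    (I : Type) (s : seq I) (x : I -> X) (y : I -> Y) : balanced F ->
  tlift F (\sum_(i <- s) tens (x i) (y i)) = \sum_(i <- s) F (x i) (y i).
Proof.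
move=> Fb; rewrite (addf_sum (tliftD Fb)).
by apply: eq_bigr => i _; rewrite (tliftE Fb).
Qed.

(* The preimage t of 1 satisfies r t = t r, and m (x) n = r t for r = f (m (x) n). *)
Lemma iso_unit M N (f : tensB M N -> regular A) : bilin f -> bijective f ->
  let phi (m : M) (n : N) : A := f (tens (m : right_of M) (n : left_of N)) in
  exists s : seq (M * N), \sum_(z <- s) phi z.1 z.2 = 1 /\
  forall (G : zmodType) (F : M -> N -> G), @balanced _ (right_of M) (left_of N) G F ->
  (forall m n, F m n = \sum_(z <- s) F z.1 (z.2 <* phi m n)) /\
  (forall r, \sum_(z <- s) F (r *> z.1) z.2 = \sum_(z <- s) F z.1 (z.2 <* r)).
Proof.
move=> fl [f' fK f'K] phi; have [s sE] := tens_seq (f' 1); exists s.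
pose T (r : A) : tensB M N := \sum_(z <- s) tens (z.1 : right_of M) (z.2 <* r : left_of N).
pose T' (r : A) : tensB M N := \sum_(z <- s) tens (r *> z.1 : right_of M) (z.2 : left_of N).
have fT r : f (T r) = r.
  have -> : T r = (f' 1 : tensB M N) <* r.
    rewrite sE (addf_sum (ract_addD (M := tensB M N) r)).
    by apply: eq_bigr => z _; symmetry; exact: tens_ractE.
  by rewrite (bilinR fl) f'K; exact: mul1r.
have fT' r : f (T' r) = r.
  have -> : T' r = r *> (f' 1 : tensB M N).
    rewrite sE (addf_sum (lact_addD (M := tensB M N) r)).
    by apply: eq_bigr => z _; symmetry; exact: tens_lactE.
  by rewrite (bilinL fl) f'K; exact: mulr1.
split=> [|G F Fb].
  have <- := f'K 1; rewrite sE (addf_sum (bilinD fl)).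
  by [].
split=> [m n|r].
- rewrite -(tlift_sum s (fun z => z.1) (fun z => z.2 <* phi m n : left_of N) Fb).
  rewrite -(tliftE Fb); congr tlift; apply: (can_inj fK).
  by rewrite [RHS]fT.
- rewrite -(tlift_sum s (fun z => r *> (z.1 : M) : right_of M) (fun z => z.2) Fb).
  rewrite -(tlift_sum s (fun z => z.1) (fun z => z.2 <* r : left_of N) Fb).
  by congr tlift; apply: (can_inj fK); rewrite [LHS]fT' [RHS]fT.
Qed.

Section FromInvertible.
Variables (M N : bimod A A) (f : tensB M N -> regular A) (g : tensB N M -> regular A).
Hypotheses (fl : bilin f) (fb : bijective f) (gl : bilin g) (gb : bijective g).

Let phi (m : M) (n : N) : A := f (tens (m : right_of M) (n : left_of N)).
Let psi (n : N) (m : M) : A := g (tens (n : right_of N) (m : left_of M)).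
Let phiP : pairing phi. Proof. exact: iso_pairing. Qed.
Let psiP : pairing psi. Proof. exact: iso_pairing. Qed.

Lemma bal_ract (n : M) :
  @balanced _ (right_of M) (left_of N) M (fun x y => (x : M) <* psi y n).
Proof.
split=> [x x' y|x y y'|x a y]; first exact: ractDl.
  by rewrite (pairDl psiP) ractDr.
by rewrite [psi (a *: y) n](pairL psiP); exact: ractA.
Qed.

Lemma bal_lact (m : M) :
  @balanced _ (right_of N) (left_of M) M (fun x y => phi m x *> (y : M)).
Proof.
split=> [x x' y|x y y'|x a y]; last 1 first.
- by rewrite [phi m (_ *: x)](pairR phiP) -lactA.
- by rewrite (pairDr phiP) lactDl.
- exact: lactDr.
Qed.

Lemma bal_psi (q : N) :
  @balanced _ (right_of M) (left_of N) N (fun x y => psi q x *> (y : N)).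
Proof.
split=> [x x' y|x y y'|x a y]; last 1 first.
- by rewrite [psi q (_ *: x)](pairR psiP) -lactA.
- by rewrite (pairDr psiP) lactDl.
- exact: lactDr.
Qed.

(** The map [theta] is the composite M = R (x) M = M (x) N (x) M = M (x) R = M formed with the
    inverse of [f] and with [g]. It measures the failure of associativity: m psi(n, m') =
    theta(phi(m, n) m'). Being a bimodule automorphism with inverse [kappa], it can be absorbed into
    the first pairing, which becomes phi(theta m, n). *)
Lemma iso_morita : exists (mu : M -> N -> A) (nu : N -> M -> A), morita mu nu.
Proof.
have [s [s1 sF]] := iso_unit fl fb; have [t [t1 tF]] := iso_unit gl gb.
rewrite -/phi -/psi in s1 sF t1 tF.
pose theta n : M := \sum_(z <- s) z.1 <* psi z.2 n.
pose kappa m : M := \sum_(w <- t) phi m w.1 *> w.2.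
have thD : additive theta.
  move=> m n; rewrite -big_split; apply: eq_bigr => z _.
  by rewrite (pairDr psiP) ractDr.
have thR m a : theta (m <* a) = theta m <* a.
  rewrite (addf_sum (ract_addD a)); apply: eq_bigr => z _.
  by rewrite (pairR psiP) ractA.
have thL a m : theta (a *> m) = a *> theta m.
  rewrite (addf_sum (lact_addD a)).
  transitivity (\sum_(z <- s) (z.1 <* psi (z.2 <* a) m)).
    by apply: eq_bigr => z _; rewrite (pairM psiP).
  have [_ /(_ a) <-] := sF _ _ (bal_ract m).
  by apply: eq_bigr => z _; rewrite lractA.
have thE m n m' : m <* psi n m' = theta (phi m n *> m').
  have [/(_ m n) -> _] := sF _ _ (bal_ract m').
  by apply: eq_bigr => z _; rewrite (pairM psiP).
have kthK : cancel kappa theta.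
  move=> m; rewrite (addf_sum thD) -[RHS]ract1 -t1 (addf_sum (ractr_addD m)).
  by apply: eq_bigr => w _; rewrite thE.
(* The coefficient psi(z_2, n) is moved through the canonical element of N (x) M by [tF], which
   turns the inner sum into phi(z_1, z_2) n; these terms add up to n. *)
have thK : cancel theta kappa.
  move=> n; rewrite -[RHS]lact1 -s1 (addf_sum (lactr_addD n)).
  transitivity (\sum_(w <- t) \sum_(z <- s) phi z.1 (psi z.2 n *> w.1) *> w.2).
    apply: eq_bigr => w _; rewrite (addf_sum ((pairDl phiP) w.1)).
    rewrite (addf_sum (lactr_addD w.2)); apply: eq_bigr => z _.
    by rewrite (pairM phiP).
  rewrite exchange_big; apply: eq_bigr => z _.
  have [h k] := tF _ _ (bal_lact z.1); rewrite k -h //.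
pose mu m n := phi (theta m) n.
have muP : pairing mu.
  split=> [n m m'|m n n'|a m n|m n a|m a n]; rewrite /mu.
  - by rewrite thD (pairDl phiP).
  - exact: (pairDr phiP).
  - by rewrite thL (pairL phiP).
  - exact: (pairR phiP).
  - by rewrite thR (pairM phiP).
have munu m n m' : mu m n *> m' = m <* psi n m'.
  by apply: (can_inj thK); rewrite -thE thR.
exists mu, psi; split=> // [n m n'||]; last by exists t.
(* The defect d of the second associativity law pairs to 0 with all of M. Injectivity of [f] gives p
   (x) d = 0, hence psi(q, p) d = 0 for all q and p, and 1 is a sum of such psi(q, p). *)
- apply/eqP; rewrite -subr_eq0; apply/eqP; set d : N := _ - _.
  have d0 p : phi p d = 0.
    rewrite -[p]kthK -/(mu _ _) /d (addfB ((pairDr muP) _)) -(pairM muP) -munu.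
    by rewrite (pairL muP) (pairR muP) subrr.
  have pd0 p : tens (p : right_of M) (d : left_of N) = 0.
    have [f' fK _] := fb; apply: (can_inj fK).
    by rewrite [LHS]d0 (addf0 (bilinD fl)).
  rewrite -[LHS]lact1 -t1 (addf_sum (lactr_addD d)) big1 // => w _.
  by have := tliftE (bal_psi w.1) w.2 d; rewrite pd0 tlift0 //; exact: bal_psi.
- exists [seq (kappa z.1, z.2) | z <- s]; rewrite big_map -[RHS]s1.
  by apply: eq_bigr => z _; rewrite /mu kthK.
Qed.

End FromInvertible.
End Morita.

Lemma Pic_morita (R : pzRingType) (Dl : set (set R)) (Dr : set (set R^c)) (M : bimod R R) :
  in_Pic Dl Dr M -> exists (N : bimod R R) (mu : M -> N -> R) (nu : N -> M -> R),
  [/\ in_Pic Dl Dr N, bimod_iso (tensB M N) (regular R),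
      bimod_iso (tensB N M) (regular R) & morita mu nu].
Proof.
move=> hM; have [[N [i j]] _ _] := hM; exists N.
have [f fl fb] := bimod_isoE i; have [g gl gb] := bimod_isoE j.
have [mu [nu h]] := iso_morita fl fb gl gb; exists mu, nu; split=> //.
exact: in_Pic_inv hM i j.
Qed.

(** * Localization of invertible bimodules *)

Section RingLocalization.
Variable C : zero_cell.
Local Notation R := (zc_ring C).
Local Notation Q := (Qring C).
Local Notation iota := (@R_to_Q C).
Local Notation RR := (regular R).

Lemma ltfR (D : set R) (a b : R) : zc_l C D -> (forall x, D x -> x * a = x * b) -> a = b.
Proof.
move=> DD h; apply/eqP; rewrite -subr_eq0; apply/eqP; apply: (@zc_ltf C).
by exists D => // x Dx; apply: etrans (mulrBr _ _ _) _; rewrite h // subrr.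
Qed.

Lemma rtfR (D : set R) (a b : R) : zc_r C D -> (forall x, D x -> a * x = b * x) -> a = b.
Proof.
move=> DD h; apply/eqP; rewrite -subr_eq0; apply/eqP; apply: (@zc_rtf C).
by exists D => // x Dx; apply: etrans (mulrBl (x : R) a b) _; rewrite h // subrr.
Qed.

Lemma regular_ltf : torsion_free (zc_l C) (left_of RR).
Proof. by move=> v [I DI h]; apply: (ltfR DI) => x Ix; rewrite mulr0; exact: h. Qed.

Lemma regular_rtf : torsion_free (zc_r C) (right_of RR).
Proof. by move=> v [I DI h]; apply: (rtfR DI) => x Ix; rewrite mul0r; exact: h. Qed.

Lemma iota_inj : injective iota.
Proof.
move=> a b /clsP[[D DD [_ _ h]] _]; apply: (ltfR DD) => x Dx; exact: h.
Qed.

(** Turns the values of a component map into products in Q, so that later arguments can compute in Q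
    instead of with representatives. *)
Lemma iota_lmap (p : cpair RR) x : ldom p x -> iota x * (cls p : Q) = iota (lmap p x).
Proof.
move=> px; rewrite [LHS]Qmul_cls.
apply: (cls_eql regular_ltf); exists (ldom p); first exact: ldomP.
have [_ _ pM] := zc_lid (ldomP p).
by split=> // y py; [split=> //; exact: pM|rewrite /= lmapZ].
Qed.

Lemma iota_rmap (p : cpair RR) x : rdom p x -> (cls p : Q) * iota x = iota (rmap p x).
Proof.
move=> px; rewrite [LHS]Qmul_cls.
apply: (cls_eqr regular_rtf); exists (rdom p); first exact: rdomP.
have [_ _ pM] := zc_rid (rdomP p).
by split=> // y py; [split=> //; exact: pM|rewrite /= rmapZ].
Qed.

(** The hypothesis makes the left components agree on a smaller member of the filter, and [cls_eql]
    then identifies the classes. This is the equality test in Q. *)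
Lemma Q_ltf (D : set R) (q q' : Q) : zc_l C D ->
  (forall x, D x -> iota x * q = iota x * q') -> q = q'.
Proof.
move=> DD; elim/Qloc_ind: q => p; elim/Qloc_ind: q' => p' h.
apply: (cls_eql regular_ltf); exists (D `&` (ldom p `&` ldom p')).
  by do 2?apply: zc_lI => //; exact: ldomP.
split=> [x [_ []]|x [_ []]|x [Dx [px p'x]]] //.
by apply: iota_inj; rewrite -!iota_lmap ?h.
Qed.

Lemma Q_rtf (D : set R) (q q' : Q) : zc_r C D ->
  (forall x, D x -> q * iota x = q' * iota x) -> q = q'.
Proof.
move=> DD; elim/Qloc_ind: q => p; elim/Qloc_ind: q' => p' h.
apply: (cls_eqr regular_rtf); exists (D `&` (rdom p `&` rdom p')).
  by do 2?apply: zc_rI => //; exact: rdomP.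
split=> [x [_ []]|x [_ []]|x [Dx [px p'x]]] //.
by apply: iota_inj; rewrite -!iota_rmap ?h.
Qed.

(** Elements of D act as denominators of q. Prescribing [K] lets denominators be chained: the
    products can be made to land where the next factor is already defined. *)
Lemma Q_ldom (q : Q) (K : set R) : zc_l C K -> exists2 D : set R, zc_l C D &
  forall x, D x -> exists2 r, K r & iota x * q = iota r.
Proof.
move=> KK; elim/Qloc_ind: q => p.
exists [set x | ldom p x /\ K (lmap p x)]; first exact: comp_ldom.
by move=> x [px Kx]; exists (lmap p x) => //; exact: iota_lmap.
Qed.

Lemma Q_rdom (q : Q) (K : set R) : zc_r C K -> exists2 D : set R, zc_r C D &
  forall x, D x -> exists2 r, K r & q * iota x = iota r.
Proof.
move=> KK; elim/Qloc_ind: q => p.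
exists [set x : R | rdom p x /\ K (rmap p x)]; first exact: comp_rdom.
by move=> x [px Kx]; exists (rmap p x) => //; exact: iota_rmap.
Qed.

End RingLocalization.

Section ModuleLocalization.
Variables (C : zero_cell) (M : bimod C C).
Hypothesis hM : in_Pic (zc_l C) (zc_r C) M.
Local Notation R := (zc_ring C).
Local Notation Q := (Qring C).
Local Notation iota := (@R_to_Q C).
Local Notation RR := (regular R).
Local Notation QM := (QMbimod hM).
Local Notation emb := (@emb C M : M -> QM).

Lemma emb_inj : injective emb.
Proof.
move=> m n /clsP[[D DD [_ _ h]] _]; apply: (ltf_eq hM DD) => x Dx; exact: h.
Qed.

Lemma embD : additive emb.
Proof.
move=> m n; rewrite [RHS]clsD.
by apply: cls_eq => [||x _|x _] /=; rewrite ?setTI ?lactDr ?ractDl.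
Qed.

Lemma emb_lmap (p : cpair M) x : ldom p x -> iota x *> (cls p : QM) = emb (lmap p x).
Proof.
move=> px; apply: etrans (Qlact_cls hM _ _) _.
have [_ _ pM] := zc_lid (ldomP p).
apply: (cls_lext hM (ldomP p)) => y py; split=> //; last by rewrite /= lmapZ.
by split=> //; exact: pM.
Qed.

Lemma emb_rmap (p : cpair M) x : rdom p x -> (cls p : QM) <* iota x = emb (rmap p x).
Proof.
move=> px; apply: etrans (Qract_cls hM _ _) _.
have [_ _ pM] := zc_rid (rdomP p).
apply: (cls_rext hM (rdomP p)) => y py; split=> //; last by rewrite /= rmapZ.
by split=> //; exact: pM.
Qed.

Lemma embL x m : emb (x *> m) = iota x *> emb m.
Proof. by rewrite emb_lmap. Qed.

Lemma embR m x : emb (m <* x) = emb m <* iota x.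
Proof. by rewrite emb_rmap. Qed.

Lemma QM_ltf (D : set R) (z z' : QM) : zc_l C D ->
  (forall x, D x -> iota x *> z = iota x *> z') -> z = z'.
Proof.
move=> DD; move: z z'; apply: Qloc_ind => p; apply: Qloc_ind => p' h.
apply: (cls_eql (Pic_ltf hM)); exists (D `&` (ldom p `&` ldom p')).
  by do 2?apply: zc_lI => //; exact: ldomP.
split=> [x [_ []]|x [_ []]|x [Dx [px p'x]]] //.
by apply: emb_inj; rewrite -!emb_lmap ?h.
Qed.

Lemma QM_rtf (D : set R) (z z' : QM) : zc_r C D ->
  (forall x, D x -> z <* iota x = z' <* iota x) -> z = z'.
Proof.
move=> DD; move: z z'; apply: Qloc_ind => p; apply: Qloc_ind => p' h.
apply: (cls_eqr (Pic_rtf hM)); exists (D `&` (rdom p `&` rdom p')).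
  by do 2?apply: zc_rI => //; exact: rdomP.
split=> [x [_ []]|x [_ []]|x [Dx [px p'x]]] //.
by apply: emb_inj; rewrite -!emb_rmap ?h.
Qed.

Lemma QM_rdom (z : QM) : exists2 D : set R, zc_r C D &
  forall x, D x -> exists m, z <* iota x = emb m.
Proof.
move: z; apply: Qloc_ind => p; exists (rdom p); first exact: rdomP.
by move=> x px; exists (rmap p x); exact: emb_rmap.
Qed.

Lemma QM_ldom (z : QM) : exists2 D : set R, zc_l C D &
  forall x, D x -> exists m, iota x *> z = emb m.
Proof.
move: z; apply: Qloc_ind => p; exists (ldom p); first exact: ldomP.
by move=> x px; exists (lmap p x); exact: emb_lmap.
Qed.

End ModuleLocalization.

Section QLinear.
Variable C : zero_cell.
Local Notation Q := (Qring C).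
Local Notation iota := (@R_to_Q C).

Definition R_separated (T : bimod Q Q) := forall (D : set C) (t t' : T), zc_l C D ->
  (forall x, D x -> iota x *> t = iota x *> t') -> t = t'.

(** For x with x q in R, x F(q e) = F(x q e) = (x q) F(e); such x contain a member of the filter,
    and T is separated. *)
Lemma R_linear_Q_linear (E T : bimod Q Q) (F : E -> T) : R_separated T ->
  (forall x e, F (iota x *> e) = iota x *> F e) -> forall q e, F (q *> e) = q *> F e.
Proof.
move=> sT FR q e; have [D DD h] := Q_ldom q (zc_lT C).
apply: (sT _ _ _ DD) => x /h[r _ xq].
by rewrite -FR !lactA xq FR.
Qed.

End QLinear.

(** * Extension of a pairing to the localization *)

Section Pairing.
Variables (C : zero_cell) (M N : bimod C C) (nu : N -> M -> C).
Hypotheses (hM : in_Pic (zc_l C) (zc_r C) M) (hN : in_Pic (zc_l C) (zc_r C) N).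
Hypothesis nuP : pairing nu.
Local Notation R := (zc_ring C).
Local Notation Q := (Qring C).
Local Notation iota := (@R_to_Q C).
Local Notation RR := (regular R).
Local Notation QM := (QMbimod hM).
Local Notation emb := (@emb C M : M -> QM).

(** States that q is [n, z] through right denominators y of z. As z y lies in M for all y in a
    member of the right filter, [Q_rtf] leaves at most one such q. *)
Definition extends_pairing (n : N) (z : QM) (q : Q) :=
  forall y m, z <* iota y = emb m -> q * iota y = iota (nu n m).

(** For arbitrary y, compare q y and nu(n, m) after multiplying by those a with y a in D; they form
    a member of the right filter. *)
Lemma extends_pairingI n z q (D : set R) : zc_r C D ->
  (forall y, D y -> exists2 m, z <* iota y = emb m & q * iota y = iota (nu n m)) ->
  extends_pairing n z q.
Proof.
move=> DD h y m zy.
apply: (Q_rtf (zc_rcolon y DD)) => a /= /h[m'].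
rewrite rmorphM -ractA zy -embR => /emb_inj <-.
by rewrite mulrA => ->; rewrite (pairR nuP) rmorphM.
Qed.

(** The right component is y |-> nu(n, z y). Compatibility forces the left one: f(x) y = nu(x n, z
    y). If x n = sum_i c_i d_i with d_i in the left domain of z, then f(x) = sum_i nu(c_i, d_i z)
    works, and such x form a member of the left filter. *)
Lemma extends_pairing_ex n z : exists q, extends_pairing n z q.
Proof.
move: z; apply: Qloc_ind => p.
(* The unit of Q restricted to the left domain of p, so that [lspan_dom] applies to the set of x
   with x n in N times that domain. *)
pose q0 : cpair RR := crestr (p := cemb (1 : RR)) (ldomP p) (zc_rT C)
  (fun _ _ => I) (fun _ _ => I).
pose D : set R := [set x | ldom (cemb n) x /\
  exists w, rspan (ldom q0) (lmap q0) (lmap (cemb n) x) w].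
have DD : zc_l C D := lspan_dom hN (cemb n) q0.
pose g (y : R) : R := nu n (rmap p y).
pose isf (x r : R) := forall y : R, rdom p y -> r * y = x * g y.
have fX x : D x -> exists r, isf x r.
  move=> [_ [w [s [sp xn _]]]]; exists (\sum_(z <- s) nu z.1 (lmap p z.2)) => y py.
  rewrite mulr_suml -(pairL nuP) [x *> n]xn (addf_sum ((pairDl nuP) _)).
  apply: eq_big_seq => z /sp zp.
  by rewrite (pairM nuP) (cpairP (zp : ldom p z.2) py) (pairR nuP).
pose f x : R := xget 0 (isf x).
have fP x : D x -> isf x (f x) by move=> /fX[r hr]; exact: (xgetPex 0 (ex_intro _ r hr)).
have [D0 Dadd DM] := zc_lid DD; have [_ pD pM] := zc_rid (rdomP p).
have fD x y : D x -> D y -> f (x + y) = f x + f y.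
  move=> Dx Dy; apply: (rtfR (rdomP p)) => a pa.
  by rewrite mulrDl !fP // ?mulrDl //; exact: Dadd.
have fZ a x : D x -> f (a * x) = a * f x.
  move=> Dx; apply: (rtfR (rdomP p)) => b pb.
  by rewrite -mulrA !fP ?mulrA //; exact: DM.
have gD x y : rdom p x -> rdom p y -> g (x + y) = g x + g y.
  by move=> px py; rewrite /g rmapD // (pairDr nuP).
have gZ x a : rdom p x -> g (x * a) = g x * a.
  by move=> px; rewrite /g rmapZ // (pairR nuP).
pose q : cpair RR := @CPair C RR D f (rdom p) g DD (rdomP p) fD fZ gD gZ
  (fun x y Dx py => esym (fP x Dx y py)).
exists (cls q); apply: (extends_pairingI (rdomP p)) => y py.
exists (rmap p y); first exact: emb_rmap.
exact: (@iota_rmap _ q).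
Qed.

Definition pairQ n z : Q := xget 0 (extends_pairing n z).

Lemma pairQP n z y m : z <* iota y = emb m -> pairQ n z * iota y = iota (nu n m).
Proof. exact: (xgetPex 0 (extends_pairing_ex n z)). Qed.

(** All the identities for [pairQ] below are reduced by this to identities for [nu], by choosing
    enough right denominators of z. *)
Lemma pairQ_eq n z q (D : set R) : zc_r C D ->
  (forall y, D y -> exists2 m, z <* iota y = emb m & q * iota y = iota (nu n m)) ->
  pairQ n z = q.
Proof.
move=> DD h; apply: (Q_rtf DD) => y /h[m zy ->]; exact: pairQP.
Qed.

Lemma pairQ_emb n m : pairQ n (emb m) = iota (nu n m).
Proof.
apply: (pairQ_eq (zc_rT C)) => y _; exists (m <* y); first by rewrite embR.
by rewrite (pairR nuP) rmorphM.
Qed.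

Lemma pairQ_Dr n : additive (pairQ n).
Proof.
move=> z z'; have [D DD h] := QM_rdom z; have [D' DD' h'] := QM_rdom z'.
apply: (pairQ_eq (zc_rI DD DD')) => y [/h[m zy] /h'[m' zy']].
exists (m + m'); first by rewrite embD ractDl zy zy'.
by rewrite (pairDr nuP) rmorphD mulrDl (pairQP _ zy) (pairQP _ zy').
Qed.

Lemma pairQ_R n z q : pairQ n (z <* q) = pairQ n z * q.
Proof.
have [D DD h] := QM_rdom z; have [E EE k] := Q_rdom q DD.
apply: (pairQ_eq EE) => y /k[r /h[m zm] qy].
exists m; first by rewrite ractA qy.
by rewrite -mulrA qy (pairQP _ zm).
Qed.

Lemma pairQ_Dl z : additive (pairQ^~ z).
Proof.
move=> n n'; have [D DD h] := QM_rdom z.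
apply: (pairQ_eq DD) => y /h[m zy]; exists m => //.
by rewrite (pairDl nuP) rmorphD mulrDl !(pairQP _ zy).
Qed.

Lemma pairQ_L r n z : pairQ (r *> n) z = iota r * pairQ n z.
Proof.
have [D DD h] := QM_rdom z.
apply: (pairQ_eq DD) => y /h[m zy]; exists m => //.
by rewrite (pairL nuP) rmorphM -mulrA (pairQP _ zy).
Qed.

Lemma pairQ_M r n z : pairQ (n <* r) z = pairQ n (iota r *> z).
Proof.
have [D DD h] := QM_rdom z.
apply: (pairQ_eq DD) => y /h[m zy]; exists m => //.
by rewrite (pairM nuP); apply: pairQP; rewrite lractA zy embL.
Qed.

End Pairing.
Arguments pairQP {C M N nu} hM hN nuP n {z y m}.
Arguments pairQ_emb {C M N nu} hM hN nuP n m.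
Arguments pairQ_Dr {C M N nu} hM hN nuP n.
Arguments pairQ_Dl {C M N nu} hM hN nuP z.
Arguments pairQ_R {C M N nu} hM hN nuP n z q.
Arguments pairQ_L {C M N nu} hM hN nuP r n z.
Arguments pairQ_M {C M N nu} hM hN nuP r n z.

Section MoritaLocalization.
Variables (C : zero_cell) (M N : bimod C C) (mu : M -> N -> C) (nu : N -> M -> C).
Hypotheses (hM : in_Pic (zc_l C) (zc_r C) M) (hN : in_Pic (zc_l C) (zc_r C) N).
Hypothesis mn : morita mu nu.
Local Notation R := (zc_ring C).
Local Notation Q := (Qring C).
Local Notation iota := (@R_to_Q C).
Local Notation QM := (QMbimod hM).
Local Notation QN := (QMbimod hN).
Local Notation embM := (@emb C M : M -> QM).
Local Notation embN := (@emb C N : N -> QN).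

Let muP := mor_mu mn.
Let nuP := mor_nu mn.
Let nuQ : N -> QM -> Q := pairQ nu (hM := hM).
Let muQ : M -> QN -> Q := pairQ mu (hM := hN).

Lemma QM_basis : exists s : seq (M * N),
  (forall z : QM, \sum_(i <- s) embM i.1 <* nuQ i.2 z = z) /\
  (forall m, \sum_(i <- s) i.1 <* nu i.2 m = m).
Proof.
have [s sE] := mor_basis mn; exists s; split=> // z.
have [D DD h] := QM_rdom z; apply: (QM_rtf DD) => y /h[m zy].
rewrite (addf_sum (ract_addD (iota y))) zy -[in RHS](sE m).
rewrite (addf_sum (@embD _ _ hM)); apply: eq_bigr => i _.
by rewrite ractA (pairQP hM hN nuP _ zy) embR.
Qed.

(* As v = sum_i a_i [a'_i, v], the left pairing is (v, n) = sum_i (a_i, [a'_i, v] n). *)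
Lemma left_pairing : exists beta : QM -> N -> Q,
  [/\ forall n, additive (beta^~ n),
      forall q v n, beta (q *> v) n = q * beta v n,
      forall m n, beta (embM m) n = iota (mu m n) &
      exists t : seq (N * M), (forall v : QM, \sum_(i <- t) beta v i.1 *> embM i.2 = v)
        /\ (forall m, \sum_(i <- t) mu m i.1 *> i.2 = m)].
Proof.
have [s [sQ sE]] := QM_basis.
pose beta (v : QM) n := \sum_(i <- s) muQ i.1 (nuQ i.2 v *> embN n).
have bD n : additive (beta^~ n).
  move=> v w; rewrite -big_split; apply: eq_bigr => i _.
  by rewrite /nuQ (pairQ_Dr hM hN nuP) lactDl /muQ (pairQ_Dr hN hM muP).
have muQ_sumr m (I : Type) (r : seq I) (F : I -> QN) :
    muQ m (\sum_(i <- r) F i) = \sum_(i <- r) muQ m (F i).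
  by apply: addf_sum; exact: (pairQ_Dr hN hM muP).
have muQ_suml v (I : Type) (r : seq I) (F : I -> M) :
    muQ (\sum_(i <- r) F i) v = \sum_(i <- r) muQ (F i) v.
  by apply: (addf_sum (f := muQ^~ v)); exact: (pairQ_Dl hN hM muP).
have bE m n : beta (embM m) n = iota (mu m n).
  transitivity (muQ (\sum_(i <- s) i.1 <* nu i.2 m) (embN n)); last first.
    by rewrite sE /muQ (pairQ_emb hN hM muP).
  rewrite muQ_suml; apply: eq_bigr => i _.
  by rewrite /nuQ (pairQ_emb hM hN nuP) /muQ (pairQ_M hN hM muP).
(* The definition of [beta] uses right denominators only, so left linearity needs an argument.
   Expanding v = sum_k a_k [a'_k, v] brings x next to a_k in M; the coefficients nu(a'_i, x a_k)
   pass to the first argument of [muQ], where the sum over i collapses to x a_k. *)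
have bR x v n : beta (iota x *> v) n = iota x * beta v n.
  transitivity (\sum_(i <- s) \sum_(k <- s)
      muQ (i.1 <* nu i.2 (x *> k.1)) (nuQ k.2 v *> embN n)).
    apply: eq_bigr => i _.
    rewrite -[in LHS](sQ v) (addf_sum (lact_addD (iota x))).
    rewrite /nuQ (addf_sum (pairQ_Dr hM hN nuP i.2)) (addf_sum (lactr_addD (embN n))) muQ_sumr.
    apply: eq_bigr => k _; rewrite -lractA -embL (pairQ_R hM hN nuP).
    by rewrite (pairQ_emb hM hN nuP) /muQ (pairQ_M hN hM muP) lactA.
  rewrite exchange_big mulr_sumr; apply: eq_bigr => k _.
  by rewrite -muQ_suml sE /muQ (pairQ_L hN hM muP).
have bL q v n : beta (q *> v) n = q * beta v n.
  apply: (@R_linear_Q_linear _ QM (regular Q) (beta^~ n)) => [D t t' DD|x e].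
    exact: Q_ltf.
  exact: bR.
exists beta; split=> //.
have [t tE] := mor_basis_l mn; exists t; split=> // v.
have [D DD h] := QM_ldom v; apply: (QM_ltf DD) => x /h[m xv].
rewrite (addf_sum (lact_addD (iota x))) xv -[in RHS](tE m).
rewrite (addf_sum (@embD _ _ hM)); apply: eq_bigr => i _.
by rewrite lactA -bR xv bE embL.
Qed.

End MoritaLocalization.

(** * Right Q-linear maps out of Q(M) *)

Section Extension.
Variables (C : zero_cell) (M : bimod C C).
Hypothesis hM : in_Pic (zc_l C) (zc_r C) M.
Local Notation R := (zc_ring C).
Local Notation Q := (Qring C).
Local Notation iota := (@R_to_Q C).
Local Notation QM := (QMbimod hM).
Local Notation emb := (@emb C M : M -> QM).

Lemma QM_gen (z : QM) : exists s : seq (M * Q), z = \sum_(i <- s) emb i.1 <* i.2.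
Proof.
have [N [mu [nu [hN _ _ mn]]]] := Pic_morita hM.
have [s [sQ _]] := QM_basis hM hN mn.
exists [seq (i.1, pairQ nu i.2 z) | i <- s].
by rewrite big_map -[LHS]sQ.
Qed.

(** The formula is forced by z = sum_i a_i [a'_i, z]. *)
Lemma QM_extend (E : bimod Q Q) (j : M -> E) : additive j ->
  (forall m a, j (m <* a) = j m <* iota a) ->
  exists psi : QM -> E, [/\ additive psi, forall z q, psi (z <* q) = psi z <* q
    & forall m, psi (emb m) = j m].
Proof.
move=> jD jR; have [N [mu [nu [hN _ _ mn]]]] := Pic_morita hM.
have [s [_ sE]] := QM_basis hM hN mn; have nuP := mor_nu mn.
exists (fun z => \sum_(i <- s) j i.1 <* pairQ nu i.2 z); split=> [z z'|z q|m].
- rewrite -big_split; apply: eq_bigr => i _.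
  by rewrite (pairQ_Dr hM hN nuP) ractDr.
- rewrite (addf_sum (ract_addD q)); apply: eq_bigr => i _.
  by rewrite (pairQ_R hM hN nuP) ractA.
- rewrite -[in RHS](sE m) (addf_sum jD); apply: eq_bigr => i _.
  by rewrite (pairQ_emb hM hN nuP) jR.
Qed.

Lemma QM_ext (E : bimod Q Q) (f g : QM -> E) : additive f -> additive g ->
  (forall z q, f (z <* q) = f z <* q) -> (forall z q, g (z <* q) = g z <* q) ->
  (forall m, f (emb m) = g (emb m)) -> f =1 g.
Proof.
move=> fD gD fR gR fg z; have [s ->] := QM_gen z.
rewrite (addf_sum fD) (addf_sum gD); apply: eq_bigr => i _.
by rewrite fR gR fg.
Qed.

(** Recognition of Q(M). The extension [psi] of [j] is inverse to [phi]: one composite fixes the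
    generators j(M) of E, the other fixes M. Left Q-linearity of [phi] follows from left R-linearity
    of [j], because Q(M) is separated by left denominators. *)
Lemma QM_universal (E : bimod Q Q) (j : M -> E) (phi : E -> QM) : additive j ->
  (forall a m, j (a *> m) = iota a *> j m) ->
  (forall m a, j (m <* a) = j m <* iota a) ->
  (forall e, exists s : seq (M * Q), e = \sum_(i <- s) j i.1 <* i.2) ->
  additive phi -> (forall e q, phi (e <* q) = phi e <* q) ->
  (forall m, phi (j m) = emb m) -> bimod_iso QM E.
Proof.
move=> jD jL jR jG fD fR fj; have [psi [pD pR pj]] := QM_extend jD jR.
apply/bimod_iso_sym/(@bimod_isoI _ _ _ _ phi).
  split=> //; apply: R_linear_Q_linear => [D t t'|x e]; first exact: QM_ltf.
  have [s ->] := jG e; rewrite (addf_sum (lact_addD _)) !(addf_sum fD).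
  rewrite (addf_sum (lact_addD _)); apply: eq_bigr => i _.
  by rewrite -!lractA -jL !fR !fj embL lractA.
exists psi => [e|].
  have [s ->] := jG e; rewrite (addf_sum fD) (addf_sum pD).
  by apply: eq_bigr => i _; rewrite fR pR fj pj.
apply: QM_ext => [u v|//|z q|//|m].
- by rewrite pD fD.
- by rewrite pR fR.
- by rewrite pj fj.
Qed.

End Extension.

(** * Compatibility of localization with units, isomorphisms and tensor products *)

Section LocalizationIso.
Variable C : zero_cell.
Local Notation R := (zc_ring C).
Local Notation Q := (Qring C).
Local Notation iota := (@R_to_Q C).
Implicit Types M N : bimod C C.
Local Notation PicC := (in_Pic (zc_l C) (zc_r C)).

Lemma QM_regular (hR : PicC (regular R)) : bimod_iso (QMbimod hR) (regular Q).
Proof.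
apply: (@QM_universal C (regular R) hR (regular Q) iota
  (fun q => (@emb C (regular R) (1 : R) : QMbimod hR) <* q)) => [|a m|m a|q|u v|u q|m].
- exact: raddfD.
- exact: rmorphM.
- exact: rmorphM.
- exists [:: ((1 : R), q)]; rewrite big_seq1 /= rmorph1.
  by rewrite [RHS]mul1r.
- exact: ractDr.
- by rewrite ractA.
- rewrite -embR; congr emb; exact: mul1r.
Qed.

Lemma QM_iso M N (hM : PicC M) (hN : PicC N) : bimod_iso M N ->
  bimod_iso (QMbimod hM) (QMbimod hN).
Proof.
move=> /bimod_isoE[f fl [g fK gK]]; have gl := bilin_can fl fK gK.
have [phi [pD pR pE]] : exists phi : QMbimod hN -> QMbimod hM,
    [/\ additive phi, forall z q, phi (z <* q) = phi z <* q
      & forall n, phi (emb n) = emb (g n)].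
  apply: QM_extend => [u v|m a]; first by rewrite (bilinD gl) embD.
  by rewrite (bilinR gl) embR.
apply: (@QM_universal C M hM (QMbimod hN) (fun m => emb (f m)) phi) => // [u v|a m|m a|z|m].
- by rewrite (bilinD fl) embD.
- by rewrite (bilinL fl) embL.
- by rewrite (bilinR fl) embR.
- have [s ->] := QM_gen z; exists [seq (g i.1, i.2) | i <- s].
  by rewrite big_map; apply: eq_bigr => i _; rewrite gK.
- by rewrite pE fK.
Qed.

Section Tens.
Variables (M N : bimod C C) (hM : PicC M) (hN : PicC N) (hMN : PicC (tensB M N)).
Local Notation QM := (QMbimod hM).
Local Notation QN := (QMbimod hN).
Local Notation QMN := (QMbimod hMN).
Local Notation E := (tensB QM QN).
Local Notation tMN m n := (tens (m : right_of M) (n : left_of N) : tensB M N).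
Local Notation tQ v w := (tens (v : right_of QM) (w : left_of QN) : E).
Local Notation embM m := (@emb C M m : QM).
Local Notation embN n := (@emb C N n : QN).
Local Notation embMN u := (@emb C (tensB M N) u : QMN).

Lemma emb_tens_bal : @balanced _ (right_of M) (left_of N) E
  (fun m n => tQ (embM m) (embN n)).
Proof.
split=> [m m' n|m n n'|m a n].
- rewrite embD; exact: tensDl.
- rewrite embD; exact: tensDr.
- apply: etrans (congr1 (fun v : QM => tQ v (embN n)) (embR hM m a)) _.
  apply: etrans _ (congr1 (fun w : QN => tQ (embM m) w) (esym (embL hN a n))).
  exact: (@tensZ Q (right_of QM) (left_of QN)).
Qed.

Let j : tensB M N -> E := tlift (fun (m : right_of M) (n : left_of N) => tQ (embM m) (embN n)).

Let jD : additive j. Proof. exact: tliftD emb_tens_bal. Qed.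

Let jE (m : M) (n : N) : j (tMN m n) = tQ (embM m) (embN n).
Proof. exact: tliftE emb_tens_bal m n. Qed.

Let jL a u : j (a *> u) = iota a *> j u.
Proof.
move: u; apply: (tensB_ext (f := fun u => j (a *> u)) (g := fun u => iota a *> j u)).
- by move=> u v; rewrite lactDr jD.
- by move=> u v; rewrite jD lactDr.
move=> m n; transitivity (j (tMN (a *> m) n)); first by congr j; exact: tens_lactE.
by rewrite !jE embL; symmetry; exact: tens_lactE.
Qed.

Let jR u a : j (u <* a) = j u <* iota a.
Proof.
move: u; apply: (tensB_ext (f := fun u => j (u <* a)) (g := fun u => j u <* iota a)).
- by move=> u v; rewrite ractDl jD.
- by move=> u v; rewrite jD ractDl.
move=> m n; transitivity (j (tMN m (n <* a))); first by congr j; exact: tens_ractE.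
by rewrite !jE embR; symmetry; exact: tens_ractE.
Qed.

(** With v = sum_i m_i q_i, the q_i cross the tensor sign, and each q_i w is again a sum of terms n
    q with n in N. *)
Let jG (e : E) : exists s : seq (tensB M N * Q), e = \sum_(i <- s) j i.1 <* i.2.
Proof.
pose P (e : E) := exists s : seq (tensB M N * Q), e = \sum_(i <- s) j i.1 <* i.2.
have P0 : P 0 by exists [::]; rewrite big_nil.
have PD u v : P u -> P v -> P (u + v).
  by move=> [s ->] [t ->]; exists (s ++ t); rewrite big_cat.
apply: (@tens_ind _ (right_of QM) (left_of QN) P) => // v w.
have [s ->] := QM_gen (v : QM); rewrite tens_suml.
apply: (big_ind P) => // i _.
rewrite (tensZ (@emb _ M i.1 : right_of QM) i.2).
have [t ->] := QM_gen (i.2 *: w : QN); rewrite tens_sumr.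
apply: (big_ind P) => // k _; exists [:: (tMN i.1 k.1, k.2)].
by rewrite big_seq1 jE; symmetry; exact: tens_ractE.
Qed.

(** The map from Q(M) (x) Q(N) sends v (x) w to sum_i a_i (x) [a'_i, v] w: the dual basis moves the
    Q-coefficients of v into w. So only m (x) w with m in M needs a meaning in Q(M (x) N), and [S m]
    supplies it by extending n |-> m (x) n. *)
Lemma QM_tens : bimod_iso QMN E.
Proof.
have [N' [mu [nu [hN' _ _ mn]]]] := Pic_morita hM.
have [s [_ sE]] := QM_basis hM hN' mn; have nuP := mor_nu mn.
have SX m : exists f : QN -> QMN, [/\ additive f,
    forall z q, f (z <* q) = f z <* q & forall n, f (embN n) = embMN (tMN m n)].
  apply: QM_extend => [n n'|n a].
    by rewrite -embD; congr emb; exact: tensDr.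
  by rewrite -embR; congr emb; symmetry; exact: tens_ractE.
have [S SP] := choice SX.
have SD m : additive (S m) by case: (SP m).
have SR m z q : S m (z <* q) = S m z <* q by case: (SP m).
have SE m n : S m (embN n) = embMN (tMN m n) by case: (SP m).
have SDl z : additive (S^~ z).
  move=> m m'; move: z; apply: QM_ext => [//|u v|//|z q|n].
  - by rewrite !SD addrACA.
  - by rewrite !SR ractDl.
  - by rewrite !SE -embD; congr emb; exact: tensDl.
have SM m a z : S (m <* a) z = S m (iota a *> z).
  move: z; apply: QM_ext => [//|u v|//|z q|n].
  - by rewrite lactDr SD.
  - by rewrite -lractA SR.
  - by rewrite -embL !SE; congr emb; exact: (tensZ (m : right_of M) a (n : left_of N)).
pose F (v : right_of QM) (w : left_of QN) : QMN :=
  \sum_(i <- s) S i.1 (pairQ nu i.2 (v : QM) *> (w : QN)).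
have Fb : balanced F.
  split=> [v v' w|v w w'|v q w].
  - rewrite -big_split; apply: eq_bigr => i _.
    by rewrite (pairQ_Dr hM hN' nuP) lactDl SD.
  - rewrite -big_split; apply: eq_bigr => i _.
    by rewrite [_ *> (w + w')]lactDr SD.
  - apply: eq_bigr => i _; rewrite (pairQ_R hM hN' nuP i.2 v q).
    by rewrite -lactA.
have Femb m w : F (embM m) w = S m w.
  rewrite -[in RHS](sE m) (addf_sum (SDl w)); apply: eq_bigr => i _.
  by rewrite (pairQ_emb hM hN' nuP) SM.
apply: (@QM_universal C _ hMN E j (tlift F)) => // [u v|e q|].
- exact: (tliftD Fb).
- move: e; apply: (tensB_ext (f := fun e => tlift F (e <* q))
    (g := fun e => tlift F e <* q)).
  + by move=> u v; rewrite ractDl (tliftD Fb).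
  + by move=> u v; rewrite (tliftD Fb) ractDl.
  move=> v w; transitivity (tlift F (tQ v (w <* q))).
    by congr tlift; exact: tens_ractE.
  rewrite !(tliftE Fb) (addf_sum (ract_addD q)); apply: eq_bigr => i _.
  by rewrite -lractA SR.
- apply: (tensB_ext (f := fun u => tlift F (j u)) (g := fun u => embMN u)).
  + by move=> u v; rewrite jD (tliftD Fb).
  + exact: embD.
  + by move=> m n; rewrite jE (tliftE Fb) Femb SE.
Qed.

End Tens.
End LocalizationIso.

(** * Induced filters *)

Section Restriction.
Variables (A B : pzRingType) (f : {rmorphism A -> B}) (X : lmodType B).

Definition restr_scalars of {rmorphism A -> B} : Type := X.
Local Notation V := (restr_scalars f).
HB.instance Definition _ := GRing.Zmodule.on V.

Definition rs_scale (a : A) (x : V) : V := f a *: (x : X).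

Fact rs_scaleA a b x : rs_scale a (rs_scale b x) = rs_scale (a * b) x.
Proof. by rewrite /rs_scale scalerA rmorphM. Qed.
Fact rs_scale1 : left_id 1 rs_scale.
Proof. by move=> x; rewrite /rs_scale rmorph1; exact: scale1r. Qed.
Fact rs_scaleDr : right_distributive rs_scale +%R.
Proof. by move=> a x y; exact: scalerDr. Qed.
Fact rs_scaleDl x : {morph rs_scale^~ x : a b / a + b}.
Proof. by move=> a b; rewrite /rs_scale rmorphD; exact: scalerDl. Qed.

HB.instance Definition _ := GRing.Zmodule_isLmodule.Build A V
  rs_scaleA rs_scale1 rs_scaleDr rs_scaleDl.
End Restriction.

Section InducedFilters.
Variable C : zero_cell.
Local Notation R := (zc_ring C).
Local Notation Q := (Qring C).
Local Notation iota := (@R_to_Q C).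

(** The embedding R -> Q between the converse rings, so that right modules are restricted by the
    same construction as left ones. *)
Definition iotac (a : R^c) : Q^c := iota a.
Fact iotac_zmod : {morph iotac : a b / a - b}.
Proof. by move=> a b; exact: (rmorphB (@R_to_Q C)). Qed.
Fact iotac_monoid : GRing.monoid_morphism iotac.
Proof. by split=> [|a b]; [exact: (rmorph1 (@R_to_Q C))|exact: (rmorphM (@R_to_Q C) b a)]. Qed.
HB.instance Definition _ := GRing.isZmodMorphism.Build R^c Q^c iotac iotac_zmod.
HB.instance Definition _ := GRing.isMonoidMorphism.Build R^c Q^c iotac iotac_monoid.

Lemma set_prod_gen (A B : set Q) x y : A x -> B y -> set_prod A B (x * y).
Proof.
move=> Ax By; exists [:: (x, y)]; rewrite big_seq1; split=> // z.
by rewrite inE => /eqP ->.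
Qed.

Lemma set_prod_ind (A B P : set Q) : P 0 -> (forall x y, P x -> P y -> P (x + y)) ->
  (forall x y, A x -> B y -> P (x * y)) -> set_prod A B `<=` P.
Proof.
move=> P0 PD Pm _ [s [sAB ->]]; rewrite big_seq; apply: (big_ind P) => // z /sAB[].
exact: Pm.
Qed.

Lemma set_prod0 (A B : set Q) : set_prod A B 0.
Proof. by exists [::]; rewrite big_nil. Qed.

Lemma set_prodD (A B : set Q) x y : set_prod A B x -> set_prod A B y ->
  set_prod A B (x + y).
Proof.
move=> [s [sAB ->]] [t [tAB ->]]; exists (s ++ t); rewrite big_cat; split=> // z.
by rewrite mem_cat => /orP[/sAB|/tAB].
Qed.

Lemma set_prodL (A B : set Q) a x : (forall y, A y -> A (a * y)) ->
  set_prod A B x -> set_prod A B (a * x).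
Proof.
move=> h; move: x; apply: (set_prod_ind (P := fun x => set_prod A B (a * x))) => [|x y|x y Ax By].
- by rewrite mulr0; exact: set_prod0.
- by rewrite mulrDr; exact: set_prodD.
- by rewrite mulrA; apply: set_prod_gen => //; exact: h.
Qed.

Lemma set_prodR (A B : set Q) a x : (forall y, B y -> B (y * a)) ->
  set_prod A B x -> set_prod A B (x * a).
Proof.
move=> h; move: x; apply: (set_prod_ind (P := fun x => set_prod A B (x * a))) => [|x y|x y Ax By].
- by rewrite mul0r; exact: set_prod0.
- by rewrite mulrDl; exact: set_prodD.
- by rewrite -mulrA; apply: set_prod_gen => //; exact: h.
Qed.

(** Q D contains D, and whatever D kills is killed by Q D; torsion for the induced filter is
    therefore torsion over R. *)
Lemma killed_by_l (Y : lmodType Q) (y : Y) :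
  killed_by (@ind_l C) y <-> killed_by (zc_l C) (y : restr_scalars Y iota).
Proof.
split=> [[J [Jid [D DD DJ]] Jk]|[D DD Dk]].
- exists D => // a Da; apply: Jk; apply: DJ.
  have : set_prod setT (iota @` D) (1 * iota a) by apply: set_prod_gen => //; exists a.
  by rewrite mul1r.
- exists (set_prod setT (iota @` D)).
    split; last by exists D.
    split; [exact: set_prod0|exact: set_prodD|].
    by move=> a x; exact: set_prodL.
  apply: (set_prod_ind (P := fun a => a *: y = 0)) => [|a b|a _ _ [d Dd <-]].
  + exact: scale0r.
  + by rewrite scalerDl => -> ->; rewrite addr0.
  + by rewrite -scalerA (Dk d Dd : iota d *: y = 0) scaler0.
Qed.

Lemma killed_by_r (X : lmodType Q^c) (x : X) :
  killed_by (@ind_r C) x <-> killed_by (zc_r C) (x : restr_scalars X iotac).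
Proof.
split=> [[J [Jid [D DD DJ]] Jk]|[D DD Dk]].
- exists D => // a Da; apply: Jk; apply: DJ.
  have : set_prod (iota @` D) setT (iota a * 1) by apply: set_prod_gen => //; exists a.
  by rewrite mulr1.
- exists (set_prod (iota @` D) setT).
    split; last by exists D.
    split; [exact: set_prod0|exact: set_prodD|].
    by move=> a x'; exact: set_prodR.
  apply: (set_prod_ind (P := fun a => (a : Q^c) *: x = 0)) => [|a b|_ a [d Dd <-] _].
  + exact: scale0r.
  + by move=> a0 b0; apply: etrans (@scalerDl _ X x a b) _; rewrite a0 b0 addr0.
  + apply: etrans (esym (@scalerA _ X (a : Q^c) (iotac d) x)) _.
    by rewrite (Dk d Dd : iotac d *: x = 0) scaler0.
Qed.

Lemma torsion_indl (Y : lmodType Q) :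
  torsion (@ind_l C) Y <-> torsion (zc_l C) (restr_scalars Y iota).
Proof. by split=> h y; apply/killed_by_l; exact: h. Qed.

Lemma torsion_free_indl (Y : lmodType Q) :
  torsion_free (@ind_l C) Y <-> torsion_free (zc_l C) (restr_scalars Y iota).
Proof. by split=> h y /killed_by_l; exact: h. Qed.

Lemma torsion_indr (X : lmodType Q^c) :
  torsion (@ind_r C) X <-> torsion (zc_r C) (restr_scalars X iotac).
Proof. by split=> h y; apply/killed_by_r; exact: h. Qed.

Lemma torsion_free_indr (X : lmodType Q^c) :
  torsion_free (@ind_r C) X <-> torsion_free (zc_r C) (restr_scalars X iotac).
Proof. by split=> h y /killed_by_r; exact: h. Qed.

End InducedFilters.

(** * Base change along R -> Q and membership of Q(M) in the Picard group of Q *)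

Section LocalizedSharp.
Variables (C : zero_cell) (M : bimod C C).
Hypothesis hM : in_Pic (zc_l C) (zc_r C) M.
Local Notation R := (zc_ring C).
Local Notation Q := (Qring C).
Local Notation iota := (@R_to_Q C).
Local Notation iotac := (@iotac C).
Local Notation QM := (QMbimod hM).
Local Notation emb := (@emb C M : M -> QM).

(** The Q-coefficients of v have to move left onto X, so v is expanded as sum_i beta(v, n_i) m_i by
    the left pairing; [tensL_QM] uses the right dual basis instead. *)
Lemma tensR_QM (X : lmodType Q^c) :
  lmod_iso (tensR (restr_scalars X iotac) M) (restr_scalars (tensR X QM) iotac).
Proof.
have [N [mu [nu [hN _ _ mn]]]] := Pic_morita hM.
have [beta [bD bL bE [t [tQ tE]]]] := left_pairing hM hN mn.
have muP := mor_mu mn.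
pose X' : lmodType R^c := restr_scalars X iotac.
pose g (x : X') (m : left_of M) : tensor X (left_of QM) :=
  tens (x : X) (emb m : left_of QM).
have gb : balanced g.
  split=> [x x' m|x m m'|x a m]; first exact: tensDl.
    by rewrite /g [emb _]embD; exact: tensDr.
  rewrite /g [emb (a *: m)]embL.
  exact: (@tensZ Q X (left_of QM)).
pose f (x : X) (v : left_of QM) : tensor X' (left_of M) :=
  \sum_(i <- t) tens ((beta v i.1 : Q^c) *: x : X') (i.2 : left_of M).
have fb : balanced f.
  split=> [x x' v|x v v'|x q v].
  - rewrite -big_split; apply: eq_bigr => i _.
    by rewrite scalerDr; exact: tensDl.
  - rewrite -big_split; apply: eq_bigr => i _.
    by rewrite bD [_ *: x](@scalerDl _ X x); exact: tensDl.
  - by apply: eq_bigr => i _; rewrite scalerA [beta (q *: v) _]bL.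
apply: (@lmod_isoI _ (tensR X' M) (restr_scalars (tensR X QM) iotac) (tlift g)).
  apply: (@tensR_linI _ _ X' M (restr_scalars (tensR X QM) iotac)) => [|x m a].
    exact: (tliftD gb).
  rewrite !(tliftE gb) /g embR; symmetry; exact: tens_ractE.
exists (tlift f).
- apply: (tens_ext (g := idfun)) => [u v|//|x m]; first by rewrite (tliftD gb) (tliftD fb).
  rewrite (tliftE gb) (tliftE fb) -[in RHS](tE m) tens_sumr.
  apply: eq_bigr => i _; rewrite bE; exact: (@tensZ R X' (left_of M)).
- apply: (tens_ext (g := idfun)) => [u v|//|x v]; first by rewrite (tliftD fb) (tliftD gb).
  rewrite (tliftE fb) (addf_sum (tliftD gb)) -[in RHS](tQ v) tens_sumr.
  apply: eq_bigr => i _; rewrite (tliftE gb); exact: (@tensZ Q X (left_of QM)).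
Qed.

Lemma tensL_QM (Y : lmodType Q) :
  lmod_iso (tensL M (restr_scalars Y iota)) (restr_scalars (tensL QM Y) iota).
Proof.
have [N [mu [nu [hN _ _ mn]]]] := Pic_morita hM.
have [s [sQ sE]] := QM_basis hM hN mn; have nuP := mor_nu mn.
pose Y' : lmodType R := restr_scalars Y iota.
pose g (m : right_of M) (y : Y') : tensor (right_of QM) Y :=
  tens (emb m : right_of QM) (y : Y).
have gb : balanced g.
  split=> [m m' y|m y y'|m a y]; last 1 first.
  - apply: etrans (congr1 (fun v : QM => tens (v : right_of QM) (y : Y)) (embR hM m a)) _.
    exact: (@tensZ Q (right_of QM) Y).
  - by rewrite /g [emb _]embD; exact: tensDl.
  - exact: tensDr.
pose f (v : right_of QM) (y : Y) : tensor (right_of M) Y' :=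
  \sum_(i <- s) tens (i.1 : right_of M) (pairQ nu i.2 (v : QM) *: y : Y').
have fb : balanced f.
  split=> [v v' y|v y y'|v q y].
  - rewrite -big_split; apply: eq_bigr => i _.
    by rewrite (pairQ_Dr hM hN nuP) scalerDl; exact: tensDr.
  - rewrite -big_split; apply: eq_bigr => i _.
    by rewrite scalerDr; exact: tensDr.
  - by apply: eq_bigr => i _; rewrite (pairQ_R hM hN nuP i.2 v q) scalerA.
apply: (@lmod_isoI _ (tensL M Y') (restr_scalars (tensL QM Y) iota) (tlift g)).
  apply: (@tensL_linI _ _ M Y' (restr_scalars (tensL QM Y) iota)) => [|m y a].
    exact: (tliftD gb).
  rewrite !(tliftE gb) /g embL; symmetry; exact: tens_lactE.
exists (tlift f).
- apply: (tens_ext (g := idfun)) => [u v|//|m y]; first by rewrite (tliftD gb) (tliftD fb).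
  rewrite (tliftE gb) (tliftE fb) -[in RHS](sE m) tens_suml.
  apply: eq_bigr => i _; rewrite (pairQ_emb hM hN nuP); symmetry.
  exact: (@tensZ R (right_of M) Y').
- apply: (tens_ext (g := idfun)) => [u v|//|v y]; first by rewrite (tliftD fb) (tliftD gb).
  rewrite (tliftE fb) (addf_sum (tliftD gb)) -[in RHS](sQ v) tens_suml.
  apply: eq_bigr => i _; rewrite (tliftE gb); symmetry.
  exact: (@tensZ Q (right_of QM) Y).
Qed.

Lemma QM_preservesR : preserves (@ind_r C) (fun X => tensR X QM).
Proof.
have [_ /sharp_preserves pM _] := hM.
move=> X; have [h k] := pM (restr_scalars X iotac).
split=> [/torsion_indr|/torsion_free_indr] t.
- by apply/torsion_indr; apply: torsion_iso (tensR_QM X) _; exact: h.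
- by apply/torsion_free_indr; apply: torsion_free_iso (tensR_QM X) _; exact: k.
Qed.

Lemma QM_preservesL : preserves (@ind_l C) (fun Y => tensL QM Y).
Proof.
have [_ _ /sharp_preserves pM] := hM.
move=> X; have [h k] := pM (restr_scalars X iota).
split=> [/torsion_indl|/torsion_free_indl] t.
- by apply/torsion_indl; apply: torsion_iso (tensL_QM X) _; exact: h.
- by apply/torsion_free_indl; apply: torsion_free_iso (tensL_QM X) _; exact: k.
Qed.

End LocalizedSharp.

(** Localizing M (x) N = R shows that Q(N) is inverse to Q(M). Both functors preserve the torsion
    classes, and being mutually inverse they map them onto themselves. *)
Lemma QM_in_Pic (C : zero_cell) (M : bimod C C) (hM : in_Pic (zc_l C) (zc_r C) M) :
  in_Pic (@ind_l C) (@ind_r C) (QMbimod hM).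
Proof.
have [N [_ [_ [hN i j _]]]] := Pic_morita hM.
have QMN : forall A B (hA : in_Pic (zc_l C) (zc_r C) A) (hB : in_Pic (zc_l C) (zc_r C) B),
    bimod_iso (tensB A B) (regular C) ->
    bimod_iso (tensB (QMbimod hA) (QMbimod hB)) (regular (Qring C)).
  move=> A B hA hB k; have h1 := in_Pic1 (zc_l C) (zc_r C).
  apply: bimod_iso_trans (bimod_iso_sym (QM_tens hA hB (in_Pic_mul hA hB))) _.
  exact: bimod_iso_trans (QM_iso _ h1 k) (QM_regular _).
have QMNi := QMN _ _ hM hN i; have QNMi := QMN _ _ hN hM j.
split; first by exists (QMbimod hN).
- apply: (@preserves_sharp _ (@ind_r C) (fun X => tensR X (QMbimod hM))
    (fun X => tensR X (QMbimod hN))) => [X||].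
  + exact: tensR_cancel.
  + exact: QM_preservesR.
  + exact: QM_preservesR.
- apply: (@preserves_sharp _ (@ind_l C) (fun X => tensL (QMbimod hM) X)
    (fun X => tensL (QMbimod hN) X)) => [X||].
  + exact: tensL_cancel.
  + exact: QM_preservesL.
  + exact: QM_preservesL.
Qed.

Lemma phi3E (C : zero_cell) (M : bimod C C) (hM : in_Pic (zc_l C) (zc_r C) M) :
  phi3 (iso_class M) = iso_class (QMbimod hM).
Proof.
apply/funext => P; apply/propext; split=> [[M' [hM' [i k]]]|k].
  exact: bimod_iso_trans (QM_iso hM hM' i) k.
by exists M, hM; split=> //; exact: bimod_iso_refl.
Qed.

Lemma phi3_hom (C : zero_cell) : is_hom (PicR C) (PicQ C) (@phi3 C).
Proof.
split=> /= [x [M hM ->]|x y [M hM ->] [N hN ->]].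
  by exists (QMbimod hM); [exact: QM_in_Pic|exact: phi3E].
have hMN := in_Pic_mul hM hN.
by rewrite Pic_mulE !phi3E Pic_mulE; apply: iso_class_eq; exact: QM_tens.
Qed.

(** * The relative Picard group *)

Section SetProducts.
Variable C : zero_cell.
Local Notation R := (zc_ring C).
Local Notation Q := (Qring C).
Local Notation iota := (@R_to_Q C).
Implicit Types A B D N : set Q.

Lemma set_prodA A B D : set_prod A (set_prod B D) = set_prod (set_prod A B) D.
Proof.
apply/seteqP; split.
- apply: set_prod_ind => [|x y|x y Ax]; [exact: set_prod0|exact: set_prodD|].
  move: y; apply: set_prod_ind => [|y z|y z By Dz]; first by rewrite mulr0; exact: set_prod0.
    by rewrite mulrDr; exact: set_prodD.
  by rewrite mulrA; apply: set_prod_gen => //; exact: set_prod_gen.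
- apply: set_prod_ind => [|x y|x y ABx Dy]; [exact: set_prod0|exact: set_prodD|].
  move: x ABx; apply: set_prod_ind => [|x z|x z Ax Bz]; first by rewrite mul0r; exact: set_prod0.
    by rewrite mulrDl; exact: set_prodD.
  by rewrite -mulrA; apply: set_prod_gen => //; exact: set_prod_gen.
Qed.

Lemma set_prodS A A' B B' : A `<=` A' -> B `<=` B' -> set_prod A B `<=` set_prod A' B'.
Proof.
move=> AA BB; apply: set_prod_ind => [|x y|x y Ax By]; [exact: set_prod0|exact: set_prodD|].
by apply: set_prod_gen; [exact: AA|exact: BB].
Qed.

Lemma RinQ_iota r : RinQ (iota r). Proof. by exists r. Qed.

Lemma RinQ_sub_bimod : sub_bimod (@RinQ C).
Proof.
split=> [|_ _ [x _ <-] [y _ <-]|a _ [x _ <-]|_ a [x _ <-]].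
- by exists 0 => //; exact: rmorph0.
- by exists (x + y) => //; exact: rmorphD.
- by exists (a * x) => //; exact: rmorphM.
- by exists (x * a) => //; exact: rmorphM.
Qed.

Lemma set_prod1l N : sub_bimod N -> set_prod (@RinQ C) N = N.
Proof.
move=> hN; apply/seteqP; split=> [|x Nx].
- apply: set_prod_ind => [|x y|_ x [r _ <-]]; [exact: sb0|exact: sbD|exact: sbl].
- rewrite -[x]mul1r; apply: set_prod_gen => //.
  by exists 1 => //; exact: rmorph1.
Qed.

Lemma set_prod1r N : sub_bimod N -> set_prod N (@RinQ C) = N.
Proof.
move=> hN; apply/seteqP; split=> [|x Nx].
- apply: set_prod_ind => [|x y|x _ Nx [r _ <-]]; [exact: sb0|exact: sbD|exact: sbr].
- rewrite -[x]mulr1; apply: set_prod_gen => //.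
  by exists 1 => //; exact: rmorph1.
Qed.

Lemma set_prod_sub_bimod A B : sub_bimod A -> sub_bimod B -> sub_bimod (set_prod A B).
Proof.
move=> hA hB; split=> [|x y|a x|x a]; [exact: set_prod0|exact: set_prodD| |].
- by apply: set_prodL => y; exact: sbl.
- by apply: set_prodR => y; exact: sbr.
Qed.

Lemma set_inv_sub_bimod N : sub_bimod N -> sub_bimod (set_inv N).
Proof.
move=> hN; have hR := RinQ_sub_bimod.
split=> [m _|x y Ix Iy m Nm|a x Ix m Nm|x a Ix m Nm].
- by rewrite mul0r mulr0; split; exact: (sb0 hR).
- have [h1 h2] := Ix m Nm; have [k1 k2] := Iy m Nm.
  by rewrite mulrDl mulrDr; split; exact: (sbD hR).
- have [h1 _] := Ix m Nm; have [_ h2] := Ix _ (sbr hN a Nm).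
  by split; [rewrite -mulrA; exact: (sbl hR)|rewrite mulrA].
- have [_ h1] := Ix m Nm; have [h2 _] := Ix _ (sbl hN a Nm).
  by split; [rewrite -mulrA|rewrite mulrA; exact: (sbr hR)].
Qed.

Lemma set_prod_inv_sub N : set_prod N (set_inv N) `<=` @RinQ C.
Proof.
have hR := RinQ_sub_bimod.
apply: set_prod_ind => [|x y|x y Nx /(_ _ Nx)[]//]; [exact: sb0|exact: sbD].
Qed.

Lemma set_inv_prod_sub N : set_prod (set_inv N) N `<=` @RinQ C.
Proof.
have hR := RinQ_sub_bimod.
apply: set_prod_ind => [|x y|x y Ix /Ix[]//]; [exact: sb0|exact: sbD].
Qed.

(** Any two-sided inverse N' lies in N^{-1}, so R = N N' is contained in N N^{-1}, which lies in R;
    likewise in the other order. *)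
Lemma PicRQ_memI N N' (hN : sub_bimod N) : set_prod N N' = @RinQ C ->
  set_prod N' N = @RinQ C -> T_sharp (zc_r C) (sub_bm hN) ->
  U_sharp (zc_l C) (sub_bm hN) -> PicRQ_mem N.
Proof.
move=> e1 e2 sT sU; have N'I : N' `<=` set_inv N.
  by move=> n N'n m Nm; split; [rewrite -e2|rewrite -e1]; exact: set_prod_gen.
exists hN; split=> //; apply/seteqP; split.
- exact: set_prod_inv_sub.
- by rewrite -[X in X `<=` _]e1; apply: set_prodS.
- exact: set_inv_prod_sub.
- by rewrite -[X in X `<=` _]e2; apply: set_prodS.
Qed.

Lemma sub_bm_eq A B (hA : sub_bimod A) (hB : sub_bimod B) : A = B ->
  bimod_iso (sub_bm hA) (sub_bm hB).
Proof.
by move=> e; subst B; rewrite (Prop_irrelevance hA hB); exact: bimod_iso_refl.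
Qed.

Lemma set_prod_seq A B x : set_prod A B x ->
  exists s : seq ({x : Q | A x} * {x : Q | B x}), x = \sum_(z <- s) sval z.1 * sval z.2.
Proof.
move: x; apply: set_prod_ind => [|x y [s ->] [t ->]|x y Ax By].
- by exists [::]; rewrite big_nil.
- by exists (s ++ t); rewrite big_cat.
- by exists [:: (exist _ x Ax, exist _ y By)]; rewrite big_seq1.
Qed.

Section Embedded.
Variables (M : bimod R R) (j : M -> Q).
Hypotheses (jD : additive j) (jL : forall a m, j (a *> m) = iota a * j m)
  (jR : forall m a, j (m <* a) = j m * iota a).

Lemma range_sub_bimod : sub_bimod (range j).
Proof.
split=> [|_ _ [x _ <-] [y _ <-]|a _ [x _ <-]|_ a [x _ <-]].
- by exists 0 => //; exact: addf0.
- by exists (x + y).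
- by exists (a *> x).
- by exists (x <* a).
Qed.

Lemma range_iso N (hN : sub_bimod N) : injective j -> N = range j ->
  bimod_iso M (sub_bm hN).
Proof.
move=> jI NE; have Nj m : N (j m) by rewrite NE; exists m.
apply: (@bimod_isoI _ _ M (sub_bm hN) (fun m => exist _ (j m) (Nj m))).
  split=> [u v|a m|m a]; apply: sub_inj => /=; [exact: jD|exact: jL|exact: jR].
apply: bij_of => [m n /(congr1 sval)/jI //|[q Nq]].
by have [m _ mq] : range j q by [rewrite -NE]; exists m; exact: sub_inj.
Qed.

End Embedded.

Lemma sub_sumE N (hN : sub_bimod N) I (s : seq I) (F : I -> sub_bm hN) :
  sval (\sum_(i <- s) F i) = \sum_(i <- s) sval (F i).
Proof. by rewrite (addf_sum (f := fun x : sub_bm hN => sval x)). Qed.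

Section Invertible.
Variables (N : set Q) (hN : sub_bimod N).
Hypothesis N1 : set_prod N (set_inv N) 1.

Lemma inv_act (x a : sub_bm hN) b : set_inv N b -> N (sval a * (b * sval x)).
Proof.
move=> /(_ _ (svalP x))[[r _ <-] _]; apply: sbr => //; exact: svalP.
Qed.

(** With 1 = sum_i a_i b_i, a_i in N and b_i in N^{-1}, the inverse of multiplication is v |-> sum_i
    a_i (x) b_i v. On v = x y the scalar b_i x lies in R, so it crosses the tensor sign and the sum
    becomes x (x) y. *)
Lemma sub_bm_mul B (hB : sub_bimod B) (hNB : sub_bimod (set_prod N B)) :
  bimod_iso (tensB (sub_bm hN) (sub_bm hB)) (sub_bm hNB).
Proof.
have [s s1] := set_prod_seq N1.
have mP (x : sub_bm hN) (y : sub_bm hB) : set_prod N B (sval x * sval y).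
  by apply: set_prod_gen; exact: svalP.
pose g (x : right_of (sub_bm hN)) (y : left_of (sub_bm hB)) : sub_bm hNB :=
  exist _ (sval x * sval y) (mP x y).
have gb : balanced g.
  split=> [x x' y|x y y'|x a y]; apply: sub_inj => /=.
  - exact: mulrDl.
  - exact: mulrDr.
  - by rewrite mulrA.
have bP (b : {b | set_inv N b}) (v : sub_bm hNB) : B (sval b * sval v).
  move: (sval v) (svalP v); apply: set_prod_ind => [|x y|x y Nx By].
  - by rewrite mulr0; exact: sb0.
  - by rewrite mulrDr; exact: sbD.
  - by rewrite mulrA; have [[r _ <-] _] := svalP b _ Nx; exact: sbl.
pose act (b : {b | set_inv N b}) (v : sub_bm hNB) : sub_bm hB :=
  exist _ (sval b * sval v) (bP b v).
have actD b : additive (act b) by move=> u v; apply: sub_inj; exact: mulrDr.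
pose h (v : sub_bm hNB) : tensB (sub_bm hN) (sub_bm hB) :=
  \sum_(i <- s) tens (i.1 : right_of (sub_bm hN)) (act i.2 v : left_of (sub_bm hB)).
have hD : additive h.
  by move=> u v; rewrite -big_split; apply: eq_bigr => i _; rewrite actD; exact: tensDr.
have gK : cancel (tlift g) h.
  apply: (tens_ext (g := idfun)) => [u v|//|x y]; first by rewrite (tliftD gb) hD.
  rewrite (tliftE gb).
  pose ga (i : {x | N x} * {x | set_inv N x}) : sub_bm hN :=
    exist _ (sval i.1 * (sval i.2 * sval x)) (@inv_act x i.1 _ (svalP i.2)).
  have xE : x = \sum_(i <- s) ga i.
    apply: sub_inj; rewrite sub_sumE -[LHS]mul1r s1 mulr_suml.
    by apply: eq_bigr => i _; rewrite /= mulrA.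
  rewrite [in RHS]xE tens_suml; apply: eq_bigr => i _.
  have [[r _ ir] _] := svalP i.2 _ (svalP x).
  transitivity (tens ((r : R^c) *: (i.1 : right_of (sub_bm hN))) y); last first.
    by congr tens; apply: sub_inj; rewrite /= -ir.
  rewrite tensZ; congr tens; apply: sub_inj => /=.
  by rewrite ir mulrA.
apply: (@bimod_isoI _ _ (tensB (sub_bm hN) (sub_bm hB)) (sub_bm hNB) (tlift g)).
  apply: tensB_bilinI => [|m n a|m n a]; first exact: (tliftD gb).
    by rewrite !(tliftE gb); apply: sub_inj; rewrite /= mulrA.
  by rewrite !(tliftE gb); apply: sub_inj; rewrite /= mulrA.
apply: bij_of => [|[q q12]]; first exact: can_inj gK.
suff [u uE] : exists u, sval (tlift g u) = q by exists u; exact: sub_inj.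
move: q q12; apply: set_prod_ind => [|x y [u <-] [v <-]|x y Nx By].
- by exists 0; rewrite (addf0 (tliftD gb)).
- by exists (u + v); rewrite (tliftD gb).
- exists (tens (exist _ x Nx : right_of (sub_bm hN)) (exist _ y By : left_of (sub_bm hB))).
  by rewrite (tliftE gb).
Qed.

End Invertible.
End SetProducts.

(** * The group Pic(R|Q), and exactness at U(Z(Q)) and Pic(R|Q) *)

Section RelativePicard.
Variable C : zero_cell.
Local Notation R := (zc_ring C).
Local Notation Q := (Qring C).
Local Notation iota := (@R_to_Q C).
Local Notation RinQ := (@RinQ C).
Local Notation PicC := (in_Pic (zc_l C) (zc_r C)).
Implicit Types N : set Q.

Lemma RinQ1 : RinQ 1. Proof. by exists 1 => //; exact: rmorph1. Qed.

Lemma regular_iso N (hN : sub_bimod N) : N = RinQ -> bimod_iso (regular R) (sub_bm hN).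
Proof.
move=> NE; apply: (@range_iso C (regular R) iota) => //.
- exact: rmorphD.
- exact: rmorphM.
- exact: rmorphM.
- exact: iota_inj.
Qed.

Lemma PicRQ_sub N : PicRQ_mem N -> sub_bimod N. Proof. by case. Qed.

Lemma PicRQ_in_Pic N (hN : sub_bimod N) : PicRQ_mem N -> PicC (sub_bm hN).
Proof.
move=> [hN' [e1 e2 sT sU]]; have i := sub_bm_eq hN' hN (erefl N).
have hI := set_inv_sub_bimod hN.
split; [|exact: T_sharp_iso i sT|exact: U_sharp_iso i sU].
exists (sub_bm hI); split.
- have h := set_prod_sub_bimod hN hI.
  apply: bimod_iso_trans (@sub_bm_mul _ _ hN _ _ hI h) _.
    by rewrite e1; exact: RinQ1.
  exact/bimod_iso_sym/regular_iso.
- have h := set_prod_sub_bimod hI hN.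
  apply: bimod_iso_trans (@sub_bm_mul _ _ hI _ _ hN h) _.
    (* [sub_bm_mul] applied to N^{-1} asks for 1 in the product of N^{-1} with its own inverse,
       which contains N. *)
    have : set_prod (set_inv N) N 1 by rewrite e2; exact: RinQ1.
    by apply: set_prodS => // n Nn m Im; have [] := Im n Nn.
  exact/bimod_iso_sym/regular_iso.
Qed.

Lemma PicRQ_mem_mul N1 N2 : PicRQ_mem N1 -> PicRQ_mem N2 -> PicRQ_mem (set_prod N1 N2).
Proof.
move=> m1 m2; have [h1 [e1 f1 _ _]] := m1; have [h2 [e2 f2 _ _]] := m2.
have h := set_prod_sub_bimod h1 h2.
have k1 := set_inv_sub_bimod h1; have k2 := set_inv_sub_bimod h2.
have i : bimod_iso (tensB (sub_bm h1) (sub_bm h2)) (sub_bm h).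
  by apply: (@sub_bm_mul _ _ h1 _ _ h2 h); rewrite e1; exact: RinQ1.
have [_ sT sU] := in_Pic_iso i (in_Pic_mul (PicRQ_in_Pic h1 m1) (PicRQ_in_Pic h2 m2)).
apply: (PicRQ_memI (hN := h) (N' := set_prod (set_inv N2) (set_inv N1))) => //.
- by rewrite set_prodA -(set_prodA N1) e2 set_prod1r.
- by rewrite set_prodA -(set_prodA _ _ N1) f1 set_prod1r.
Qed.

Lemma PicRQ_mem1 : PicRQ_mem RinQ.
Proof.
have h := RinQ_sub_bimod C.
have [_ sT sU] := in_Pic_iso (regular_iso h (erefl _)) (in_Pic1 (zc_l C) (zc_r C)).
by apply: (PicRQ_memI (hN := h) (N' := RinQ)) => //; rewrite set_prod1l.
Qed.

Lemma PicRQ_mem_inv N : PicRQ_mem N -> PicRQ_mem (set_inv N).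
Proof.
move=> m; have [h [e f _ _]] := m; have k := set_inv_sub_bimod h.
have i : bimod_iso (tensB (sub_bm h) (sub_bm k)) (regular R).
  have l := set_prod_sub_bimod h k.
  apply: bimod_iso_trans (@sub_bm_mul _ _ h _ _ k l) _.
    by rewrite e; exact: RinQ1.
  exact/bimod_iso_sym/regular_iso.
have j : bimod_iso (tensB (sub_bm k) (sub_bm h)) (regular R).
  have l := set_prod_sub_bimod k h.
  apply: bimod_iso_trans (@sub_bm_mul _ _ k _ _ h l) _.
    have : set_prod (set_inv N) N 1 by rewrite f; exact: RinQ1.
    by apply: set_prodS => // n Nn m' Im; have [] := Im n Nn.
  exact/bimod_iso_sym/regular_iso.
have [_ sT sU] := in_Pic_inv (PicRQ_in_Pic h m) i j.
exact: (PicRQ_memI (hN := k) (N' := N)).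
Qed.

Lemma PicRQ_group : is_group (PicRQ C).
Proof.
split=> /= [x y|| |x hx|x hx].
- exact: PicRQ_mem_mul.
- exact: PicRQ_mem1.
- by move=> x y z _ _ _; exact: set_prodA.
- by have h := PicRQ_sub hx; rewrite set_prod1l // set_prod1r.
- by have [h [e f _ _]] := hx; exists (set_inv x) => //; exact: PicRQ_mem_inv.
Qed.

Lemma phi2E N (hN : sub_bimod N) : phi2 N = iso_class (sub_bm hN).
Proof.
apply/funext => P; apply/propext; split=> [[h i]|i]; last by exists hN.
by apply: bimod_iso_trans i; exact: sub_bm_eq.
Qed.

Lemma phi2_hom : is_hom (PicRQ C) (PicR C) (@phi2 C).
Proof.
split=> /= [x mx|x y mx my]; have hx := PicRQ_sub mx.
  by exists (sub_bm hx); [exact: PicRQ_in_Pic|exact: phi2E].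
have hy := PicRQ_sub my; have h := set_prod_sub_bimod hx hy.
rewrite (phi2E h) (phi2E hx) (phi2E hy) Pic_mulE; apply: iso_class_eq.
apply/bimod_iso_sym/sub_bm_mul; have [_ [-> _ _ _]] := mx; exact: RinQ1.
Qed.

Lemma UZ_group (A : pzRingType) : is_group (UZ A).
Proof.
split=> /= [x y [xC [x' [xx x'x]]] [yC [y' [yy y'y]]]|||x _|x [xC [x' [xx x'x]]]].
- split=> [z|]; first by rewrite -mulrA yC mulrA xC -mulrA.
  exists (y' * x'); split.
    by rewrite mulrA -(mulrA x) yy mulr1.
  by rewrite mulrA -(mulrA y') x'x mulr1.
- by split=> [y|]; [rewrite mul1r mulr1|exists 1; rewrite mulr1].
- by move=> x y z _ _ _; exact: mulrA.
- by rewrite mul1r mulr1.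
- exists x' => //; split; last by exists x.
  by move=> y; rewrite -[LHS]mulr1 -xx -mulrA (mulrA y) -xC !mulrA x'x mul1r.
Qed.

(** If d q lies in R then d x q = x d q = d q x; such d contain a member of the left filter. *)
Lemma R_commuting_central (x : Q) : (forall r, iota r * x = x * iota r) -> forall q, x * q = q * x.
Proof.
move=> h q; have [D DD k] := Q_ldom q (zc_lT C).
apply: (Q_ltf DD) => d /k[r _ dq].
by rewrite !mulrA dq h -mulrA dq h.
Qed.

Lemma phi1M (x y : Q) : (forall q, y * q = q * y) ->
  set_prod (phi1 x) (phi1 y) = phi1 (x * y).
Proof.
move=> yC; apply/seteqP; split.
- apply: set_prod_ind => [|_ _ [r _ <-] [s _ <-]|_ _ [r _ <-] [s _ <-]].
  + by exists 0 => //; rewrite rmorph0 mulr0.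
  + by exists (r + s) => //; rewrite rmorphD mulrDr.
  + exists (r * s) => //; rewrite rmorphM !mulrA; congr (_ * _).
    by rewrite -!mulrA yC.
- move=> _ [r _ <-]; rewrite -mulrA; apply: set_prod_gen.
    by exists 1 => //; rewrite rmorph1 mulr1.
  by exists r.
Qed.

Lemma phi1_1 : phi1 1 = RinQ.
Proof.
by apply/seteqP; split=> _ [r _ <-]; exists r => //; rewrite mul1r.
Qed.

(** Multiplication by x is a bimodule isomorphism from R onto xR, which transports the torsion
    conditions; the inverse of xR is x^{-1} R. *)
Lemma phi1_mem x : central_unit x -> PicRQ_mem (phi1 x) /\
  forall h : sub_bimod (phi1 x), bimod_iso (regular R) (sub_bm h).
Proof.
move=> [xC [y [xy yx]]].
have yC q : y * q = q * y.
  by rewrite -[LHS]mulr1 -xy -mulrA (mulrA q) -xC !mulrA yx mul1r.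
pose j (r : regular R) : Q := x * iota r.
have jD : additive j by move=> r s; rewrite /j rmorphD mulrDr.
have jL a (m : regular R) : j (a *> m) = iota a * j m.
  by rewrite /j rmorphM !mulrA xC.
have jR (m : regular R) a : j (m <* a) = j m * iota a.
  by rewrite /j rmorphM mulrA.
have jI : injective j.
  move=> r s /(congr1 ( *%R y)); rewrite !mulrA yx !mul1r; exact: iota_inj.
have hs : sub_bimod (phi1 x) := range_sub_bimod jD jL jR.
have i h : bimod_iso (regular R) (@sub_bm C (phi1 x) h).
  exact: (range_iso jD jL jR).
split=> //; have [_ sT sU] := in_Pic_iso (i hs) (in_Pic1 (zc_l C) (zc_r C)).
by apply: (PicRQ_memI (hN := hs) (N' := phi1 y)) => //; rewrite phi1M // ?xy ?yx phi1_1.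
Qed.

Lemma phi1_hom : is_hom (UZ Q) (PicRQ C) (@phi1 C).
Proof.
split=> /= [x hx|x y _ [yC _]]; first by case: (phi1_mem hx).
by rewrite phi1M.
Qed.

Lemma R_to_Q_hom : is_hom (UZ R) (UZ Q) iota.
Proof.
split=> /= [x [xC [y [xy yx]]]|x y _ _]; last exact: rmorphM.
split; last by exists (iota y); rewrite -!rmorphM xy yx rmorph1.
by apply: R_commuting_central => r; rewrite -!rmorphM xC.
Qed.

(** If yR = R, then y = y 1 lies in R, and 1 in yR provides its inverse there. *)
Lemma exact_UZQ : exact_at (UZ R) (UZ Q) (PicRQ C) iota (@phi1 C).
Proof.
move=> y [yC [y' [yy y'y]]] /=; split=> [[x [xC [x' [xx x'x]]] <-]|e].
  apply/seteqP; split=> _ [r _ <-]; first by rewrite -rmorphM; exact: RinQ_iota.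
  by exists (x' * r) => //; rewrite -rmorphM mulrA xx mul1r.
have [r _ ry] : RinQ y by rewrite -e; exists 1 => //; rewrite rmorph1 mulr1.
have [s _ ys] : phi1 y 1 by rewrite e; exact: RinQ1.
exists r => //; have rC t : r * t = t * r.
  by apply: iota_inj; rewrite !rmorphM /= ry yC.
split=> //; exists s; rewrite -rC; split; apply: iota_inj;
  by rewrite rmorphM rmorph1 /= ry ys.
Qed.

(** Let x be the image of 1 under a bimodule isomorphism R -> N. Then N = xR, the two linearities
    make x commute with R and hence with Q, and 1 in N N^{-1}, a subset of xQ, makes x
    invertible. *)
Lemma exact_PicRQ : exact_at (UZ Q) (PicRQ C) (PicR C) (@phi1 C) (@phi2 C).
Proof.
move=> N mN /=; split=> [[x hx <-]|].
  have [mx i] := phi1_mem hx; have h := PicRQ_sub mx.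
  by rewrite (phi2E h); apply/iso_class_eq/bimod_iso_sym.
have [hN [e1 e2 _ _]] := mN; rewrite (phi2E hN).
move=> /iso_classE/bimod_iso_sym/bimod_isoE[f fl [g fK gK]].
pose x : Q := sval (f (1 : R)).
have fxr (r : R) : sval (f r) = x * iota r.
  by rewrite -[r in LHS]mul1r (bilinR fl (1 : R) r).
have frx (r : R) : sval (f r) = iota r * x.
  by rewrite -[r in LHS]mulr1 (bilinL fl r (1 : R)).
have NE : phi1 x = N.
  apply/seteqP; split=> [_ [r _ <-]|n Nn].
    by rewrite -fxr; exact: svalP.
  by exists (g (exist _ n Nn)) => //; rewrite -fxr gK.
have xC := R_commuting_central (fun r => etrans (esym (frx r)) (fxr r)).
have [q xq] : exists q, x * q = 1.
  have : set_prod N (set_inv N) 1 by rewrite e1; exact: RinQ1.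
  move: 1; rewrite -NE; apply: (set_prod_ind (P := fun z => exists q, x * q = z)).
  - by exists 0; rewrite mulr0.
  - by move=> _ _ [q <-] [q' <-]; exists (q + q'); rewrite mulrDr.
  - by move=> _ n [r _ <-] _; exists (iota r * n); rewrite mulrA.
by exists x => //; split=> //; exists q; split=> //; rewrite -xC.
Qed.

End RelativePicard.

(** * Exactness at Pic(R, Dl, Dr) *)

Section ExactPic.
Variable C : zero_cell.
Local Notation R := (zc_ring C).
Local Notation Q := (Qring C).
Local Notation iota := (@R_to_Q C).
Local Notation RinQ := (@RinQ C).
Local Notation PicC := (in_Pic (zc_l C) (zc_r C)).

(** N generates Q because 1 = sum_i a_i b_i with a_i in N and b_i in N^{-1}; the same elements give
    the map q |-> sum_i a_i (b_i q) from Q to Q(N). *)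
Lemma QM_sub N (hN : sub_bimod N) (hM : PicC (sub_bm hN)) :
  PicRQ_mem N -> bimod_iso (QMbimod hM) (regular Q).
Proof.
move=> [_ [e1 e2 _ _]].
have [s s1] : exists s : seq ({x : Q | N x} * {x : Q | set_inv N x}),
    1 = \sum_(z <- s) sval z.1 * sval z.2.
  by apply: set_prod_seq; rewrite e1; exact: RinQ1.
pose em (n : sub_bm hN) : QMbimod hM := @emb C (sub_bm hN) n.
apply: (@QM_universal C _ hM (regular Q) (fun n : sub_bm hN => sval n)
  (fun q => \sum_(i <- s) em i.1 <* (sval i.2 * q))) => // [q|u v|e q|n].
- exists [seq (i.1 : sub_bm hN, sval i.2 * q) | i <- s].
  rewrite big_map -[LHS]mul1r s1 mulr_suml; apply: eq_bigr => i _.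
  by rewrite /= mulrA.
- by rewrite -big_split; apply: eq_bigr => i _; rewrite mulrDr ractDr.
- rewrite (addf_sum (ract_addD q)); apply: eq_bigr => i _.
  by rewrite ractA /= mulrA.
- pose ga (i : {x | N x} * {x | set_inv N x}) : sub_bm hN :=
    exist _ (sval i.1 * (sval i.2 * sval n)) (inv_act n i.1 (svalP i.2)).
  have nE : n = \sum_(i <- s) ga i.
    apply: sub_inj; rewrite sub_sumE -[LHS]mul1r s1 mulr_suml.
    by apply: eq_bigr => i _; rewrite /= mulrA.
  rewrite [in RHS]nE (addf_sum (@embD _ _ hM)); apply: eq_bigr => i _.
  have [[r _ ir] _] := svalP i.2 _ (svalP n).
  rewrite -ir -embR; congr emb; apply: sub_inj.
  by rewrite /= -ir.
Qed.

(* The map m (x) m' |-> j(m) j'(m') transported along f is r |-> u r. *)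
Lemma embedded_mul (M M' : bimod R R) (f : tensB M M' -> regular R)
    (j : M -> Q) (j' : M' -> Q) : bilin f -> bijective f ->
  additive j -> (forall a m, j (a *> m) = iota a * j m) ->
  (forall m a, j (m <* a) = j m * iota a) ->
  additive j' -> (forall a m, j' (a *> m) = iota a * j' m) ->
  (forall m a, j' (m <* a) = j' m * iota a) ->
  exists2 u : Q, (forall q, u * q = q * u) &
    forall m m', j m * j' m' = u * iota (f (tens (m : right_of M) (m' : left_of M'))).
Proof.
move=> fl [f' fK f'K] jD jL jR jD' jL' jR'; have fl' := bilin_can fl fK f'K.
pose h := fun (m : right_of M) (m' : left_of M') => j m * j' m'.
have hb : balanced h.
  split=> [x x' y|x y y'|x a y]; rewrite /h; last 1 first.
  - apply: etrans (congr1 (fun q => q * j' y) (jR x a)) _.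
    by rewrite -mulrA; congr (_ * _); rewrite -jL'.
  - by rewrite jD mulrDl.
  - by rewrite jD' mulrDr.
have hR (t : tensB M M') a : tlift h (t <* a) = tlift h t * iota a.
  move: t; apply: (tensB_ext (f := fun t => tlift h (t <* a))
    (g := fun t => tlift h t * iota a)) => [u v|u v|m m'].
  - by rewrite ractDl (tliftD hb).
  - by rewrite (tliftD hb) mulrDl.
  - by rewrite [_ <* _]tens_ractE !(tliftE hb) /h jR' mulrA.
have hL (t : tensB M M') a : tlift h (a *> t) = iota a * tlift h t.
  move: t; apply: (tensB_ext (f := fun t => tlift h (a *> t))
    (g := fun t => iota a * tlift h t)) => [u v|u v|m m'].
  - by rewrite lactDr (tliftD hb).
  - by rewrite (tliftD hb) mulrDr.
  - by rewrite [_ *> _]tens_lactE !(tliftE hb) /h jL mulrA.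
pose u := tlift h (f' (1 : R)).
have uR r : tlift h (f' r) = u * iota r.
  by rewrite -hR -(bilinR fl') /= mul1r.
have uL r : tlift h (f' r) = iota r * u.
  by rewrite -hL -(bilinL fl') /= mulr1.
exists u; first by apply: R_commuting_central => r; rewrite -uL uR.
by move=> m m'; rewrite -uR fK (tliftE hb).
Qed.

(** As [f] is onto R and simple tensors generate, the sums of the u f(m (x) m') fill uR. *)
Lemma range_mul (M M' : bimod R R) (f : tensB M M' -> regular R)
    (j : M -> Q) (j' : M' -> Q) (u : Q) : bilin f -> bijective f ->
    (forall m m', j m * j' m' = u * iota (f (tens (m : right_of M) (m' : left_of M')))) ->
  set_prod (range j) (range j') = phi1 u.
Proof.
move=> fl [f' fK f'K] jj; apply/seteqP; split.
- apply: set_prod_ind => [|_ _ [r _ <-] [s _ <-]|_ _ [m _ <-] [m' _ <-]].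
  + by exists 0 => //; rewrite rmorph0 mulr0.
  + by exists (r + s) => //; rewrite rmorphD mulrDr.
  + by rewrite jj; eexists.
- move=> _ [r _ <-]; rewrite -[r]f'K.
  apply: (@tens_ind _ (right_of M) (left_of M')
    (fun t => set_prod (range j) (range j') (u * iota (f t)))) => [|t t' h h'|m m'].
  + by rewrite (addf0 (bilinD fl)) rmorph0 mulr0; exact: set_prod0.
  + by rewrite (bilinD fl) rmorphD mulrDr; exact: set_prodD.
  + by rewrite -jj; apply: set_prod_gen; eexists.
Qed.

(* u is invertible as soon as uR meets R in a member of both filters: its
   inverse is the class of the pair of maps u r |-> r. *)
Lemma central_unitI (u : Q) (D D' H H' : set R) : (forall q, u * q = q * u) ->
  zc_l C D -> zc_l C D' -> zc_r C H -> zc_r C H' ->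
  (forall x y, D x -> D' y -> phi1 u (iota x * iota y)) ->
  (forall x y, H x -> H' y -> phi1 u (iota x * iota y)) ->
  exists w, u * w = 1.
Proof.
move=> uC DD DD' HH HH' hl hr.
pose I : set R := [set r | exists s, iota r = u * iota s].
have I0 : I 0 by exists 0; rewrite rmorph0 mulr0.
have ID x y : I x -> I y -> I (x + y).
  by move=> [s sE] [t tE]; exists (s + t); rewrite !rmorphD /= mulrDr sE tE.
have IL a x : I x -> I (a * x).
  by move=> [s sE]; exists (a * s); rewrite !rmorphM /= sE !mulrA uC.
have IR x a : I x -> I (x * a).
  by move=> [s sE]; exists (s * a); rewrite !rmorphM /= sE mulrA.
(* For y in D' the left ideal of x with x y in I contains D, so gluing over D' puts I in the left
   filter. On the right the gluing is over the first factor H. *)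
have Il : zc_l C I.
  apply: (gf_glue (zc_lP C) DD') => [|y Dy]; first by split.
  apply: (gf_up (zc_lP C) DD) => [|x Dx].
    split=> [|x x'|a x] /=; first by rewrite mul0r.
      by rewrite mulrDl; exact: ID.
    by rewrite -mulrA; exact: IL.
  have [s _ sE] := hl x y Dx Dy; exists s.
  by rewrite rmorphM /= sE.
have Ir : zc_r C I.
  apply: (gf_glue (zc_rP C) HH) => [|x Hx].
    by split=> // a x; exact: IR.
  apply: (gf_up (zc_rP C) HH') => [|y Hy].
    split=> [|y y'|a y] /=.
    - by rewrite [_ * _](mulr0 (x : R)).
    - by move=> h k; rewrite [_ * _](mulrDr (x : R)); exact: ID.
    - by move=> h; rewrite [_ * _](mulrA (x : R)); exact: IR.
  have [s _ sE] := hr x y Hx Hy; exists s.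
  by apply: etrans (rmorphM (@R_to_Q C) (x : R) (y : R)) _; rewrite /= sE.
(* Each d in I is u t' with t' in R, so d s = t' (u s) = t' (u t) = d t, and torsion-freeness
   applies. *)
have uI s t : u * iota s = u * iota t -> s = t.
  move=> e; apply: (ltfR Il) => d [t' dE]; apply: iota_inj.
  by rewrite !rmorphM /= dE uC -mulrA e mulrA -uC -dE.
pose f (r : R) : R := xget 0 (fun s => iota r = u * iota s).
have fP r : I r -> iota r = u * iota (f r).
  by move=> Ix; exact: (xgetPex 0 Ix).
have fD x y : I x -> I y -> f (x + y) = f x + f y.
  move=> Ix Iy; apply: uI; rewrite -fP; last exact: ID.
  by rewrite !rmorphD /= mulrDr -!fP.
have fL a x : I x -> f (a * x) = a * f x.
  move=> Ix; apply: uI; rewrite -fP; last exact: IL.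
  by rewrite !rmorphM /= mulrA uC -mulrA -fP.
have fR x a : I x -> f (x * a) = f x * a.
  move=> Ix; apply: uI; rewrite -fP; last exact: IR.
  by rewrite !rmorphM /= mulrA -fP.
have fC x y : I x -> I y -> x * f y = f x * y.
  move=> Ix Iy; apply: uI.
  by rewrite !rmorphM /= !mulrA uC -mulrA -!fP.
pose p : cpair (regular R) := @CPair C (regular R) I f I f Il Ir fD fL fD fR fC.
exists (cls p : Q); rewrite uC; apply: (Q_ltf Il) => x Ix.
by rewrite mulrA (@iota_lmap _ p x Ix) mulr1 /= -uC -fP.
Qed.

Lemma exact_PicR : exact_at (PicRQ C) (PicR C) (PicQ C) (@phi2 C) (@phi3 C).
Proof.
move=> c [M hM ->]; split=> [[N mN]|].
  have hN := PicRQ_sub mN; have hs := PicRQ_in_Pic hN mN.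
  rewrite (phi2E hN) => <-; rewrite (phi3E hs).
  by apply: iso_class_eq; exact: QM_sub.
rewrite (phi3E hM) => /iso_classE i.
have [M' [_ [_ [hM' iMM' iM'M _]]]] := Pic_morita hM.
(* Q(M') = Q(M') (x) Q = Q(M') (x) Q(M) = Q(M' (x) M) = Q. *)
have i' : bimod_iso (QMbimod hM') (regular Q).
  have h1 := in_Pic1 (zc_l C) (zc_r C); have hMM := in_Pic_mul hM' hM.
  apply: bimod_iso_trans (bimod_iso_sym (tensB_unitr _)) _.
  apply: bimod_iso_trans (tensB_iso (bimod_iso_refl _) (bimod_iso_sym i)) _.
  apply: bimod_iso_trans (bimod_iso_sym (QM_tens hM' hM hMM)) _.
  exact: bimod_iso_trans (QM_iso _ h1 iM'M) (QM_regular _).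
have [F Fl [F' FK F'K]] := bimod_isoE i; have [G Gl [G' GK G'K]] := bimod_isoE i'.
have [f fl fb] := bimod_isoE iMM'; have [g gl gb] := bimod_isoE iM'M.
pose em (m : M) : QMbimod hM := @emb C M m.
pose em' (m : M') : QMbimod hM' := @emb C M' m.
pose j (m : M) : Q := F (em m); pose j' (m : M') : Q := G (em' m).
have jD : additive j by move=> x y; rewrite /j /em embD (bilinD Fl).
have jL a m : j (a *> m) = iota a * j m by rewrite /j /em embL (bilinL Fl).
have jR m a : j (m <* a) = j m * iota a by rewrite /j /em embR (bilinR Fl).
have jD' : additive j' by move=> x y; rewrite /j' /em' embD (bilinD Gl).
have jL' a m : j' (a *> m) = iota a * j' m by rewrite /j' /em' embL (bilinL Gl).
have jR' m a : j' (m <* a) = j' m * iota a by rewrite /j' /em' embR (bilinR Gl).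
have jI : injective j.
  by move=> x y e; refine (@emb_inj C M hM x y _); exact: (can_inj FK) e.
(* Transports the denominators of Q(M) along [F]. At q = 1 this says that N contains a member of the
   filter. *)
have lj q : exists2 D : set R, zc_l C D & forall x, D x -> range j (iota x * q).
  have [D DD h] := QM_ldom (F' q); exists D => // x /h[m xm].
  by exists m => //; rewrite /j /em -xm (bilinL Fl) F'K.
have rj q : exists2 D : set R, zc_r C D & forall x, D x -> range j (q * iota x).
  have [D DD h] := QM_rdom (F' q); exists D => // x /h[m xm].
  by exists m => //; rewrite /j /em -xm (bilinR Fl) F'K.
have lj' q : exists2 D : set R, zc_l C D & forall x, D x -> range j' (iota x * q).
  have [D DD h] := QM_ldom (G' q); exists D => // x /h[m xm].
  by exists m => //; rewrite /j' /em' -xm (bilinL Gl) G'K.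
have rj' q : exists2 D : set R, zc_r C D & forall x, D x -> range j' (q * iota x).
  have [D DD h] := QM_rdom (G' q); exists D => // x /h[m xm].
  by exists m => //; rewrite /j' /em' -xm (bilinR Gl) G'K.
have [D DD hD] := lj 1; have [H HH hH] := rj 1.
have [u uC uE] := embedded_mul fl fb jD jL jR jD' jL' jR'.
have uP := range_mul fl fb uE.
have [w uw] : exists w, u * w = 1.
  have [D' DD' hD'] := lj' 1; have [H' HH' hH'] := rj' 1.
  apply: (central_unitI uC DD DD' HH HH') => x y hx hy; rewrite -uP;
    apply: set_prod_gen.
  - by rewrite -[iota x]mulr1; exact: hD.
  - by rewrite -[iota y]mulr1; exact: hD'.
  - by rewrite -[iota x]mul1r; exact: hH.
  - by rewrite -[iota y]mul1r; exact: hH'.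
have wC q : w * q = q * w.
  by rewrite -[LHS]mulr1 -uw -mulrA (mulrA q) -uC !mulrA -uC uw mul1r.
pose k m := w * j' m.
have kD : additive k by move=> x y; rewrite /k jD' mulrDr.
have kL a m : k (a *> m) = iota a * k m by rewrite /k jL' !mulrA wC.
have kR m a : k (m <* a) = k m * iota a by rewrite /k jR' mulrA.
have jk : set_prod (range j) (range k) = RinQ.
  rewrite -phi1_1; apply: (range_mul fl fb) => m m'.
  by rewrite /k mulrA -wC -mulrA uE mulrA wC uw.
have [v vC vE] := embedded_mul gl gb kD kL kR jD jL jR.
have vP := range_mul gl gb vE.
(* If j' m = x u then k m = w x u = x; so taking q = u in [lj'] and [rj'] shows that the range of
   [k] also contains members of both filters. *)
have [v' vv'] : exists v', v * v' = 1.
  have [D' DD' hD'] := lj' u; have [H' HH' hH'] := rj' u.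
  apply: (central_unitI vC DD' DD HH' HH) => x y hx hy; rewrite -vP;
    apply: set_prod_gen.
  - have [m _ mE] := hD' x hx; exists m => //.
    by rewrite /k mE wC -mulrA uw mulr1.
  - by rewrite -[iota y]mulr1; exact: hD.
  - have [m _ mE] := hH' x hx; exists m => //.
    by rewrite /k mE mulrA wC uw mul1r.
  - by rewrite -[iota y]mul1r; exact: hH.
have hN := range_sub_bimod jD jL jR; have hK := range_sub_bimod kD kL kR.
(* With K the range of [k] and N that of [j], (K N)(K N) = K (N K) N = K N because N K = R;
   multiplying by v' R then leaves R = K N. *)
have vv : phi1 (v * v) = phi1 v.
  rewrite -phi1M // -vP set_prodA -(set_prodA (range k)) jk.
  by rewrite set_prod1r.
have kj : set_prod (range k) (range j) = RinQ.
  have : set_prod (phi1 v') (phi1 (v * v)) = set_prod (phi1 v') (phi1 v) by rewrite vv.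
  rewrite !phi1M //; last by move=> q; rewrite -mulrA vC (vC q) -mulrA.
  have v'v : v' * v = 1 by rewrite -vC.
  by rewrite mulrA v'v mul1r phi1_1 vP.
have iN : bimod_iso M (sub_bm hN) by exact: range_iso.
have [_ sT sU] := in_Pic_iso iN hM.
exists (range j); first exact: (PicRQ_memI (hN := hN) (N' := range k)).
by rewrite (phi2E hN); apply/iso_class_eq/bimod_iso_sym.
Qed.

End ExactPic.

Theorem theorem3p3 (C : zero_cell) :
  [/\ is_group (UZ (zc_ring C)), is_group (UZ (Qring C)), is_group (PicRQ C),
      is_group (PicR C) & is_group (PicQ C)] /\
  [/\ is_hom (UZ (zc_ring C)) (UZ (Qring C)) (@R_to_Q C),
      is_hom (UZ (Qring C)) (PicRQ C) (@phi1 C),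
      is_hom (PicRQ C) (PicR C) (@phi2 C) &
      is_hom (PicR C) (PicQ C) (@phi3 C)] /\
  [/\ trivial_kernel (UZ (zc_ring C)) (UZ (Qring C)) (@R_to_Q C),
      exact_at (UZ (zc_ring C)) (UZ (Qring C)) (PicRQ C) (@R_to_Q C) (@phi1 C),
      exact_at (UZ (Qring C)) (PicRQ C) (PicR C) (@phi1 C) (@phi2 C) &
      exact_at (PicRQ C) (PicR C) (PicQ C) (@phi2 C) (@phi3 C)].
Proof.
split; [split|split; split].
- exact: UZ_group.
- exact: UZ_group.
- exact: PicRQ_group.
- exact: Pic_group.
- exact: Pic_group.
- exact: R_to_Q_hom.
- exact: phi1_hom.
- exact: phi2_hom.
- exact: phi3_hom.
- by move=> x _ /= x1; apply: iota_inj; rewrite rmorph1.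
- exact: exact_UZQ.
- exact: exact_PicRQ.
- exact: exact_PicR.
Qed.
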